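(* Let $\Omega$ be a Cantor group and let $T:\Omega\to\Omega$ be a minimal translation. There exists a dense $G_\delta$ set $\mathcal R\subseteq C(\Omega,\mathbb D)$ such that for every $f\in\mathcal R$ and every $\omega\in\Omega$, the spectrum of the extended CMV operator $\mathcal E_f=\mathcal E_{f,\omega}$ on $\ell^2(\mathbb Z)$ with Verblunsky coefficients $\alpha_n=f(T^n\omega)$, $n\in\mathbb Z$, is a Cantor set.
   Context: $\mathbb D=\{z\in\mathbb C:|z|<1\}$ and $\partial\mathbb D$ is the unit circle. A Cantor group $\Omega$ is a totally disconnected compact Abelian (Hausdorff) topological group with no isolated points. A translation is a map $T:\Omega\to\Omega$ of the form $T\omega=\omega+a$ for some $a\in\Omega$; it is minimal if the $T$-orbit $\{T^n\omega:n\in\mathbb Z\}$ of every $\omega\in\Omega$ is dense in $\Omega$. $C(\Omega,\mathbb D)$ is the set of continuous functions $\Omega\to\mathbb D$ (sampling functions) with the topology of the supremum norm. A Cantor set in $\partial\mathbb D$ is a nonempty closed subset of $\partial\mathbb D$ with empty interior (relative to $\partial\mathbb D$) and no isolated points. For a two-sided sequence $(\alpha_n)_{n\in\mathbb Z}$ in $\mathbb D$ (Verblunsky coefficients), put $\rho_n=\sqrt{1-|\alpha_n|^2}$. The extended CMV operator $\mathcal E$ is the unitary operator on $\ell^2(\mathbb Z)$ given, for every odd $n\in\mathbb Z$, by $$(\mathcal E u)_{n+1}=\bar\alpha_{n+1}\rho_n u_n-\bar\alpha_{n+1}\alpha_n u_{n+1}+\bar\alpha_{n+2}\rho_{n+1}u_{n+2}+\rho_{n+2}\rho_{n+1}u_{n+3},$$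 $$(\mathcal E u)_{n+2}=\rho_{n+1}\rho_n u_n-\rho_{n+1}\alpha_n u_{n+1}-\bar\alpha_{n+2}\alpha_{n+1}u_{n+2}-\rho_{n+2}\alpha_{n+1}u_{n+3}.$$ By minimality of $T$, the spectrum of $\mathcal E_{f,\omega}$ does not depend on $\omega$. *)

(* Defs.v *)
From HB Require Import structures.
From mathcomp Require Import all_boot all_order all_algebra.
From mathcomp Require Import all_classical all_reals all_analysis.
From mathcomp Require Import borel_hierarchy complex.
From mathcomp Require Import ring lra zify.

Set Implicit Arguments.
Unset Strict Implicit.
Unset Printing Implicit Defensive.
Import Order.TTheory GRing.Theory Num.Theory.
Import numFieldNormedType.Exports.
Local Open Scope classical_set_scope.
Local Open Scope ring_scope.

(* The library topologizes R[i] only through the key of an abstract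
   numClosedFieldType; this makes the modulus metric canonical on R[i] itself. *)
HB.instance Definition _ (R : realType) :=
  PseudoPointedMetric.copy R[i] R[i]^o.

(* The modulus with values in R; `|z| : R[i] is (normc z)%:C. *)
Notation normc := Normc.normc.

Section ell2.
Context (I : choiceType) (R : realType).
Implicit Types u v : I -> R[i].

Definition sqnorm u : \bar R := (\esum_(i in [set: I]) ((normc (u i)) ^+ 2)%:E)%E.

Definition square_summable : {pred I -> R[i]^o} := fun u => (sqnorm u < +oo)%E.

Lemma sqnorm_ge0 u : (0 <= sqnorm u)%E.
Proof. by apply: esum_ge0 => i _; rewrite lee_fin sqr_ge0. Qed.

Lemma normc_ge0 (z : R[i]) : 0 <= normc z.
Proof. by case: z => a b /=; exact: sqrtr_ge0. Qed.

Lemma normcD (z w : R[i]) : normc (z + w) <= normc z + normc w.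
Proof.
have := ler_normD z w; rewrite /Num.norm /=.
by rewrite -rmorphD lecR.
Qed.

Lemma esumZ_le (c : R) (f : I -> R) : 0 <= c -> (forall i, 0 <= f i) ->
  (\esum_(i in [set: I]) (c * f i)%:E <= c%:E * \esum_(i in [set: I]) (f i)%:E)%E.
Proof.
move=> c0 f0; apply: ge_ereal_sup => _ [A [finA AT] <-].
under eq_fsbigr do rewrite EFinM.
rewrite -ge0_mule_fsumr; last by move=> i; rewrite lee_fin.
apply: lee_pmul; rewrite ?lee_fin//.
  by apply: fsume_ge0 => i _; rewrite lee_fin.
by apply: ereal_sup_ubound; exists A.
Qed.

Lemma sqnorm_comb (c d : R) u v (w : I -> R[i]) : 0 <= c -> 0 <= d ->
  (forall i, normc (w i) ^+ 2 <= c * normc (u i) ^+ 2 + d * normc (v i) ^+ 2) ->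
  (sqnorm w <= c%:E * sqnorm u + d%:E * sqnorm v)%E.
Proof.
move=> c0 d0 H.
apply: (@le_trans _ _ (\esum_(i in [set: I])
   ((c * normc (u i) ^+ 2)%:E + (d * normc (v i) ^+ 2)%:E))%E).
  by apply: le_esum => i _; rewrite -EFinD lee_fin.
rewrite esumD; last 2 first.
- by move=> i _; rewrite lee_fin mulr_ge0// sqr_ge0.
- by move=> i _; rewrite lee_fin mulr_ge0// sqr_ge0.
by apply: leeD; apply: esumZ_le => // i; exact: sqr_ge0.
Qed.

Lemma sqnormZ_le (c : R) u (w : I -> R[i]) : 0 <= c ->
  (forall i, normc (w i) ^+ 2 <= c * normc (u i) ^+ 2) ->
  (sqnorm w <= c%:E * sqnorm u)%E.
Proof.
move=> c0 H; apply: le_trans (esumZ_le c0 (fun i => sqr_ge0 (normc (u i)))).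
by apply: le_esum => i _; rewrite lee_fin.
Qed.

Lemma square_summable_fin u : u \in square_summable -> sqnorm u \is a fin_num.
Proof. by move=> su; rewrite ge0_fin_numE// sqnorm_ge0. Qed.

Lemma square_summable_submod : submod_closed square_summable.
Proof.
split=> [|a u v su sv].
  rewrite unfold_in /= /square_summable /sqnorm esum1 ?ltry// => i _.
  by rewrite Normc.normc0 expr0n.
have H : (sqnorm (a *: u + v)%R <=
    (2 * normc a ^+ 2)%:E * sqnorm u + 2%:E * sqnorm v)%E.
  apply: sqnorm_comb; [by rewrite mulr_ge0 ?sqr_ge0|by []|move=> i].
  have := normcD (a * u i) (v i); rewrite Normc.normcM.
  have := normc_ge0 (a * u i + v i).
  have : a * u i + v i = (a *: u + v) i by [].
  move=> ->; set x := normc _; set y := _ * normc _; set z := normc (v i) => x0 xyz.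
  have : x ^+ 2 <= (y + z) ^+ 2 by rewrite ler_sqr ?nnegrE// (le_trans x0).
  move/le_trans; apply; rewrite -mulrA -exprMn -/y.
  rewrite -subr_ge0.
  suff -> : 2 * y ^+ 2 + 2 * z ^+ 2 - (y + z) ^+ 2 = (y - z) ^+ 2 by exact: sqr_ge0.
  by ring.
rewrite unfold_in /square_summable; apply: le_lt_trans H _.
by apply: lte_add_pinfty; apply: lte_mul_pinfty => //;
  rewrite lee_fin// mulr_ge0// sqr_ge0.
Qed.
HB.instance Definition _ := GRing.isSubmodClosed.Build R[i] _ square_summable
  square_summable_submod.

Record ell2 := Ell2 {
  ell2_seq :> I -> R[i]^o ; ell2P : ell2_seq \in square_summable }.
HB.instance Definition _ := [isSub for ell2_seq].
HB.instance Definition _ := [Choice of ell2 by <:].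
HB.instance Definition _ := [SubChoice_isSubLmodule of ell2 by <:].


Definition ell2_normr (u : ell2) : R := Num.sqrt (fine (sqnorm u)).

Lemma ell2_normr_sqr (u : ell2) : sqnorm u = (ell2_normr u ^+ 2)%:E.
Proof.
rewrite sqr_sqrtr ?fine_ge0 ?sqnorm_ge0// fineK//.
exact: square_summable_fin (ell2P u).
Qed.

Lemma ell2_normr_ge0 (u : ell2) : 0 <= ell2_normr u.
Proof. exact: sqrtr_ge0. Qed.

Lemma ell2_normr_eq0 (u : ell2) : ell2_normr u = 0 -> u = 0.
Proof.
move=> u0; apply/val_inj/funext => i /=.
apply: Normc.eq0_normc; apply/eqP; rewrite -sqrf_eq0 eq_le sqr_ge0 andbT.
have : (((normc (u i)) ^+ 2)%:E <= sqnorm u)%E.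
  apply: esum_ge; exists [set i]; first by split; [exact: finite_set1|].
  by rewrite fsbig_set1.
by rewrite ell2_normr_sqr u0 expr0n lee_fin.
Qed.

Lemma ell2_normrD (u v : ell2) :
  ell2_normr (u + v) <= ell2_normr u + ell2_normr v.
Proof.
have [/ell2_normr_eq0->|a0] := eqVneq (ell2_normr u) 0.
  by rewrite add0r lerDr ell2_normr_ge0.
have [/ell2_normr_eq0->|b0] := eqVneq (ell2_normr v) 0.
  by rewrite addr0 lerDl ell2_normr_ge0.
have {}a0 : 0 < ell2_normr u by rewrite lt_def a0 ell2_normr_ge0.
have {}b0 : 0 < ell2_normr v by rewrite lt_def b0 ell2_normr_ge0.
move: a0 b0; set a := ell2_normr u; set b := ell2_normr v => a0 b0.
have ab0 : 0 <= a + b by rewrite addr_ge0 ?ltW.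
suff : ell2_normr (u + v) ^+ 2 <= (a + b) ^+ 2.
  by rewrite ler_sqr ?nnegrE ?ell2_normr_ge0.
rewrite -lee_fin -ell2_normr_sqr.
have H : (sqnorm (u + v)%R <=
    (1 + b / a)%:E * sqnorm u + (1 + a / b)%:E * sqnorm v)%E.
  apply: sqnorm_comb; [by rewrite addr_ge0 ?divr_ge0 ?ltW|by rewrite addr_ge0 ?divr_ge0 ?ltW|move=> i].
  have := normcD (u i) (v i); have := normc_ge0 (u i + v i).
  have -> : u i + v i = (u + v) i by [].
  set x := normc _; set y := normc _; set z := normc _ => x0 xyz.
  apply: (@le_trans _ _ ((y + z) ^+ 2)).
    by rewrite ler_sqr ?nnegrE// (le_trans x0).
  rewrite -subr_ge0.
  suff -> : (1 + b / a) * y ^+ 2 + (1 + a / b) * z ^+ 2 - (y + z) ^+ 2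
    = (b * y - a * z) ^+ 2 / (a * b) by rewrite divr_ge0 ?sqr_ge0 ?mulr_ge0 ?ltW.
  by field; rewrite !gt_eqF.
apply: (le_trans H).
rewrite !ell2_normr_sqr -/a -/b -!EFinM -EFinD lee_fin le_eqVlt; apply/orP; left.
by apply/eqP; field; rewrite !gt_eqF.
Qed.

Lemma ell2_normrZ (l : R[i]) (u : ell2) :
  ell2_normr (l *: u) = normc l * ell2_normr u.
Proof.
have le1 (k : R[i]) (v : ell2) : ell2_normr (k *: v) <= normc k * ell2_normr v.
  suff : ell2_normr (k *: v) ^+ 2 <= (normc k * ell2_normr v) ^+ 2.
    by rewrite ler_sqr ?nnegrE ?mulr_ge0 ?normc_ge0 ?ell2_normr_ge0.
  rewrite exprMn -lee_fin -ell2_normr_sqr EFinM -ell2_normr_sqr.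
  apply: sqnormZ_le => [|i]; first by rewrite sqr_ge0.
  by rewrite -exprMn -Normc.normcM.
apply/eqP; rewrite eq_le le1/=.
have [->|l0] := eqVneq l 0.
  by rewrite Normc.normc0 mul0r ell2_normr_ge0.
have nl0 : 0 < normc l.
  by rewrite lt_def normc_ge0 andbT; apply: contra_neq l0; exact: Normc.eq0_normc.
rewrite mulrC -ler_pdivlMr// mulrC -Normc.normcV.
by have := le1 l^-1 (l *: u); rewrite scalerA mulVf// scale1r.
Qed.

(* The norm of a normedModType over R[i] takes its values in R[i]. *)
Definition ell2_norm (u : ell2) : R[i] := (ell2_normr u)%:C%C.

Lemma ell2_normD (u v : ell2) : ell2_norm (u + v) <= ell2_norm u + ell2_norm v.
Proof. by rewrite /ell2_norm -rmorphD lecR ell2_normrD. Qed.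
Lemma ell2_normZ (l : R[i]) (u : ell2) : ell2_norm (l *: u) = `|l| * ell2_norm u.
Proof. by rewrite /ell2_norm ell2_normrZ rmorphM. Qed.
Lemma ell2_norm_eq0 (u : ell2) : ell2_norm u = 0 -> u = 0.
Proof. by case=> /ell2_normr_eq0. Qed.
HB.instance Definition _ := Lmodule_isNormed.Build R[i] ell2
  ell2_normD ell2_normZ ell2_norm_eq0.

End ell2.

Section spectrum.
Context (K : numFieldType) (V : normedModType K).

(* z is in the resolvent set when A - z has an inverse among the bounded
   (i.e. continuous) linear operators. *)
Definition resolvent_set (A : V -> V) : set K :=
  [set z | exists2 B : {linear V -> V}, continuous B &
    (forall u, B (A u - z *: u) = u) /\ (forall u, A (B u) - z *: B u = u)].

Definition spectrum (A : V -> V) : set K := ~` resolvent_set A.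

End spectrum.

Definition disk (R : realType) : set R[i] := [set z | `|z| < 1].
Arguments disk : clear implicits.

Definition circle (R : realType) : set R[i] := [set z | `|z| = 1].
Arguments circle : clear implicits.

(* subspace (circle R) has the trace topology at the points of the circle, so
   for S inside the circle the fourth clause is emptiness of the relative
   interior.  Since the circle is closed, closedness in R[i] and in the circle
   agree. *)
Definition circle_cantor_set (R : realType) (S : set R[i]) :=
  [/\ S !=set0, S `<=` circle R, closed S,
      interior (S : set (subspace (circle R))) = set0 & isolated S = set0].

Section cmv.
Context (R : realType) (alpha : int -> disk R).
Implicit Types (u : int -> R[i]) (n k : int).

Let al n : R[i] := set_val (alpha n).

Definition cmv_rho n : R[i] := (Num.sqrt (1 - normc (al n) ^+ 2))%:C%C.

Local Notation rho := cmv_rho.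

(* For odd n, the entries of index n + 1 (cmv_row1) and n + 2 (cmv_row2) of the
   image of u under the extended CMV operator; see cmv_seqE. *)
Definition cmv_row1 u n : R[i] :=
  (al (n + 1))^* * rho n * u n - (al (n + 1))^* * al n * u (n + 1)
  + (al (n + 2))^* * rho (n + 1) * u (n + 2) + rho (n + 2) * rho (n + 1) * u (n + 3).

Definition cmv_row2 u n : R[i] :=
  rho (n + 1) * rho n * u n - rho (n + 1) * al n * u (n + 1)
  - (al (n + 2))^* * al (n + 1) * u (n + 2) - rho (n + 2) * al (n + 1) * u (n + 3).

Definition cmv_seq u k : R[i] :=
  if (2 %| k)%Z then cmv_row1 u (k - 1) else cmv_row2 u (k - 2).

Lemma cmv_seqE u n : ~~ (2 %| n)%Z ->
  cmv_seq u (n + 1) = cmv_row1 u n /\ cmv_seq u (n + 2) = cmv_row2 u n.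
Proof.
move=> nodd; rewrite /cmv_seq !addrK.
have -> : (2 %| n + 1)%Z by lia.
by have -> : (2 %| n + 2)%Z = false by lia.
Qed.

Lemma cmv_al_le1 n : normc (al n) <= 1.
Proof.
have : `|al n| < 1 := set_valP (alpha n).
by rewrite /Num.norm/= -(rmorph1 (real_complex R)) ltcR => /ltW.
Qed.

Lemma cmv_alJ_le1 n : normc (al n)^* <= 1.
Proof.
apply: le_trans (cmv_al_le1 n).
by rewrite -lecR; have /= := normcJ (al n); rewrite /Num.norm/= => ->.
Qed.

Lemma cmv_rho_le1 n : normc (rho n) <= 1.
Proof.
rewrite /cmv_rho /= expr0n addr0 sqrtr_sqr ger0_norm ?sqrtr_ge0//.
by rewrite -[leRHS]sqrtr1 ler_sqrt ?ler01// gerBl sqr_ge0.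
Qed.

Let le1M (a b : R[i]) : normc a <= 1 -> normc b <= 1 -> normc (a * b) <= 1.
Proof. by move=> a1 b1; rewrite Normc.normcM mulr_ile1 ?normc_ge0. Qed.

Let normcN (a : R[i]) : normc (- a) = normc a.
Proof. by case: a => x y /=; rewrite !sqrrN. Qed.

Let bound4 (a b c d x y z t : R[i]) :
  normc a <= 1 -> normc b <= 1 -> normc c <= 1 -> normc d <= 1 ->
  normc (a * x + b * y + c * z + d * t) ^+ 2 <=
  4 * (normc x ^+ 2 + normc y ^+ 2 + normc z ^+ 2 + normc t ^+ 2).
Proof.
move=> a1 b1 c1 d1.
have M (e w : R[i]) : normc e <= 1 -> normc (e * w) <= normc w.
  by move=> e1; rewrite Normc.normcM ler_piMl ?normc_ge0.
have H : normc (a * x + b * y + c * z + d * t)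
    <= normc x + normc y + normc z + normc t.
  apply: le_trans (normcD _ _) _; apply: lerD; last exact: M.
  apply: le_trans (normcD _ _) _; apply: lerD; last exact: M.
  by apply: le_trans (normcD _ _) _; apply: lerD; exact: M.
have := normc_ge0 (a * x + b * y + c * z + d * t).
move: H; set s := normc (_ + _).
move: (normc x) (normc y) (normc z) (normc t) => p q r v H s0.
apply: (@le_trans _ _ ((p + q + r + v) ^+ 2)).
  by rewrite ler_sqr ?nnegrE// (le_trans s0).
rewrite -subr_ge0.
suff -> : 4 * (p ^+ 2 + q ^+ 2 + r ^+ 2 + v ^+ 2) - (p + q + r + v) ^+ 2 =
  (p - q) ^+ 2 + (p - r) ^+ 2 + (p - v) ^+ 2 + (q - r) ^+ 2 + (q - v) ^+ 2
  + (r - v) ^+ 2 by rewrite !addr_ge0 ?sqr_ge0.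
by ring.
Qed.

Let window u k : R := \sum_(j < 5) normc (u (k + j%:Z - 2)) ^+ 2.

Let cmv_seq_window u k : normc (cmv_seq u k) ^+ 2 <= 4 * window u k.
Proof.
have H (a b c d : int) : normc (u a) ^+ 2 + normc (u b) ^+ 2 + normc (u c) ^+ 2
   + normc (u d) ^+ 2 <= window u k -> 4 * (normc (u a) ^+ 2 + normc (u b) ^+ 2
   + normc (u c) ^+ 2 + normc (u d) ^+ 2) <= 4 * window u k.
  by move=> ?; rewrite ler_pM2l.
have wE : window u k = normc (u (k - 2)) ^+ 2 + normc (u (k - 1)) ^+ 2 +
   normc (u k) ^+ 2 + normc (u (k + 1)) ^+ 2 + normc (u (k + 2)) ^+ 2.
  rewrite /window !big_ord_recr big_ord0 /= add0r.
  by do 4?[congr (_ + _)]; congr (normc (u _) ^+ 2); lia.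
rewrite /cmv_seq; case: ifP => _.
- rewrite /cmv_row1 -mulNr.
  have -> : k - 1 + 1 = k by lia.
  have -> : k - 1 + 2 = k + 1 by lia.
  have -> : k - 1 + 3 = k + 2 by lia.
  apply: le_trans (bound4 _ _ _ _ _ _ _ _) _; rewrite ?normcN.
  + by apply: le1M; rewrite ?normcN ?cmv_alJ_le1 ?cmv_rho_le1.
  + by apply: le1M; rewrite ?normcN ?cmv_alJ_le1 ?cmv_al_le1.
  + by apply: le1M; rewrite ?normcN ?cmv_alJ_le1 ?cmv_rho_le1.
  + by apply: le1M; rewrite ?normcN ?cmv_rho_le1.
  by apply: H; rewrite wE -subr_ge0; have := sqr_ge0 (normc (u (k - 2))); lra.
- rewrite /cmv_row2 -!mulNr.
  have -> : k - 2 + 1 = k - 1 by lia.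
  have -> : k - 2 + 2 = k by lia.
  have -> : k - 2 + 3 = k + 1 by lia.
  apply: le_trans (bound4 _ _ _ _ _ _ _ _) _; rewrite ?normcN.
  + by apply: le1M; rewrite ?normcN ?cmv_rho_le1.
  + by apply: le1M; rewrite ?normcN ?cmv_rho_le1 ?cmv_al_le1.
  + by apply: le1M; rewrite ?normcN ?cmv_alJ_le1 ?cmv_al_le1.
  + by apply: le1M; rewrite ?normcN ?cmv_rho_le1 ?cmv_al_le1.
  by apply: H; rewrite wE -subr_ge0; have := sqr_ge0 (normc (u (k + 2))); lra.
Qed.

Lemma sqnorm_shift u (j : int) : sqnorm (fun k => u (k + j)) = sqnorm u.
Proof.
rewrite /sqnorm; apply/esym/(reindex_esum setT setT (fun k => k + j)).
split=> [x _//|x y _ _ /addIr//|x _]; exists (x - j) => //=.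
by rewrite subrK.
Qed.

Lemma sqnorm_cmv_le u : (sqnorm (cmv_seq u) <= 20%:E * sqnorm u)%E.
Proof.
have w0 k : 0 <= window u k by apply: sumr_ge0 => j _; exact: sqr_ge0.
apply: (@le_trans _ _ (\esum_(k in [set: int]) (4 * window u k)%:E)%E).
  by apply: le_esum => k _; rewrite lee_fin.
apply: le_trans (esumZ_le _ w0) _ => //.
have -> : (\esum_(k in [set: int]) (window u k)%:E = 5%:E * sqnorm u)%E.
  rewrite /window; under eq_esum do rewrite -sumEFin.
  rewrite esum_sum; last by move=> k j _ _; rewrite lee_fin sqr_ge0.
  rewrite (eq_bigr (fun=> sqnorm u)).
    by rewrite sumr_const card_ord mule_natl.
  move=> j _; rewrite -(sqnorm_shift u (j%:Z - 2)).
  by apply: eq_esum => k _; rewrite addrA.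
by rewrite muleA -EFinM -natrM.
Qed.

Lemma cmv_summable (u : ell2 int R) :
  (cmv_seq u : int -> R[i]^o) \in @square_summable int R.
Proof.
rewrite unfold_in /square_summable; apply: le_lt_trans (sqnorm_cmv_le u) _.
by apply: lte_mul_pinfty; rewrite ?lee_fin//; exact: (ell2P u).
Qed.

Definition cmv (u : ell2 int R) : ell2 int R := Ell2 (cmv_summable u).

Lemma cmv_is_linear : linear cmv.
Proof.
move=> a u v; apply/val_inj/funext => k.
have E j : (a *: u + v) j = a * u j + v j by [].
suff : cmv_seq (a *: u + v) k = a * cmv_seq u k + cmv_seq v k by [].
by rewrite /cmv_seq; case: ifP => _; rewrite /cmv_row1 /cmv_row2 !E; ring.
Qed.
HB.instance Definition _ :=
  GRing.isLinear.Build R[i] (ell2 int R) (ell2 int R) _ cmv cmv_is_linear.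

Lemma cmv_continuous : continuous cmv.
Proof.
apply/(linear_bounded_continuous cmv)/linear_boundedP.
near=> r => u.
apply: (@le_trans _ _ (20%:R * `|u|)); last first.
  by rewrite ler_wpM2r//; near: r; apply: nbhs_pinfty_ge; exact: realn.
have -> : 20%:R = (20%:R : R)%:C%C :> R[i] by rewrite rmorph_nat.
rewrite /Num.norm /= /ell2_norm -rmorphM lecR.
suff : ell2_normr (cmv u) ^+ 2 <= (20 * ell2_normr u) ^+ 2.
  by rewrite ler_sqr ?nnegrE ?mulr_ge0 ?ell2_normr_ge0.
apply: (@le_trans _ _ (20 * ell2_normr u ^+ 2)).
  rewrite -lee_fin -ell2_normr_sqr EFinM -ell2_normr_sqr.
  exact: sqnorm_cmv_le.
by rewrite exprMn ler_wpM2r ?sqr_ge0// -natrX ler_nat.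
Unshelve. all: by end_near. Qed.

End cmv.

Definition cantor_group (G : topologicalZmodType) : Prop :=
  [/\ compact [set: G], hausdorff_space G, totally_disconnected [set: G]
    & isolated [set: G] = set0].

Section translation.
Context (G : topologicalZmodType).
Implicit Types (a w : G) (n : int).

Definition translation a : G -> G := fun w => w + a.

(* The n-th iterate of w |-> w + a for n in Z; see translation_iterE. *)
Definition translation_iter a n : G -> G :=
  match n with
  | Posz m => iter m (translation a)
  | Negz m => iter m.+1 (translation (- a))
  end.

Lemma translationK a : cancel (translation a) (translation (- a)).
Proof. by move=> w; rewrite /translation addrK. Qed.

Lemma translation_iterE a n w : translation_iter a n w = w + a *~ n.
Proof.
have E (b : G) m : iter m (translation b) w = w + b *+ m.
  by elim: m => [|m IH]; rewrite ?mulr0n ?addr0// iterS IH /translation mulrSr addrA.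
by case: n => m; rewrite /translation_iter E// NegzE mulrNz mulNrn pmulrn.
Qed.

Definition minimal_translation a : Prop :=
  forall w, dense (range (fun n => translation_iter a n w)).

End translation.

Definition verblunsky (R : realType) (G : topologicalZmodType)
    (f : G -> disk R) (a w : G) : int -> disk R :=
  fun n => f (translation_iter a n w).

Import ArrowAsUniformType.

(* For compact G this is the topology of the supremum norm on C(G, disk). *)
Lemma nbhs_samplingE (R : realType) (G : topologicalType)
    (f : continuousType G (disk R)) (P : set (continuousType G (disk R))) :
  nbhs f P <-> exists2 e : R, 0 < e &
    forall g : continuousType G (disk R),
      (forall w, normc (set_val (f w) - set_val (g w)) < e) -> P g.
Proof.
rewrite -nbhs_entourageE; split.
  move=> [A [/= B [C [D entD DC] CB] BA] AP].
  move: entD; rewrite -entourage_ballE => -[[e1 e2] /= e0 eD].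
  move: e0; rewrite ltcE /= => /andP[/eqP e20 e0]; rewrite {}e20 in eD.
  exists e1 => // g fg; apply: AP; apply/xsectionP; apply: BA; apply: CB => /= w.
  apply: DC; apply: eD; rewrite /= /ball /= /Num.norm /=.
  by rewrite (ltcR (normc _) e1); exact: fg.
move=> [e e0 eP].
pose D : set (R[i] * R[i]) := [set xy | ball xy.1 (e%:C%C) xy.2].
have entD : entourage D.
  by rewrite -entourage_ballE; exists (e%:C%C) => //=; rewrite ltcR.
pose E := [set fg : continuousType G (disk R) * continuousType G (disk R) |
  forall w : G, D (set_val (fg.1 w), set_val (fg.2 w))].
exists E.
  exists [set fg : (G -> disk R) * (G -> disk R) |
    forall w, D (set_val (fg.1 w), set_val (fg.2 w))] => //.
  exists [set xy | D (set_val xy.1, set_val xy.2)] => //.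
  by exists D.
move=> g /xsectionP/= H; apply: eP => w.
by move: (H w); rewrite /D /= /ball /= /Num.norm /= (ltcR (normc _) e).
Qed.

(* Main.v *)
Require Import Defs.
From HB Require Import structures.
From mathcomp Require Import all_boot all_order all_algebra.
From mathcomp Require Import all_classical all_reals all_analysis.
From mathcomp Require Import borel_hierarchy complex.
From mathcomp Require Import ring lra zify.

Set Implicit Arguments.
Unset Strict Implicit.
Unset Printing Implicit Defensive.
Import Order.TTheory GRing.Theory Num.Theory.
Import numFieldNormedType.Exports.
Import ArrowAsUniformType.
Local Open Scope classical_set_scope.
Local Open Scope ring_scope.

(* Write E for the CMV operator of f, a surjective isometry, so that z is
   outside the spectrum iff ||E u - z u|| >= c ||u|| for some c > 0.

   The spectrum has no isolated points, whatever f is.  At an isolated point z0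
   every approximate eigenvector is close to the kernel of E - z0.  Since f is
   almost periodic along the orbit, the translates of a kernel vector by almost
   periods are approximate kernel vectors; three such translates far apart give
   three independent kernel vectors, whereas the kernel has dimension at most two.

   It remains to make the resolvent set dense in the circle for generic f.  Having
   a gap at a point of a given arc is an open condition, so by Baire's theorem it
   is enough to open a gap after a small perturbation of f.  First make f constant
   on the cosets of an open subgroup, so that the coefficients have a period p.  A
   point z = w^2 of the circle is in the resolvent set when the trace of the period
   transfer matrix, which lies in SU(1,1), exceeds 2 in absolute value.  If the
   trace stays in [-2, 2] on the arc, it is there a nonconstant continuous function
   and hence, for all large k, takes a value 2 cos(pi j / k) at which the k-th
   power of the transfer matrix is 1 or -1.  Changing only the coefficients at the
   multiples of k p, by an arbitrarily small amount, then multiplies the matrix of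
   period k p by a hyperbolic matrix and opens a gap. *)

(** * Square-summable sequences and isometries *)

(** No spectral theorem is invoked. Its role is taken by the averages of [z ^- j E ^ j], whose mean
    square over the dyadic roots of unity follows from the parallelogram law. The kernel has
    dimension at most two because the Szego recursion recovers an eigenvector from its pair of
    components at one site. Writing the spectral parameter as [w ^ 2] gives this recursion the same
    form at even and odd sites, so periods of either parity are allowed. The trace is not constant
    on an arc because its product with [w ^ p] is a polynomial in [w] of degree exactly [2 p]. The
    factor [k] is not free: the available periods are the return times to open subgroups, which can
    only be forced to be large, so a suitable point of the arc is needed for every large [k]. Where
    the power is 1 or -1, the unchanged part of the period is, up to sign, the inverse of the old
    Szego matrix; what remains is a quotient of two distinct Szego matrices, and this is always
    hyperbolic. Functions with values in the open disk do not form a complete space, so the Baire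
    argument also has to keep the limit away from the unit circle. *)

Section complex_modulus.
Context {R : realType}.
Implicit Types x y z : R[i].

Lemma normcN z : normc (- z) = normc z.
Proof. by case: z => a b /=; rewrite !sqrrN. Qed.

Lemma normcBC x y : normc (x - y) = normc (y - x).
Proof. by rewrite -normcN opprB. Qed.

Lemma normcB x y : normc (x - y) <= normc x + normc y.
Proof. by rewrite -[normc y]normcN normcD. Qed.

Lemma normc_real (a : R) : normc a%:C%C = `|a|.
Proof. by rewrite /= expr0n addr0 sqrtr_sqr. Qed.

Lemma sqr_normcE z : normc z ^+ 2 = complex.Re z ^+ 2 + complex.Im z ^+ 2.
Proof. by case: z => a b /=; rewrite sqr_sqrtr// addr_ge0 ?sqr_ge0. Qed.

Lemma normc_conj z : normc z^* = normc z.
Proof. by case: z => a b /=; rewrite sqrrN. Qed.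

Lemma normcX z n : normc (z ^+ n) = normc z ^+ n.
Proof.
elim: n => [|n IH]; first by rewrite !expr0 Normc.normc1.
by rewrite !exprS Normc.normcM IH.
Qed.

Lemma sqr_normc_conj z : (normc z ^+ 2)%:C%C = z * z^*.
Proof. by rewrite rmorphXn/= -sqr_normc. Qed.

Lemma normc_parallelogram x y : normc (x + y) ^+ 2 + normc (x - y) ^+ 2 =
  2 * normc x ^+ 2 + 2 * normc y ^+ 2.
Proof. by rewrite !sqr_normcE; case: x y => a b [c d] /=; ring. Qed.

Lemma sqr_normcD_le x y : normc (x + y) ^+ 2 <= 2 * normc x ^+ 2 + 2 * normc y ^+ 2.
Proof. by rewrite -normc_parallelogram lerDl sqr_ge0. Qed.

Lemma normc_le_ReIm z : normc z <= `|complex.Re z| + `|complex.Im z|.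
Proof.
suff : normc z ^+ 2 <= (`|complex.Re z| + `|complex.Im z|) ^+ 2.
  by rewrite ler_sqr ?nnegrE ?normc_ge0 ?addr_ge0.
rewrite sqr_normcE -[complex.Re z ^+ 2]real_normK ?num_real//.
rewrite -[complex.Im z ^+ 2]real_normK ?num_real// sqrrD.
by rewrite -addrAC lerDl mulrn_wge0// mulr_ge0.
Qed.

Lemma ler_Re_normc z : `|complex.Re z| <= normc z.
Proof.
suff : `|complex.Re z| ^+ 2 <= normc z ^+ 2.
  by rewrite ler_sqr ?nnegrE ?normc_ge0.
by rewrite sqr_normcE real_normK ?num_real// lerDl sqr_ge0.
Qed.

Lemma ler_Im_normc z : `|complex.Im z| <= normc z.
Proof.
suff : `|complex.Im z| ^+ 2 <= normc z ^+ 2.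
  by rewrite ler_sqr ?nnegrE ?normc_ge0.
by rewrite sqr_normcE real_normK ?num_real// lerDr sqr_ge0.
Qed.

Lemma circleP z : circle R z <-> normc z = 1.
Proof.
rewrite /circle /= /Num.norm /=; split=> [[]//|->].
by [].
Qed.

Lemma diskP z : disk R z <-> normc z < 1.
Proof. by rewrite /disk /= /Num.norm /= -(rmorph1 (real_complex R)) ltcR. Qed.

(* No convergence of [e] is needed: [l] is any point in all the intervals
   [x n - e n, x n + e n], which meet pairwise. *)
Lemma real_cauchy_approx (x e : nat -> R) :
  (forall n m, (n <= m)%N -> `|x m - x n| <= e n) ->
  exists l, forall n, `|l - x n| <= e n.
Proof.
move=> H; pose S := [set y | exists n, y = x n - e n].
have key n m : x n - e n <= x m + e m.
  have := H n (maxn n m) (leq_maxl _ _); have := H m (maxn n m) (leq_maxr _ _).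
  by rewrite !ler_norml => /andP[? ?] /andP[? ?]; lra.
have S0 : S !=set0 by exists (x 0%N - e 0%N); exists 0%N.
exists (sup S) => n; rewrite ler_norml; apply/andP; split.
  suff : x n - e n <= sup S by lra.
  apply: ub_le_sup; last by exists n.
  by exists (x 0%N + e 0%N) => _ [m ->].
by rewrite lerBlDl; apply: ge_sup => // _ [m ->].
Qed.

Lemma complex_cauchy_approx (x : nat -> R[i]) (e : nat -> R) :
  (forall n m, (n <= m)%N -> normc (x m - x n) <= e n) ->
  exists l, forall n, normc (l - x n) <= 2 * e n.
Proof.
move=> H.
have [a Ha] : exists a, forall n, `|a - complex.Re (x n)| <= e n.
  apply: real_cauchy_approx => n m nm; apply: le_trans (H _ _ nm).
  by apply: le_trans (ler_Re_normc _); case: (x m) (x n) => [? ?] [].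
have [b Hb] : exists b, forall n, `|b - complex.Im (x n)| <= e n.
  apply: real_cauchy_approx => n m nm; apply: le_trans (H _ _ nm).
  by apply: le_trans (ler_Im_normc _); case: (x m) (x n) => [? ?] [].
exists (Complex a b) => n; apply: le_trans (normc_le_ReIm _) _.
have := Ha n; have := Hb n; case: (x n) => c d /=; lra.
Qed.

End complex_modulus.

Section ell2_basics.
Context {I : choiceType} {R : realType}.
Implicit Types (u v : ell2 I R) (s : seq I).

Lemma sum_le_sqnorm (u : I -> R[i]) s : uniq s ->
  ((\sum_(i <- s) normc (u i) ^+ 2)%:E <= sqnorm u)%E.
Proof.
move=> us; apply: esum_ge; exists [set` s]; first by split.
by rewrite -fsbig_seq// sumEFin.
Qed.

Lemma sqnorm_le (u : I -> R[i]) (c : R) :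
  (forall s, uniq s -> \sum_(i <- s) normc (u i) ^+ 2 <= c) ->
  (sqnorm u <= c%:E)%E.
Proof.
move=> H; apply: ge_ereal_sup => _ [A [finA _] <-].
rewrite fsbig_finite//= sumEFin lee_fin; apply: H; exact: finmap.fset_uniq.
Qed.

Lemma ler_ell2_normr (u : ell2 I R) (c : R) : 0 <= c ->
  (sqnorm u <= (c ^+ 2)%:E)%E -> ell2_normr u <= c.
Proof.
move=> c0; rewrite ell2_normr_sqr lee_fin.
by rewrite ler_sqr ?nnegrE ?ell2_normr_ge0.
Qed.

Lemma sum_le_ell2_normr u s : uniq s ->
  \sum_(i <- s) normc (u i) ^+ 2 <= ell2_normr u ^+ 2.
Proof. by move=> us; rewrite -lee_fin -ell2_normr_sqr sum_le_sqnorm. Qed.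

Lemma normc_le_ell2_normr u i : normc (u i) <= ell2_normr u.
Proof.
have := @sum_le_ell2_normr u [:: i] isT.
by rewrite big_seq1 ler_sqr ?nnegrE ?normc_ge0 ?ell2_normr_ge0.
Qed.

Lemma ell2_addE u v i : (u + v) i = u i + v i. Proof. by []. Qed.
Lemma ell2_oppE u i : (- u) i = - u i. Proof. by []. Qed.
Lemma ell2_subE u v i : (u - v) i = u i - v i. Proof. by []. Qed.
Lemma ell2_scaleE (c : R[i]) u i : (c *: u) i = c * u i. Proof. by []. Qed.

Definition ell2E := (ell2_addE, ell2_oppE, ell2_scaleE).

Lemma ell2_ext u v : (forall i, u i = v i) -> u = v.
Proof. by move=> uv; apply/val_inj/funext. Qed.

Lemma ell2_normr0 : ell2_normr (0 : ell2 I R) = 0.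
Proof. by rewrite -(scale0r (0 : ell2 I R)) ell2_normrZ Normc.normc0 mul0r. Qed.

Lemma ell2_normrN u : ell2_normr (- u) = ell2_normr u.
Proof. by rewrite -scaleN1r ell2_normrZ normcN Normc.normc1 mul1r. Qed.

Lemma ell2_normrBC u v : ell2_normr (u - v) = ell2_normr (v - u).
Proof. by rewrite -ell2_normrN opprB. Qed.

Lemma ell2_normrB u v : ell2_normr (u - v) <= ell2_normr u + ell2_normr v.
Proof. by rewrite -[ell2_normr v]ell2_normrN ell2_normrD. Qed.

Lemma ell2_normrB_ge u v : ell2_normr u - ell2_normr v <= ell2_normr (u - v).
Proof. by rewrite lerBlDr -{1}(subrK v u) ell2_normrD. Qed.

(** No inner product is defined: the contraction estimate for half sums of an isometry and the
    Parseval identity for dyadic averages both rest on this law. *)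
Lemma ell2_parallelogram u v : ell2_normr (u + v) ^+ 2 + ell2_normr (u - v) ^+ 2 =
  2 * ell2_normr u ^+ 2 + 2 * ell2_normr v ^+ 2.
Proof.
have sq (w : ell2 I R) : (0 <= sqnorm w)%E by exact: sqnorm_ge0.
have nn (w : ell2 I R) i : [set: I] i -> (0 <= (normc (w i) ^+ 2)%:E)%E.
  by rewrite lee_fin sqr_ge0.
apply/EFin_inj; rewrite [LHS]EFinD [RHS]EFinD !mulr_natl !mulr2n !EFinD.
rewrite -!ell2_normr_sqr /sqnorm -!esumD//.
apply: eq_esum => i _; rewrite -!EFinD; congr EFin.
by rewrite ell2_addE ell2_subE normc_parallelogram; ring.
all: by move=> i _; rewrite ?adde_ge0 ?lee_fin ?sqr_ge0.
Qed.

Lemma ell2_normr_le_pointwise u v :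
  (forall i, normc (u i) <= normc (v i)) -> ell2_normr u <= ell2_normr v.
Proof.
move=> H; apply: ler_ell2_normr; first exact: ell2_normr_ge0.
rewrite -ell2_normr_sqr; apply: le_esum => i _.
by rewrite lee_fin ler_sqr ?nnegrE ?normc_ge0.
Qed.

Lemma square_summable_le (u : I -> R[i]^o) v (c : R) : 0 <= c ->
  (forall i, normc (u i) <= c * normc (v i)) -> u \in @square_summable I R.
Proof.
move=> c0 H; rewrite unfold_in /square_summable.
apply: (@le_lt_trans _ _ ((c ^+ 2)%:E * sqnorm v)%E).
  apply: sqnormZ_le => [|i]; first exact: sqr_ge0.
  by rewrite -exprMn ler_sqr ?nnegrE ?mulr_ge0 ?normc_ge0.
by apply: lte_mul_pinfty; rewrite ?lee_fin ?sqr_ge0//; exact: (ell2P v).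
Qed.

(** A finite set carries all but [e ^+ 2] of the squared norm, so no coordinate outside it can have
    modulus [e] or more. *)
Lemma ell2_tail u (e : R) : 0 < e ->
  exists s : seq I, forall i, i \notin s -> normc (u i) < e.
Proof.
move=> e0.
have fin : sqnorm u \is a fin_num by exact: square_summable_fin (ell2P u).
have [_ [A [finA _] <-] Alt] := ub_ereal_sup_adherent (exprn_gt0 2 e0) fin.
exists (finmap.enum_fset (fset_set A)) => i iA; rewrite -(@ltr_pXn2r _ 2) ?nnegrE ?normc_ge0 ?ltW//.
have := @sum_le_sqnorm u (i :: finmap.enum_fset (fset_set A)); rewrite /= iA finmap.fset_uniq => /(_ isT).
move: Alt; rewrite -[ereal_sup _]/(sqnorm u) ell2_normr_sqr fsbig_finite//= sumEFin.
by rewrite big_cons EFinD -EFinB lte_fin lee_fin; lra.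
Qed.

End ell2_basics.

Section ell2_complete.
Context {I : choiceType} {R : realType}.

(** The limit is taken coordinatewise; comparison with a late term [u m] on each finite set of
    coordinates turns the coordinatewise bounds into a norm bound. *)
Lemma ell2_cauchy_approx (u : nat -> ell2 I R) (e : nat -> R) :
  (forall n m, (n <= m)%N -> ell2_normr (u m - u n) <= e n) ->
  (forall d, 0 < d -> exists N, forall n, (N <= n)%N -> e n < d) ->
  exists l : ell2 I R, forall n, ell2_normr (l - u n) <= 2 * e n.
Proof.
move=> H e0.
have en n : 0 <= e n by apply: le_trans (H n n (leqnn _)); exact: ell2_normr_ge0.
have /boolp.choice[l Hl] : forall i, exists l : R[i], forall n, normc (l - u n i) <= 2 * e n.
  move=> i; apply: complex_cauchy_approx => n m nm.
  by apply: le_trans (H _ _ nm); rewrite -ell2_subE normc_le_ell2_normr.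
have key n : (sqnorm (fun i => l i - u n i)%R <= ((2 * e n) ^+ 2)%:E)%E.
  apply: sqnorm_le => s us; apply/ler_addgt0Pr => d d0.
  (* With [e m < Num.min 1 c] the square [e m ^+ 2] is below [c], and the coordinatewise errors on
     [s] add up to at most [d]. *)
  pose c : R := d / (8 * (size s).+1%:R).
  have c0 : 0 < c by rewrite divr_gt0// mulr_gt0// ltr0Sn.
  have [N HN] : exists N, forall n, (N <= n)%N -> e n < Num.min 1 c.
    by apply: e0; rewrite lt_min ltr01.
  set m := maxn N n.
  have /HN : (N <= m)%N by rewrite leq_maxl.
  rewrite lt_min => /andP[m1 mc].
  apply: (@le_trans _ _ (\sum_(i <- s) (2 * (2 * e m) ^+ 2 + 2 * normc ((u m - u n) i) ^+ 2))).
    apply: ler_sum => i _;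
      apply: le_trans (_ : _ <= 2 * normc (l i - u m i) ^+ 2 + 2 * normc ((u m - u n) i) ^+ 2) _.
      apply: le_trans (sqr_normcD_le _ _); rewrite ell2_subE.
      by rewrite addrA subrK.
    rewrite lerD2r ler_pM2l// ler_sqr ?nnegrE ?normc_ge0//.
    by apply: le_trans (Hl i m); exact: normc_ge0.
  rewrite big_split/=.
  have : \sum_(i <- s) normc ((u m - u n) i) ^+ 2 <= e n ^+ 2.
    apply: le_trans (sum_le_ell2_normr _ us) _.
    by rewrite ler_sqr ?nnegrE ?ell2_normr_ge0// H// leq_maxr.
  have -> : \sum_(i <- s) (2 * (2 * e m) ^+ 2) = (size s)%:R * (8 * e m ^+ 2).
    by rewrite big_const_seq count_predT iter_addr_0 -mulr_natl; ring.
  rewrite -mulr_sumr.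
  have : (size s)%:R * (8 * e m ^+ 2) <= d.
    have -> : d = (size s).+1%:R * (8 * c) 
      by rewrite /c; have : (size s).+1%:R != 0 :> R by []; move: _.+1%:R => k k0; field.
    apply: ler_pM; rewrite ?ler0n ?ler_nat ?mulr_ge0 ?sqr_ge0// ler_pM2l//.
    by rewrite expr2; apply: le_trans (ltW mc); rewrite ler_piMl// ltW.
  rewrite exprMn; move: (e n ^+ 2) (\sum_(i <- s) normc _ ^+ 2) (sqr_ge0 (e n)) => a b; lra.
have lu : (fun i => l i - u 0%N i : R[i]^o) \in @square_summable I R.
  by rewrite unfold_in /square_summable; apply: le_lt_trans (key 0%N) (ltry _).
exists (Ell2 lu + u 0%N) => n; apply: ler_ell2_normr; first by rewrite mulr_ge0.
have -> : sqnorm (Ell2 lu + u 0%N - u n) = sqnorm (fun i => l i - u n i)%R.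
  by congr sqnorm; apply/funext => i; rewrite ell2_subE ell2_addE /= subrK.
exact: key.
Qed.

End ell2_complete.

Section isometries.
Context {I : choiceType} {R : realType}.
Implicit Types (u v w : ell2 I R) (z : R[i]).

Definition bounded_below (E : ell2 I R -> ell2 I R) z (c : R) :=
  forall u, c * ell2_normr u <= ell2_normr (E u - z *: u).

Lemma expr_lt_eventually (q C d : R) : 0 <= q -> q < 1 -> 0 < d ->
  exists N, forall n, (N <= n)%N -> C * q ^+ n < d.
Proof.
move=> q0 q1 d0.
have /cvgrPdist_lt H : (fun n => C * q ^+ n) @ \oo --> C * 0.
  by apply: cvgMr; apply: cvg_expr; rewrite ger0_norm.
have [N _ HN] := H _ d0; exists N => n /HN /=.
rewrite mulr0 sub0r normrN; apply: le_lt_trans; exact: ler_norm.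
Qed.

Lemma ell2_geometric_limit (u : nat -> ell2 I R) (C q : R) : 0 <= q -> q < 1 ->
  (forall k, ell2_normr (u k.+1 - u k) <= C * q ^+ k) ->
  exists l, forall k, ell2_normr (l - u k) <= 2 * (C / (1 - q) * q ^+ k).
Proof.
move=> q0 q1 H; apply: ell2_cauchy_approx; last first.
  by move=> d d0; exact: expr_lt_eventually.
have C0 : 0 <= C.
  by have := H 0%N; rewrite expr0 mulr1; apply: le_trans; exact: ell2_normr_ge0.
move=> n m /subnK <-; elim: (m - n)%N => [|k IH].
  by rewrite add0n subrr ell2_normr0 mulr_ge0 ?exprn_ge0// divr_ge0// subr_ge0 ltW.
have : ell2_normr (u (k.+1 + n)%N - u n) <= C / (1 - q) * (q ^+ n - q ^+ (k.+1 + n)).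
  move: {IH}k.+1 => j; elim: j => [|j IH].
    by rewrite add0n !subrr ell2_normr0 mulr0.
  rewrite -(subrKA (u (j + n)%N)) addSn; apply: le_trans (ell2_normrD _ _) _.
  apply: le_trans (lerD (H _) IH) _; rewrite exprS.
  suff -> : C * q ^+ (j + n) + C / (1 - q) * (q ^+ n - q ^+ (j + n)) =
    C / (1 - q) * (q ^+ n - q * q ^+ (j + n)) by [].
  by field; rewrite subr_eq0 gt_eqF.
move/le_trans; apply; apply: ler_wpM2l; first by apply: divr_ge0 => //; rewrite subr_ge0 ltW.
by rewrite gerBl exprn_ge0.
Qed.

Lemma ell2_normr_small_eq0 u : (forall d, 0 < d -> ell2_normr u <= d) -> u = 0.
Proof.
move=> H; apply: ell2_normr_eq0; apply/eqP; rewrite eq_le ell2_normr_ge0 andbT.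
by apply/ler_addgt0Pr => d d0; rewrite add0r H.
Qed.

(** The Neumann series, summed as the iteration of [x |-> w + V x] from 0. *)
Lemma contraction_surj (V : {linear ell2 I R -> ell2 I R}) (q : R) :
  0 <= q -> q < 1 -> (forall u, ell2_normr (V u) <= q * ell2_normr u) ->
  forall w, exists u, u - V u = w.
Proof.
move=> q0 q1 HV w; pose u k := iter k (fun x => w + V x) 0.
have uS k : u k.+1 = w + V (u k) by [].
have Hu k : ell2_normr (u k.+1 - u k) <= ell2_normr w * q ^+ k.
  elim: k => [|k IH]; first by rewrite uS /u /= linear0 addr0 subr0 expr0 mulr1.
  rewrite uS [u k.+1 in X in _ - X]uS opprD addrACA subrr add0r -linearB.
  by apply: le_trans (HV _) _; rewrite exprS mulrCA ler_wpM2l.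
have [l Hl] := ell2_geometric_limit q0 q1 Hu.
exists l; apply/eqP; rewrite -subr_eq0; apply/eqP/ell2_normr_small_eq0 => d d0.
set C := ell2_normr w in Hu Hl.
have [k /(_ k (leqnn _)) Hk] := expr_lt_eventually (4 * (C / (1 - q)) * q) q0 q1 d0.
have -> : l - V l - w = (l - u k.+1) - V (l - u k).
  by rewrite linearB uS; apply: ell2_ext => i; rewrite !ell2E; ring.
apply: le_trans (ell2_normrB _ _) _; apply: le_trans (lerD (Hl _) (HV _)) _.
apply: le_trans (lerD (lexx _) (ler_wpM2l q0 (Hl k))) _.
by apply: le_trans (ltW Hk); rewrite exprS le_eqVlt; apply/orP; left; apply/eqP; ring.
Qed.

Variable E : {linear ell2 I R -> ell2 I R}.
Hypothesis isoE : forall u, ell2_normr (E u) = ell2_normr u.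

Lemma isometry_half_sum z u : normc z = 1 ->
  ell2_normr (E u + z *: u) ^+ 2 =
  4 * ell2_normr u ^+ 2 - ell2_normr (E u - z *: u) ^+ 2.
Proof.
move=> z1; have := ell2_parallelogram (E u) (z *: u).
by rewrite isoE ell2_normrZ z1 mul1r; lra.
Qed.

(** Capping the constant at 1 keeps [1 - c ^+ 2 / 4], the square of the contraction factor in
    [circle_surj], nonnegative. *)
Lemma bounded_below_pos_min z c : bounded_below E z c ->
  bounded_below E z (Num.min c 1).
Proof.
move=> H u; apply: le_trans (H u); rewrite ler_wpM2r ?ell2_normr_ge0//.
by rewrite ge_min lexx.
Qed.

(* With [V = (1 + E/z)/2], the parallelogram law turns the lower bound for
   [1 - E/z = 2 (1 - V)] into an upper bound [< 1] for [V]. *)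
Lemma circle_surj z c : normc z = 1 -> 0 < c -> bounded_below E z c ->
  forall w, exists u, E u - z *: u = w.
Proof.
move=> z1 c0 /bounded_below_pos_min; set c' := Num.min c 1 => bb w.
have c'0 : 0 < c' by rewrite lt_min c0 ltr01.
have c'1 : c' <= 1 by rewrite ge_min lexx orbT.
have z0 : z != 0 by apply/eqP => zz; move: z1; rewrite zz Normc.normc0; lra.
pose V (u : ell2 I R) : ell2 I R := 2^-1 *: (u + z^-1 *: E u).
have linV : linear V.
  by move=> a u v; rewrite /V linearP; apply: ell2_ext => i; rewrite !ell2E; ring.
pose V' : {linear ell2 I R -> ell2 I R} :=
  HB.pack V (GRing.isLinear.Build _ _ _ _ V linV).
have V'E x : V' x = V x by [].
have c4 : 0 <= 1 - c' ^+ 2 / 4.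
  have : c' ^+ 2 <= 1 by rewrite expr_le1// ltW.
  lra.
have q1 : Num.sqrt (1 - c' ^+ 2 / 4) < 1.
  by rewrite -[ltRHS]sqrtr1 ltr_sqrt//; have := exprn_gt0 2 c'0; lra.
have VE u : ell2_normr (V' u) <= Num.sqrt (1 - c' ^+ 2 / 4) * ell2_normr u.
  rewrite -(@ler_pXn2r _ 2) ?nnegrE ?mulr_ge0 ?sqrtr_ge0 ?ell2_normr_ge0//.
  rewrite exprMn (sqr_sqrtr c4).
  have -> : V' u = (2^-1 * z^-1) *: (E u + z *: u).
    by apply: ell2_ext => i; rewrite ?V'E /V !ell2E; field.
  rewrite ell2_normrZ exprMn isometry_half_sum// Normc.normcM !Normc.normcV z1 invr1 mulr1.
  have -> : normc (2 : R[i]) = 2.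
    have -> : 2 = (2 : R)%:C%C by rewrite rmorph_nat.
    by rewrite normc_real ger0_norm.
  have : c' ^+ 2 * ell2_normr u ^+ 2 <= ell2_normr (E u - z *: u) ^+ 2.
    rewrite -exprMn ler_sqr ?nnegrE ?mulr_ge0 ?ell2_normr_ge0 ?bb//.
    exact: ltW.
  have -> : 2^-1 ^+ 2 = 4^-1 :> R by field.
  lra.
(* Since [E - z = - 2 z (1 - V)], the right-hand side [w] has to be divided by [- 2 z]. *)
have [u Hu] := contraction_surj (sqrtr_ge0 _) q1 VE ((- 2^-1 * z^-1) *: w).
exists u; have -> : E u - z *: u = (- 2 * z) *: (u - V' u).
  by apply: ell2_ext => i; rewrite ?V'E /V !ell2E; field.
by rewrite Hu scalerA -[RHS]scale1r; congr (_ *: _); field.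
Qed.

Lemma outside_surj z : 1 < normc z -> forall w, exists u, E u - z *: u = w.
Proof.
move=> z1 w.
have z0 : z != 0 by apply/eqP => zz; move: z1; rewrite zz Normc.normc0; lra.
pose V (u : ell2 I R) : ell2 I R := z^-1 *: E u.
have linV : linear V.
  by move=> a u v; rewrite /V linearP; apply: ell2_ext => i; rewrite !ell2E; ring.
pose V' : {linear ell2 I R -> ell2 I R} :=
  HB.pack V (GRing.isLinear.Build _ _ _ _ V linV).
have V'E x : V' x = V x by [].
have q0 : 0 <= (normc z)^-1 by rewrite invr_ge0 normc_ge0.
have q1 : (normc z)^-1 < 1 by rewrite invf_lt1// (lt_trans ltr01).
have [|u Hu] := @contraction_surj V' _ q0 q1 _ (- z^-1 *: w).
  by move=> u; rewrite ell2_normrZ isoE Normc.normcV.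
exists u; have -> : E u - z *: u = (- z) *: (u - V' u).
  by apply: ell2_ext => i; rewrite ?V'E /V !ell2E; field.
by rewrite Hu scalerA -[RHS]scale1r; congr (_ *: _); field.
Qed.

Variable F : {linear ell2 I R -> ell2 I R}.
Hypothesis EK : forall u, E (F u) = u.

Let isoF u : ell2_normr (F u) = ell2_normr u.
Proof. by rewrite -isoE EK. Qed.

(** Here [E - z = E (1 - z F)], and [z F] is a contraction because the right inverse [F] of [E] is
    isometric. *)
Lemma inside_surj z : normc z < 1 -> forall w, exists u, E u - z *: u = w.
Proof.
move=> z1 w; pose V (u : ell2 I R) : ell2 I R := z *: F u.
have linV : linear V.
  by move=> a u v; rewrite /V linearP; apply: ell2_ext => i; rewrite !ell2E; ring.
pose V' : {linear ell2 I R -> ell2 I R} :=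
  HB.pack V (GRing.isLinear.Build _ _ _ _ V linV).
have V'E x : V' x = V x by [].
have [|u Hu] := @contraction_surj V' _ (normc_ge0 z) z1 _ (F w).
  by move=> u; rewrite ell2_normrZ isoF.
exists u; move: Hu; rewrite V'E /V => /(congr1 E); rewrite EK linearB => <-.
congr (_ - _); transitivity (z *: E (F u)); first by rewrite EK.
by rewrite linearZ.
Qed.

Lemma bounded_below_off_circle z : bounded_below E z `|1 - normc z|.
Proof.
move=> u.
have := ell2_normrB_ge (E u) (z *: u); have := ell2_normrB_ge (z *: u) (E u).
rewrite ell2_normrBC isoE ell2_normrZ.
by case: (ger0P (1 - normc z)) => _; lra.
Qed.

Lemma bounded_below_surj z c : 0 < c -> bounded_below E z c ->
  forall w, exists u, E u - z *: u = w.
Proof.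
by have [z1|z1|z1] := ltgtP (normc z) 1; [move=> _ _; exact: inside_surj|
  move=> _ _; exact: outside_surj|exact: circle_surj].
Qed.

(** A bound [r] on the inverse gives the constant [r^-1]. Conversely the lower bound gives
    injectivity and the continuity of the inverse, while surjectivity comes from a contraction in
    each of the three positions of [z] relative to the circle. *)
Lemma resolvent_set_bounded_below z :
  resolvent_set E z <-> exists2 c, 0 < c & bounded_below E z c.
Proof.
split=> [[B contB [BE EB]]|[c c0 bb]].
  have /linear_boundedP [M [Mreal HM]] : bounded_near B (nbhs (0 : ell2 I R)).
    exact/continuous_linear_bounded/contB.
  have Mn : M <= (normc M)%:C%C by exact: (real_ler_norm Mreal).
  pose r := normc M + 1.
  have r0 : 0 < r by rewrite ltr_wpDl ?normc_ge0.
  have Mr : M < r%:C%C.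
    by apply: le_lt_trans Mn _; rewrite ltcR ltrDl.
  exists r^-1; first by rewrite invr_gt0.
  move=> u; have := HM _ Mr (E u - z *: u); rewrite BE.
  rewrite /Num.norm/= /ell2_norm -rmorphM lecR => H.
  by rewrite mulrC ler_pdivrMr// mulrC.
have surj := bounded_below_surj c0 bb.
have inj u v : E u - z *: u = E v - z *: v -> u = v.
  move=> uv; apply/eqP; rewrite -subr_eq0; apply/eqP/ell2_normr_eq0/eqP.
  rewrite eq_le ell2_normr_ge0 andbT -(pmulr_rle0 _ c0); apply: le_trans (bb _) _.
  suff -> : E (u - v) - z *: (u - v) = 0 by rewrite ell2_normr0.
  transitivity ((E u - z *: u) - (E v - z *: v)); last by rewrite uv subrr.
  by rewrite linearB; apply: ell2_ext => i; rewrite !ell2E; ring.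
have [B HB] := boolp.choice surj.
have linB : linear B.
  move=> a u v; apply: inj; rewrite HB.
  rewrite linearP -{1}(HB u) -{1}(HB v); apply: ell2_ext => i; rewrite !ell2E; ring.
pose B' : {linear ell2 I R -> ell2 I R} :=
  HB.pack B (GRing.isLinear.Build _ _ _ _ B linB).
exists B'; last by split=> [u|u]; [exact: inj|exact: HB].
apply/(linear_bounded_continuous B')/linear_boundedP.
near=> r => u.
apply: (@le_trans _ _ ((c^-1)%:C%C * `|u|)); last first.
  by rewrite ler_wpM2r//; near: r; apply: nbhs_pinfty_ge; by apply: ger0_real; rewrite (lecR 0) invr_ge0 ltW.
rewrite /Num.norm /= /ell2_norm -rmorphM lecR.
by rewrite mulrC ler_pdivlMr// mulrC; apply: le_trans (bb _) _; rewrite /= HB.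
Unshelve. all: by end_near. Qed.

Lemma spectrum_circle : spectrum E `<=` circle R.
Proof.
move=> z /= zS; apply/circleP/eqP; apply: contra_notT zS => z1.
apply/resolvent_set_bounded_below; exists `|1 - normc z|.
  by rewrite normr_gt0 subr_eq0 eq_sym.
exact: bounded_below_off_circle.
Qed.

(** The constant is 1-Lipschitz in the spectral parameter, whence the openness of the resolvent set
    and uniform constants on compact sets. *)
Lemma bounded_below_near z z' c : bounded_below E z c ->
  bounded_below E z' (c - normc (z - z')).
Proof.
move=> bb u; have -> : E u - z' *: u = (E u - z *: u) - (z' - z) *: u.
  by apply: ell2_ext => i; rewrite !ell2E; ring.
apply: le_trans (ell2_normrB_ge _ _); rewrite ell2_normrZ normcBC mulrBl.
by rewrite lerD2r bb.
Qed.

End isometries.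

Section compactness.
Context {R : realType}.

Lemma nbhs_complexP (z : R[i]) (P : set R[i]) :
  nbhs z P <-> exists2 e : R, 0 < e & forall w, normc (z - w) < e -> P w.
Proof.
split=> [/nbhs_ballP[e /= e0 eP]|[e e0 eP]]; last apply/nbhs_ballP.
  move: e0; rewrite ltcE /= => /andP[/eqP e2 e1].
  exists (complex.Re e) => // w zw; apply: eP; rewrite /ball /= /Num.norm/=.
  by rewrite [e]complexE e2 mulr0 addr0 ltcR.
exists (e%:C%C) => /=; first by rewrite ltcR.
by move=> w; rewrite /ball /= /Num.norm/= ltcR; exact: eP.
Qed.

Lemma Complex_continuous : continuous (fun p : R * R => Complex p.1 p.2 : R[i]).
Proof.
move=> p P /nbhs_complexP[e e0 eP].
have e20 : 0 < e / 2 by rewrite divr_gt0.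
exists (ball p.1 (e / 2), ball p.2 (e / 2)) => /=.
  by split; exact: nbhsx_ballx.
move=> [x y] [/= xp yp]; apply: eP; apply: le_lt_trans (normc_le_ReIm _) _.
move: xp yp; rewrite /ball /=.
by case: p => a b /=; lra.
Qed.

Lemma dist_continuous (y : R[i]) : continuous (fun z : R[i] => normc (z - y)).
Proof.
move=> z P /nbhs_ballP[e /= e0 eP]; apply/nbhs_complexP; exists e => // w zw.
apply: eP; apply: le_lt_trans zw; rewrite ler_norml; apply/andP; split.
  by have := normcD (w - z) (z - y); rewrite addrA subrK [normc (w - z)]normcBC; lra.
by have := normcD (z - w) (w - y); rewrite addrA subrK; lra.
Qed.

Lemma compact_circle : compact (circle R).
Proof.
pose sq : set (R * R) := `[-1, 1]%classic `*` `[-1, 1]%classic.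
have csq : compact ((fun p : R * R => Complex p.1 p.2 : R[i]) @` sq).
  apply: continuous_compact; first exact: continuous_subspaceT Complex_continuous.
  by apply: compact_setX; exact: segment_compact.
apply: (subclosed_compact _ csq).
  rewrite (_ : circle R = (fun z => normc (z - 0)) @^-1` [set 1]); last first.
    by apply/seteqP; split => z; rewrite /= subr0 circleP.
  by apply: preimage_closed => [z _|]; [exact: dist_continuous|exact: closed_eq].
move=> z /circleP z1; exists (complex.Re z, complex.Im z); last by case: z {z1}.
have := ler_Re_normc z; have := ler_Im_normc z; rewrite z1 !ler_norml.
by rewrite /sq /= !in_itv.
Qed.

Lemma compact_circle_annulus (y : R[i]) (r1 r2 : R) :
  compact [set z | [/\ normc z = 1, r1 <= normc (z - y) & normc (z - y) <= r2]].
Proof.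
rewrite (_ : mkset _ = circle R `&` (fun z => normc (z - y)) @^-1` `[r1, r2]); last first.
  apply/seteqP; split=> z /=; rewrite in_itv /= circleP.
    by case=> -> -> ->.
  by case=> -> /andP[-> ->].
apply: compact_closedI; first exact: compact_circle.
by apply: preimage_closed => [z _|]; [exact: dist_continuous|exact: interval_closed].
Qed.

End compactness.

(** * Isolated points of the spectrum of an isometry *)

Section dyadic_averages.
Context {I : choiceType} {R : realType}.
Implicit Types (u v w x : ell2 I R) (z c : R[i]).

(** The [2 ^ m]-th roots of [c]. Branching on the two square roots of [c] makes the list split in
    the same way as the factor of highest power in [dyadic_average]. *)
Fixpoint dyadic_roots m c : seq R[i] :=
  if m is m'.+1 then dyadic_roots m' (sqrtc c) ++ dyadic_roots m' (- sqrtc c)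
  else [:: c].

Lemma size_dyadic_roots m c : size (dyadic_roots m c) = (2 ^ m)%N.
Proof. by elim: m c => //= m IH c; rewrite size_cat !IH expnS mul2n addnn. Qed.

Lemma dyadic_rootsP m c z : z \in dyadic_roots m c -> z ^+ (2 ^ m) = c.
Proof.
elim: m c => [|m IH] c /=; first by rewrite inE => /eqP ->.
rewrite mem_cat expnSr exprM => /orP[] /IH ->; first exact: sqr_sqrtc.
by rewrite sqrrN sqr_sqrtc.
Qed.

Lemma dyadic_roots_circle m c z : normc c = 1 -> z \in dyadic_roots m c ->
  normc z = 1.
Proof.
move=> c1 /dyadic_rootsP /(congr1 (@Normc.normc R)); rewrite normcX c1.
by move/eqP; rewrite pexpr_eq1 ?normc_ge0 ?expn_gt0// => /eqP.
Qed.

Variable E : {linear ell2 I R -> ell2 I R}.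

Lemma iter_linear n a u v : iter n E (a *: u + v) = a *: iter n E u + iter n E v.
Proof. by elim: n => //= n ->; rewrite linearP. Qed.

Lemma iter_scale n a u : iter n E (a *: u) = a *: iter n E u.
Proof. by elim: n => //= n ->; rewrite linearZ_LR. Qed.

Lemma iter_add n u v : iter n E (u + v) = iter n E u + iter n E v.
Proof. by elim: n => //= n ->; rewrite linearD. Qed.

(* [dyadic_average m z x] is the sum of [z ^- j *: E ^ j x] for [j < 2 ^ m],
   written as an iterated product of the factors [1 + (E / z) ^ (2 ^ i)]. *)
Fixpoint dyadic_average m z x : ell2 I R :=
  if m is m'.+1 then
    dyadic_average m' z (x + (z ^+ (2 ^ m'))^-1 *: iter (2 ^ m') E x)
  else x.

Lemma dyadic_average_linear m z a u v :
  dyadic_average m z (a *: u + v) = a *: dyadic_average m z u + dyadic_average m z v.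
Proof.
elim: m u v => //= m IH u v; rewrite -IH iter_linear; congr dyadic_average.
by apply: ell2_ext => i; rewrite !ell2E; ring.
Qed.

Lemma dyadic_average_comm m z x : dyadic_average m z (E x) = E (dyadic_average m z x).
Proof.
elim: m x => //= m IH x; rewrite -IH; congr dyadic_average.
by rewrite linearD linearZ_LR -iterS -iterSr.
Qed.

Lemma dyadic_average_shift m z y x :
  dyadic_average m z (E x - y *: x) = E (dyadic_average m z x) - y *: dyadic_average m z x.
Proof.
by rewrite addrC -scaleNr dyadic_average_linear dyadic_average_comm scaleNr addrC.
Qed.

(** The geometric sum telescopes to [(E / z) ^ (2 ^ m) - 1], up to powers of [z] that clear
    denominators. *)
Lemma dyadic_average_telescope m z x : z != 0 ->
  z ^+ (2 ^ m) *: (E (dyadic_average m z x) - z *: dyadic_average m z x) =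
  z *: (iter (2 ^ m) E x - z ^+ (2 ^ m) *: x).
Proof.
move=> z0; elim: m x => [|m IH] x; first by rewrite expn0 expr1.
rewrite [dyadic_average _ _ _]/= expnS mul2n -addnn exprD iterD -scalerA IH.
set n := (2 ^ m)%N; have zn0 : z ^+ n != 0 by rewrite expf_neq0.
rewrite iter_add iter_scale; move: (z ^+ n) zn0 => y y0.
by apply: ell2_ext => i; rewrite !ell2E; field.
Qed.

Hypothesis isoE : forall u, ell2_normr (E u) = ell2_normr u.

Lemma iter_isometry n u : ell2_normr (iter n E u) = ell2_normr u.
Proof. by elim: n => //= n <-; rewrite isoE. Qed.

(** The defect stays bounded as [m] grows, whereas by [sum_dyadic_average] the squared norm of the
    average is [2 ^ m * ell2_normr x ^+ 2] in the mean over the roots. The contradictions below play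
    one against the other. *)
Lemma dyadic_average_approx m z x : normc z = 1 ->
  ell2_normr (E (dyadic_average m z x) - z *: dyadic_average m z x) <= 2 * ell2_normr x.
Proof.
move=> z1; have z0 : z != 0.
  by apply/eqP => zz; move: z1; rewrite zz Normc.normc0; lra.
have := congr1 (@ell2_normr I R) (dyadic_average_telescope m x z0).
rewrite !ell2_normrZ normcX z1 expr1n !mul1r => ->.
apply: le_trans (ell2_normrB _ _) _.
by rewrite ell2_normrZ normcX z1 expr1n iter_isometry; lra.
Qed.

(** Parseval's identity for the cyclic group of order [2 ^ m]. For the two square roots of [c] the
    first factors send [x] to [x + y] and [x - y] with [y] as long as [x], so the parallelogram law
    gives a factor 4 at each level. *)
Lemma sum_dyadic_average m c x : normc c = 1 ->
  \sum_(z <- dyadic_roots m c) ell2_normr (dyadic_average m z x) ^+ 2 =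
  4 ^+ m * ell2_normr x ^+ 2.
Proof.
elim: m c x => [|m IH] c x c1 /=; first by rewrite big_seq1 expr0 mul1r.
have s1 : normc (sqrtc c) = 1.
  have := congr1 (@Normc.normc R) (sqr_sqrtc c); rewrite normcX c1.
  by move/eqP; rewrite pexpr_eq1 ?normc_ge0// => /eqP.
have s0 : sqrtc c != 0 by rewrite sqrtc_eq0; apply/eqP => cc; move: c1; rewrite cc Normc.normc0; lra.
rewrite big_cat /= big_seq.
under eq_bigr => z /dyadic_rootsP-> do [].
rewrite -big_seq IH// big_seq.
under eq_bigr => z /dyadic_rootsP-> do [].
rewrite -big_seq IH ?normcN//.
rewrite -mulrDr invrN scaleNr ell2_parallelogram ell2_normrZ iter_isometry.
have -> : normc (sqrtc c)^-1 = 1 by rewrite Normc.normcV s1 invr1.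
by rewrite mul1r (exprS 4 m); ring.
Qed.

Lemma bounded_below_compact (K : set R[i]) : compact K ->
  (forall z, K z -> exists2 c, 0 < c & bounded_below E z c) ->
  exists2 d, 0 < d & forall z, K z -> bounded_below E z d.
Proof.
move=> /compact_near_coveringP cK H.
have [z Kz|d [d0 Hd]] := @filter_ex _ (at_right (0 : R)) _ _ (filterI (nbhs_right_gt 0)
    (cK R (at_right 0) (fun d z => bounded_below E z d) _ _)); last by exists d.
have [c c0 bb] := H z Kz.
exists ([set w | normc (z - w) < c / 2], [set d | d < c / 2]) => /=.
  split; first by apply/nbhs_complexP; exists (c / 2) => //; rewrite divr_gt0.
  by apply: nbhs_right_lt; rewrite divr_gt0.
move=> [w d] /= [zw dc] u.
apply: le_trans (bounded_below_near w bb u); rewrite ler_wpM2r ?ell2_normr_ge0//.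
by lra.
Qed.

Lemma exists_ell2_neq0 (i : I) : exists x : ell2 I R, x != 0.
Proof.
pose f (j : I) : R[i]^o := (j == i)%:R.
have sf : f \in @square_summable I R.
  rewrite unfold_in /square_summable; apply: (@le_lt_trans _ _ (1%:E)); last exact: ltry.
  apply: sqnorm_le => s us; apply: (@le_trans _ _ (\sum_(j <- s) (j == i)%:R)).
    apply: ler_sum => j _; rewrite /f; case: (j == i).
      by rewrite Normc.normc1 expr1n.
    by rewrite Normc.normc0 expr0n.
  rewrite (_ : \sum_(j <- s) _ = \sum_(j <- s | pred1 i j) 1); last first.
    by rewrite [RHS]big_mkcond; apply: eq_bigr => j _ /=; case: (j == i).
  rewrite big_const_seq iter_addr_0 -[leRHS]/(1%:R) ler_nat.
  by rewrite count_uniq_mem// leq_b1.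
exists (Ell2 sf); apply/eqP => /(congr1 (fun u : ell2 I R => u i)) /eqP.
by rewrite /= /f eqxx oner_eq0.
Qed.

(* Averaging over dyadic roots of unity: half of the mass of the averages of [v]
   sits at roots close to [z0], and since [v] is in the range of [E - z0] little
   of it sits very close to [z0]. *)
Lemma isolated_gap z0 (r : R) : normc z0 = 1 -> 0 < r ->
  (forall z, normc z = 1 -> z != z0 -> normc (z - z0) <= 2 * r ->
     exists2 c, 0 < c & bounded_below E z c) ->
  forall x, r * ell2_normr (E x - z0 *: x) <=
    ell2_normr (E (E x - z0 *: x) - z0 *: (E x - z0 *: x)).
Proof.
move=> z01 r0 H x; rewrite leNgt; apply/negP.
have aux1 (n c p q A r1 : R) : (2 * r1) ^+ 2 * n <= c * n -> q <= (2 * A) ^+ 2 ->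
    c * n <= 2 * p + 2 * q -> n * (4 * r1 ^+ 2) <= 8 * A ^+ 2 + 2 * p.
  by clear; rewrite !exprMn; lra.
have aux2 (n c p q A r1 : R) : c * p <= r1 ^+ 2 * p -> q <= (2 * A) ^+ 2 ->
    n <= 2 * q + 2 * (c * p) -> n <= 8 * A ^+ 2 + 2 * r1 ^+ 2 * p.
  by clear; rewrite !exprMn; lra.
have aux3 (A : R) : 4 * A ^+ 2 = (2 * A) ^+ 2 by clear; ring.
have aux4 (M A q b2 p x2 L : R) : M * (q * b2) <= M * (A / 2) ->
    M * (p * x2) <= M * (A / 16) -> M * A <= q * (M * b2) + p * (M * x2) + L ->
    M * (7 / 16 * A) <= L.
  by clear; lra.
set v := E x - z0 *: x; set a := ell2_normr v; set b := ell2_normr (E v - _).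
set X := ell2_normr x => bra.
have b0 : 0 <= b by exact: ell2_normr_ge0.
have a0 : 0 < a by rewrite -(pmulr_rgt0 _ r0); exact: le_lt_trans bra.
have X0 : 0 <= X by exact: ell2_normr_ge0.
(* Radius of the zone very close to [z0], small enough for [sX]; [X + 1] avoids a division by
   zero. *)
pose s := a / (8 * (X + 1)).
have s0 : 0 < s by rewrite divr_gt0// mulr_gt0// ltr_wpDl.
have sX : 2 * s ^+ 2 * X ^+ 2 <= a ^+ 2 / 16.
  have -> : 2 * s ^+ 2 * X ^+ 2 = a ^+ 2 / 32 * (X / (X + 1)) ^+ 2.
    by rewrite /s; field; rewrite gt_eqF// ltr_wpDl.
  have : (X / (X + 1)) ^+ 2 <= 1.
    by rewrite expr_le1 ?divr_ge0 ?addr_ge0// ler_pdivrMr ?ltr_wpDl// mul1r lerDl.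
  have := exprn_gt0 2 a0; nra.
have [d d0 Hd] : exists2 d, 0 < d & forall z, normc z = 1 ->
    s <= normc (z - z0) -> normc (z - z0) <= 2 * r -> bounded_below E z d.
  have cK : compact [set z | [/\ normc z = 1, s <= normc (z - z0) & normc (z - z0) <= 2 * r]].
    exact: compact_circle_annulus.
  have [|d d0 Hd] := bounded_below_compact cK.
    move=> z [z1 z2 z3]; apply: H => //; apply: contraTneq s0 => zz.
    by move: z2; rewrite zz subrr Normc.normc0 leNgt => /negbTE ->.
  by exists d => // z z1 z2 z3; apply: Hd.
pose S m z := dyadic_average m z v; pose T m z := dyadic_average m z x.
(* One summand for each position of [z]: beyond [2 * r] the defect at [z0] controls the average;
   within [s] the average is the image under [E - z0] of an average of [x], which nearly satisfies
   the equation at [z0]; in between the uniform constant [d] applies. *)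
have key m z : normc z = 1 -> ell2_normr (S m z) ^+ 2 <=
    (8 * a ^+ 2 + 2 * ell2_normr (E (S m z) - z0 *: S m z) ^+ 2) / (4 * r ^+ 2) +
    (8 * X ^+ 2 + 2 * s ^+ 2 * ell2_normr (T m z) ^+ 2) + 4 * a ^+ 2 / d ^+ 2.
  move=> z1.
  have sq (p q w : R) : 0 <= p -> p <= q + w -> p ^+ 2 <= 2 * q ^+ 2 + 2 * w ^+ 2.
    by move=> p0 pq; have := sqr_ge0 (q - w); nra.
  have N0 (u : ell2 I R) : 0 <= ell2_normr u ^+ 2 by exact: sqr_ge0.
  have r20 : 0 < 4 * r ^+ 2 by rewrite mulr_gt0 ?exprn_gt0.
  have d20 : 0 < d ^+ 2 by exact: exprn_gt0.
  have t1 : 0 <= (8 * a ^+ 2 + 2 * ell2_normr (E (S m z) - z0 *: S m z) ^+ 2) / (4 * r ^+ 2).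
    apply: divr_ge0; last exact: ltW.
    by have := N0 (E (S m z) - z0 *: S m z); have := sqr_ge0 a; lra.
  have t2 : 0 <= 8 * X ^+ 2 + 2 * s ^+ 2 * ell2_normr (T m z) ^+ 2.
    have := mulr_ge0 (sqr_ge0 s) (N0 (T m z)); have := sqr_ge0 X.
    by rewrite -mulrA; lra.
  have t3 : 0 <= 4 * a ^+ 2 / d ^+ 2.
    by apply: divr_ge0; [have := sqr_ge0 a; lra|exact: ltW].
  have SA : ell2_normr (E (S m z) - z *: S m z) <= 2 * a by exact: dyadic_average_approx.
  have [far|near2] := ltP (2 * r) (normc (z - z0)).
    rewrite -addrA; apply: ler_wpDr; first exact: addr_ge0.
    rewrite ler_pdivlMr//.
    have e1 : (z - z0) *: S m z = (E (S m z) - z0 *: S m z) - (E (S m z) - z *: S m z).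
      by apply: ell2_ext => i; rewrite !ell2E; ring.
    have := ell2_normrB (E (S m z) - z0 *: S m z) (E (S m z) - z *: S m z).
    rewrite -e1 => /(sq _ _ _ (ell2_normr_ge0 _)); rewrite ell2_normrZ exprMn.
    have : ell2_normr (E (S m z) - z *: S m z) ^+ 2 <= (2 * a) ^+ 2.
      by rewrite ler_sqr ?nnegrE ?ell2_normr_ge0// mulr_ge0// ltW.
    have : (2 * r) ^+ 2 <= normc (z - z0) ^+ 2.
      by rewrite ler_sqr ?nnegrE ?normc_ge0 ?mulr_ge0// ltW.
    move/(ler_wpM2r (N0 (S m z))).
    exact: aux1.
  have [close|near1] := ltP (normc (z - z0)) s.
    rewrite addrAC; apply: ler_wpDl; first exact: addr_ge0.
    have e1 : S m z = (E (T m z) - z *: T m z) + (z - z0) *: T m z.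
      by rewrite /S /v dyadic_average_shift; apply: ell2_ext => i; rewrite !ell2E; ring.
    have := ell2_normrD (E (T m z) - z *: T m z) ((z - z0) *: T m z).
    rewrite -e1 => /(sq _ _ _ (ell2_normr_ge0 _)); rewrite ell2_normrZ exprMn.
    have : ell2_normr (E (T m z) - z *: T m z) ^+ 2 <= (2 * X) ^+ 2.
      by rewrite ler_sqr ?nnegrE ?ell2_normr_ge0 ?mulr_ge0//; exact: dyadic_average_approx.
    have : normc (z - z0) ^+ 2 <= s ^+ 2.
      by rewrite ler_sqr ?nnegrE ?normc_ge0// ltW.
    move/(ler_wpM2r (N0 (T m z))).
    exact: aux2.
  apply: ler_wpDl; first exact: addr_ge0.
  rewrite ler_pdivlMr// mulrC -exprMn.
  rewrite aux3.
  rewrite ler_sqr ?nnegrE ?mulr_ge0 ?ell2_normr_ge0 ?(ltW d0) ?(ltW a0)//.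
  by apply: le_trans SA; exact: Hd.
have r20 : 0 < r ^+ 2 by exact: exprn_gt0.
have d20 : 0 < d ^+ 2 by exact: exprn_gt0.
pose K := 2 * a ^+ 2 / r ^+ 2 + 8 * X ^+ 2 + 4 * a ^+ 2 / d ^+ 2.
(* Summed over the roots, the far zone takes at most half of [4 ^+ m * a ^+ 2], since [b < r * a],
   and the close zone at most a sixteenth; [7 / 16] is what remains. The other terms are constant
   per root, hence of order [2 ^+ m] only. *)
have bound m : 4 ^+ m * (7 / 16 * a ^+ 2) <= 2 ^+ m * K.
  have := sum_dyadic_average m v (Normc.normc1 R).
  have sumE := sum_dyadic_average m (E v - z0 *: v) (Normc.normc1 R).
  have sumT := sum_dyadic_average m x (Normc.normc1 R).
  move=> sumS.
  have : \sum_(z <- dyadic_roots m 1) ell2_normr (S m z) ^+ 2 <=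
    \sum_(z <- dyadic_roots m 1) ((2 * r ^+ 2)^-1 *
       ell2_normr (dyadic_average m z (E v - z0 *: v)) ^+ 2 +
       2 * s ^+ 2 * ell2_normr (T m z) ^+ 2 + K).
    rewrite big_seq [leRHS]big_seq; apply: ler_sum => z /(dyadic_roots_circle (Normc.normc1 R)).
    move=> /(key m); rewrite /S (dyadic_average_shift m z z0 v) => /le_trans; apply.
    rewrite /K le_eqVlt; apply/orP; left; apply/eqP; field.
    by rewrite !gt_eqF.
  rewrite sumS 2!big_split/= -!mulr_sumr sumE sumT.
  rewrite big_const_seq count_predT iter_addr_0 size_dyadic_roots -[_ *+ (2 ^ m)%N]mulr_natl natrX.
  rewrite -/a -/b -/X.
  have M0 : 0 < 4 ^+ m :> R by rewrite exprn_gt0.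
  apply: aux4; last by rewrite (ler_pM2l M0).
  rewrite (ler_pM2l M0) invfM -mulrA mulrC ler_pM2r ?invr_gt0//.
  rewrite mulrC ler_pdivrMr// mulrC -exprMn.
  by rewrite ler_sqr ?nnegrE ?(ltW bra)// mulr_ge0 ?(ltW r0) ?(ltW a0).
have [|||m /(_ m (leqnn _))] := @expr_lt_eventually R 2^-1 K (7 / 16 * a ^+ 2).
- by [].
- by rewrite invf_lt1// ltr1n.
- by rewrite mulr_gt0 ?exprn_gt0 ?divr_gt0.
rewrite -(ltr_pM2l (exprn_gt0 m (_ : 0 < 4 :> R)))//.
rewrite mulrCA -exprMn (_ : 4 * 2^-1 = 2 :> R); last by lra.
by rewrite mulrC ltNge bound.
Qed.

(** Otherwise one constant [d] works on the whole circle and bounds every dyadic average by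
    [2 * X / d], against Parseval's identity. The index [i] supplies a nonzero vector. *)
Lemma approx_eigenvalue (i : I) : exists2 z, normc z = 1 &
  ~ exists2 c, 0 < c & bounded_below E z c.
Proof.
apply: contrapT => /forall2NP H.
have [d d0 Hd] : exists2 d, 0 < d & forall z, circle R z -> bounded_below E z d.
  apply: bounded_below_compact; first exact: compact_circle.
  by move=> z /circleP z1; have [//|/contrapT] := H z.
have [x x0] := exists_ell2_neq0 i; set X := ell2_normr x.
have X0 : 0 < X.
  rewrite lt_def ell2_normr_ge0 andbT; apply: contra_neq x0; exact: ell2_normr_eq0.
have d20 : 0 < d ^+ 2 by exact: exprn_gt0.
have bound m : 4 ^+ m * X ^+ 2 <= 2 ^+ m * (4 * X ^+ 2 / d ^+ 2).
  rewrite -(sum_dyadic_average m x (Normc.normc1 R)).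
  apply: (@le_trans _ _ (\sum_(z <- dyadic_roots m (1 : R[i])) (4 * X ^+ 2 / d ^+ 2))).
    rewrite big_seq [leRHS]big_seq.
    apply: ler_sum => z /(dyadic_roots_circle (Normc.normc1 R)) z1.
    rewrite ler_pdivlMr// mulrC -exprMn.
    apply: le_trans (_ : (2 * X) ^+ 2 <= _); last by rewrite exprMn; lra.
    rewrite ler_sqr ?nnegrE ?mulr_ge0 ?ell2_normr_ge0 ?(ltW X0) ?(ltW d0)//.
    apply: le_trans (dyadic_average_approx m x z1); apply: Hd.
    exact/circleP.
  by rewrite big_const_seq count_predT iter_addr_0 size_dyadic_roots -[_ *+ (2 ^ m)%N]mulr_natl natrX.
have [|||m /(_ m (leqnn _))] := @expr_lt_eventually R 2^-1 (4 * X ^+ 2 / d ^+ 2) (X ^+ 2).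
- by [].
- by rewrite invf_lt1// ltr1n.
- by rewrite exprn_gt0.
rewrite -(ltr_pM2l (exprn_gt0 m (_ : 0 < 4 :> R)))//.
rewrite mulrCA -exprMn (_ : 4 * 2^-1 = 2 :> R); last by lra.
by rewrite mulrC ltNge bound.
Qed.

(* The kernel vector is the limit of the powers of [(1 + E/z0)/2] applied to [w]. *)
Lemma near_kernel z0 (r : R) : normc z0 = 1 -> 0 < r ->
  (forall x, r * ell2_normr (E x - z0 *: x) <=
    ell2_normr (E (E x - z0 *: x) - z0 *: (E x - z0 *: x))) ->
  exists2 C, 0 <= C & forall w, exists2 k, E k = z0 *: k &
    ell2_normr (k - w) <= C * ell2_normr (E w - z0 *: w).
Proof.
move=> z01 r0 gap.
have z00 : z0 != 0 by apply/eqP => zz; move: z01; rewrite zz Normc.normc0; lra.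
pose c' := Num.min r 1.
have c'0 : 0 < c' by rewrite lt_min r0 ltr01.
have c'1 : c' <= 1 by rewrite ge_min lexx orbT.
have c4 : 0 <= 1 - c' ^+ 2 / 4.
  have : c' ^+ 2 <= 1 by rewrite expr_le1// ltW.
  lra.
pose q := Num.sqrt (1 - c' ^+ 2 / 4).
have q0 : 0 <= q by exact: sqrtr_ge0.
have q1 : q < 1.
  by rewrite -[ltRHS]sqrtr1 ltr_sqrt//; have := exprn_gt0 2 c'0; lra.
pose D x := E x - z0 *: x.
pose V x := (2^-1 * z0^-1) *: (E x + z0 *: x).
have DV x : D (V x) = V (D x).
  have E1 : E (V x) = (2^-1 * z0^-1) *: (E (E x) + z0 *: E x).
    by rewrite linearZ_LR linearD linearZ_LR.
  have E2 : E (D x) = E (E x) - z0 *: E x by rewrite linearB linearZ_LR.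
  rewrite [LHS]/D E1 {2}/V E2; rewrite /V /D.
  by apply: ell2_ext => i; rewrite !ell2E; ring.
(* On the range of [D] the hypothesis [gap] is a lower bound for [E - z0], so [V] contracts there as
   in [circle_surj], although it fixes the kernel. *)
have VD x : ell2_normr (V (D x)) <= q * ell2_normr (D x).
  rewrite -(@ler_pXn2r _ 2) ?nnegrE ?mulr_ge0 ?ell2_normr_ge0//.
  rewrite exprMn (sqr_sqrtr c4) ell2_normrZ exprMn isometry_half_sum//.
  rewrite Normc.normcM !Normc.normcV z01 invr1 mulr1.
  have -> : normc (2 : R[i]) = 2.
    have -> : 2 = (2 : R)%:C%C by rewrite rmorph_nat.
    by rewrite normc_real ger0_norm.
  have : c' ^+ 2 * ell2_normr (D x) ^+ 2 <= ell2_normr (D (D x)) ^+ 2.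
    rewrite -exprMn ler_sqr ?nnegrE ?mulr_ge0 ?ell2_normr_ge0 ?(ltW c'0)//.
    apply: le_trans (gap x); rewrite ler_wpM2r ?ell2_normr_ge0//.
    by rewrite ge_min lexx.
  have -> : 2^-1 ^+ 2 = 4^-1 :> R by field.
  rewrite /D; lra.
exists (1 - q)^-1; first by rewrite invr_ge0 subr_ge0 ltW.
move=> w; pose u k := iter k V w; set N := ell2_normr (E w - z0 *: w).
have Du k : ell2_normr (D (u k)) <= N * q ^+ k.
  elim: k => [|k IH]; first by rewrite expr0 mulr1.
  by rewrite [u _]/= DV; apply: le_trans (VD _) _; rewrite exprS mulrCA ler_wpM2l.
have Hu k : ell2_normr (u k.+1 - u k) <= (N / 2) * q ^+ k.
  have -> : u k.+1 - u k = (2^-1 * z0^-1) *: D (u k).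
    by rewrite [u k.+1]/= /V /D; apply: ell2_ext => i; rewrite !ell2E; field.
  rewrite ell2_normrZ Normc.normcM !Normc.normcV z01 invr1 mulr1.
  have -> : normc (2 : R[i]) = 2.
    have -> : 2 = (2 : R)%:C%C by rewrite rmorph_nat.
    by rewrite normc_real ger0_norm.
  by have := Du k; lra.
have [l Hl] := ell2_geometric_limit q0 q1 Hu.
exists l; last first.
  have := Hl 0%N; rewrite expr0 mulr1 => /le_trans; apply.
  by rewrite le_eqVlt; apply/orP; left; apply/eqP; field; rewrite subr_eq0 gt_eqF.
apply/eqP; rewrite -subr_eq0; apply/eqP/ell2_normr_small_eq0 => d d0.
have [k /(_ k (leqnn _)) Hk] := expr_lt_eventually (2 * (N / (1 - q)) + N) q0 q1 d0.
have -> : E l - z0 *: l = (E (l - u k) - z0 *: (l - u k)) + D (u k).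
  by rewrite /D linearB; apply: ell2_ext => i; rewrite !ell2E; ring.
apply: le_trans (ell2_normrD _ _) _.
have H1 : ell2_normr (E (l - u k) - z0 *: (l - u k)) <= 2 * ell2_normr (l - u k).
  by apply: le_trans (ell2_normrB _ _) _; rewrite isoE ell2_normrZ z01; lra.
have H2 : 2 * ell2_normr (l - u k) <= 2 * (N / (1 - q)) * q ^+ k.
  apply: le_trans (ler_wpM2l _ (Hl k)) _ => //.
  by rewrite le_eqVlt; apply/orP; left; apply/eqP; field; rewrite subr_eq0 gt_eqF.
by have := Du k; lra.
Qed.

End dyadic_averages.

(** * Factorization of CMV operators *)

Section blocks.
Context {R : realType}.
Implicit Types (a b : int -> R[i]) (u v : ell2 int R) (k n : int) (s : bool).

Definition crho (z : R[i]) : R[i] := (Num.sqrt (1 - normc z ^+ 2))%:C%C.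

(* The direct sum of the unitary blocks [[z^*, rho], [rho, - z]], [z = a k],
   acting on the coordinates [k, k + 1] with [k] even iff [s]. *)
Definition block_seq a s (u : int -> R[i]) k : R[i]^o :=
  if (2 %| k)%Z == s then (a k)^* * u k + crho (a k) * u (k + 1)
  else crho (a (k - 1)) * u (k - 1) - a (k - 1) * u k.

Lemma block_seq_first a s (u : int -> R[i]) k : (2 %| k)%Z = s ->
  block_seq a s u k = (a k)^* * u k + crho (a k) * u (k + 1).
Proof. by rewrite /block_seq => ->; rewrite eqxx. Qed.

Lemma block_seq_second a s (u : int -> R[i]) k : (2 %| k)%Z = s ->
  block_seq a s u (k + 1) = crho (a k) * u k - a k * u (k + 1).
Proof.
move=> ks; rewrite /block_seq addrK; case: eqP => // ks1.
by exfalso; move: ks ks1; case: s; lia.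
Qed.

Lemma crhoE (z : R[i]) : normc z <= 1 -> crho z ^+ 2 = 1 - z * z^*.
Proof.
move=> z1; rewrite -rmorphXn/= sqr_sqrtr; last by rewrite subr_ge0 expr_le1 ?normc_ge0.
by rewrite (rmorphB (real_complex R)) rmorph1 -sqr_normc_conj.
Qed.

Lemma crho_conj (z : R[i]) : crho z^* = crho z.
Proof. by rewrite /crho normc_conj. Qed.

Lemma conj_crho (z : R[i]) : (crho z)^* = crho z.
Proof. exact: conjc_real. Qed.

(** Regroups the sum along the pairs on which the blocks act, so that the isometry can be checked on
    a single block. *)
Lemma sqnorm_pairs (f : int -> R[i]) s :
  sqnorm f = (\esum_(j in [set: int]) (normc (f (2 * j + (~~ s)%:Z)) ^+ 2 +
     normc (f (2 * j + (~~ s)%:Z + 1)) ^+ 2)%:E)%E.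
Proof.
pose g k : \bar R := (normc (f k) ^+ 2)%:E.
have g0 k : (0 <= g k)%E by rewrite lee_fin sqr_ge0.
under eq_esum do rewrite EFinD.
rewrite esumD//; last 2 first.
- by move=> i _; exact: g0.
- by move=> i _; exact: g0.
pose A := [set k : int | (2 %| k)%Z == s].
rewrite -(@reindex_esum _ _ _ setT A (fun j : int => 2 * j + (~~ s)%:Z) g); last first.
  split=> [j _|j j' _ _|k /eqP ks].
  - by rewrite /A /=; case: (s) => /=; lia.
  - lia.
  - by exists ((k - (~~ s)%:Z) %/ 2)%Z => //=; move: ks; case: (s) => /=; lia.
rewrite -(@reindex_esum _ _ _ setT (~` A) (fun j : int => 2 * j + (~~ s)%:Z + 1) g); last first.
  split=> [j _|j j' _ _|k /eqP ks].
  - by rewrite /A /=; case: (s) => /=; lia.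
  - lia.
  - by exists ((k - (~~ s)%:Z - 1) %/ 2)%Z => //=; move: ks; case: (s) => /=; lia.
by have := @esumID _ _ A setT g (fun i _ => g0 i); rewrite !setTI.
Qed.

Lemma sqnorm_block a s (u : int -> R[i]) : (forall n, normc (a n) <= 1) ->
  sqnorm (block_seq a s u) = sqnorm u.
Proof.
move=> a1; rewrite (sqnorm_pairs _ s) [RHS](sqnorm_pairs _ s).
apply: eq_esum => j _; congr EFin.
have : (2 %| 2 * j + (~~ s)%:Z)%Z = s by case: (s) => /=; lia.
move: (2 * j + _) => k ks.
rewrite block_seq_first// block_seq_second//.
apply: (@complexI R); rewrite !rmorphD/= !sqr_normc_conj.
have := crhoE (a1 k); have := conj_crho (a k).
move: (crho (a k)) => r; move: (a k) (u k) (u (k + 1)) => z x y rJ r2.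
rewrite !(rmorphD, rmorphB, rmorphN, rmorphM)/= rJ !conjCK.
transitivity ((z * z^* + r ^+ 2) * (x * x^* + y * y^*)); first by ring.
by rewrite r2; ring.
Qed.

Lemma block_summable a s u : (forall n, normc (a n) <= 1) ->
  block_seq a s u \in @square_summable int R.
Proof. by move=> a1; rewrite unfold_in /square_summable sqnorm_block//; exact: (ell2P u). Qed.

(** Conjugating the coefficients gives the adjoint of each unitary block, which is its inverse. *)
Lemma block_seqK a s (u : int -> R[i]) : (forall n, normc (a n) <= 1) ->
  block_seq (fun n => (a n)^*) s (block_seq a s u) = u.
Proof.
move=> a1; apply/funext => k.
have [ks|ks] := eqVneq ((2 %| k)%Z) s.
  rewrite block_seq_first// (block_seq_first _ _ ks) (block_seq_second _ _ ks).
  rewrite conjCK crho_conj; have := crhoE (a1 k).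
  move: (crho (a k)) => r; move: (a k) (u k) (u (k + 1)) => z x y r2.
  transitivity ((z * z^* + r ^+ 2) * x); first by ring.
  by rewrite r2; ring.
have ks' : (2 %| k - 1)%Z = s by move: ks; case: s; lia.
rewrite -(subrK 1 k) block_seq_second// (block_seq_first _ _ ks') (block_seq_second _ _ ks').
rewrite crho_conj; move: (k - 1) => {ks ks' k}k; have := crhoE (a1 k).
move: (crho (a k)) => r; move: (a k) (u k) (u (k + 1)) => z x y r2.
transitivity ((z * z^* + r ^+ 2) * y); first by ring.
by rewrite r2; ring.
Qed.

Lemma block_seqKJ a s (u : int -> R[i]) : (forall n, normc (a n) <= 1) ->
  block_seq a s (block_seq (fun n => (a n)^*) s u) = u.
Proof.
move=> a1; rewrite -{1}(_ : (fun n => ((a n)^*)^*) = a).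
  by apply: block_seqK => n; rewrite normc_conj.
by apply/funext => n; rewrite conjCK.
Qed.

End blocks.

Section cmv_factorization.
Context {R : realType}.
Implicit Types (alpha : int -> disk R) (u v : ell2 int R) (k n : int) (s : bool).

Definition cmv_alpha alpha n : R[i] := set_val (alpha n).

Lemma cmv_alpha_lt1 alpha n : normc (cmv_alpha alpha n) < 1.
Proof. by apply/diskP; exact: set_valP. Qed.

Let al1 alpha n : normc (cmv_alpha alpha n) <= 1.
Proof. exact/ltW/cmv_alpha_lt1. Qed.

Let alJ1 alpha n : normc (cmv_alpha alpha n)^* <= 1.
Proof. by rewrite normc_conj. Qed.

Definition block alpha s u : ell2 int R := Ell2 (block_summable s u (al1 alpha)).

Definition block_inv alpha s u : ell2 int R := Ell2 (block_summable s u (alJ1 alpha)).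

Lemma block_seq_linear (a : int -> R[i]) s (c : R[i]) (u v : int -> R[i]) k :
  block_seq a s (fun k => c * u k + v k) k = c * block_seq a s u k + block_seq a s v k.
Proof. by rewrite /block_seq; case: ifP => _; ring. Qed.

Lemma block_linear alpha s : linear (block alpha s).
Proof. by move=> c u v; apply: ell2_ext => k; rewrite !ell2E -block_seq_linear. Qed.
HB.instance Definition _ alpha s := GRing.isLinear.Build R[i] (ell2 int R) (ell2 int R) _
  (block alpha s) (block_linear alpha s).

Lemma block_inv_linear alpha s : linear (block_inv alpha s).
Proof. by move=> c u v; apply: ell2_ext => k; rewrite !ell2E -block_seq_linear. Qed.
HB.instance Definition _ alpha s := GRing.isLinear.Build R[i] (ell2 int R) (ell2 int R) _
  (block_inv alpha s) (block_inv_linear alpha s).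

Lemma block_isometry alpha s u : ell2_normr (block alpha s u) = ell2_normr u.
Proof. by rewrite /ell2_normr /= sqnorm_block. Qed.

Lemma block_invK alpha s u : block alpha s (block_inv alpha s u) = u.
Proof. by apply/val_inj => /=; rewrite block_seqKJ. Qed.

(** The classical factorization of an extended CMV matrix; unitarity and the Szego recursion are
    both read off from it. *)
Lemma cmv_block alpha u : cmv alpha u = block alpha true (block alpha false u).
Proof.
apply: ell2_ext => k; rewrite /= /cmv_seq.
have [ke|ko] := boolP ((2 %| k)%Z).
  have k1 : (2 %| k + 1)%Z = false by lia.
  have km : (2 %| k - 1)%Z = false by lia.
  have := block_seq_second (cmv_alpha alpha) u km; rewrite subrK => E2.
  rewrite (block_seq_first _ _ ke) (block_seq_first _ _ k1) E2 /cmv_row1 subrK.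
  have -> : k - 1 + 2 = k + 1 by lia.
  have -> : k - 1 + 3 = k + 2 by lia.
  have -> : k + 1 + 1 = k + 2 by lia.
  rewrite /cmv_rho /crho /cmv_alpha.
  by ring.
have ke : (2 %| k - 1)%Z = true by lia.
have k0 : (2 %| k)%Z = false by lia.
have k2 : (2 %| k - 2)%Z = false by lia.
have := block_seq_second (cmv_alpha alpha) (block_seq (cmv_alpha alpha) false u) ke.
rewrite subrK => ->; rewrite (block_seq_first _ _ k0).
have := block_seq_second (cmv_alpha alpha) u k2.
have -> : k - 2 + 1 = k - 1 by lia.
move=> ->; rewrite /cmv_row2.
have -> : k - 2 + 1 = k - 1 by lia.
have -> : k - 2 + 2 = k by lia.
have -> : k - 2 + 3 = k + 1 by lia.
rewrite /cmv_rho /crho /cmv_alpha.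
by ring.
Qed.

Lemma cmv_isometry alpha u : ell2_normr (cmv alpha u) = ell2_normr u.
Proof. by rewrite cmv_block !block_isometry. Qed.

Definition cmv_inv alpha u : ell2 int R := block_inv alpha false (block_inv alpha true u).

Lemma cmv_inv_linear alpha : linear (cmv_inv alpha).
Proof. by move=> c u v; rewrite /cmv_inv !linearP. Qed.
HB.instance Definition _ alpha := GRing.isLinear.Build R[i] (ell2 int R) (ell2 int R) _
  (cmv_inv alpha) (cmv_inv_linear alpha).

Lemma cmv_invK alpha u : cmv alpha (cmv_inv alpha u) = u.
Proof. by rewrite cmv_block /cmv_inv !block_invK. Qed.

End cmv_factorization.

Section ell2_int.
Context {R : realType}.
Implicit Types (u v : ell2 int R) (k n : int).

Lemma shift_summable (j : int) u : (fun k => u (k + j) : R[i]^o) \in @square_summable int R.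
Proof. by rewrite unfold_in /square_summable sqnorm_shift; exact: (ell2P u). Qed.

Definition ell2_shift j u : ell2 int R := Ell2 (shift_summable j u).

Lemma ell2_normr_shift j u : ell2_normr (ell2_shift j u) = ell2_normr u.
Proof. by rewrite /ell2_normr /= sqnorm_shift. Qed.

Lemma abs_summable u : (fun k => (normc (u k))%:C%C : R[i]^o) \in @square_summable int R.
Proof.
apply: (@square_summable_le _ _ _ u 1) => // i.
by rewrite mul1r normc_real ger0_norm ?normc_ge0.
Qed.

Definition ell2_abs u : ell2 int R := Ell2 (abs_summable u).

Lemma ell2_normr_abs u : ell2_normr (ell2_abs u) = ell2_normr u.
Proof.
rewrite /ell2_normr; congr (Num.sqrt (fine _)); apply: eq_esum => i _.
by rewrite normc_real ger0_norm ?normc_ge0.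
Qed.

Lemma ell2_sumE (J : Type) (r : seq J) (P : pred J) (F : J -> ell2 int R) k :
  (\sum_(j <- r | P j) F j) k = \sum_(j <- r | P j) F j k.
Proof. by elim/big_rec2: _ => // j y x _ <-. Qed.

Lemma ell2_normr_sum (J : Type) (r : seq J) (P : pred J) (F : J -> ell2 int R) :
  ell2_normr (\sum_(j <- r | P j) F j) <= \sum_(j <- r | P j) ell2_normr (F j).
Proof.
elim/big_rec2: _ => [|j y x _ H]; first by rewrite ell2_normr0.
by apply: le_trans (ell2_normrD _ _) _; rewrite lerD2l.
Qed.

End ell2_int.

Section cmv_perturbation.
Context {R : realType}.
Implicit Types (alpha beta : int -> disk R) (u v : ell2 int R) (k n : int).

(** For the two square roots, [|x - y| ^ 2 <= |x - y| (x + y) = |x ^ 2 - y ^ 2|]. The modulus of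
    continuity is only of Holder type, but uniform up to the unit circle, so [cmv_perturb] holds for
    all coefficients at once. *)
Lemma crho_modulus (z w : R[i]) : normc z <= 1 -> normc w <= 1 ->
  normc (crho z - crho w) ^+ 2 <= 2 * normc (z - w).
Proof.
move=> z1 w1; rewrite /crho -rmorphB normc_real.
have z2 : 0 <= 1 - normc z ^+ 2 by rewrite subr_ge0 expr_le1 ?normc_ge0.
have w2 : 0 <= 1 - normc w ^+ 2 by rewrite subr_ge0 expr_le1 ?normc_ge0.
have sz := sqr_sqrtr z2; have sw := sqr_sqrtr w2.
have := sqrtr_ge0 (1 - normc z ^+ 2); have := sqrtr_ge0 (1 - normc w ^+ 2).
move: sz sw; move: (Num.sqrt (1 - normc z ^+ 2)) (Num.sqrt (1 - normc w ^+ 2)) => x y xz yw y0 x0.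
have d1 : normc z - normc w <= normc (z - w) by have := normcD (z - w) w; rewrite subrK; lra.
have d2 : normc w - normc z <= normc (z - w).
  by have := normcD (w - z) z; rewrite subrK [normc (w - z)]normcBC; lra.
have D : (x - y) * (x + y) = (normc w - normc z) * (normc w + normc z) by lra.
have := normc_ge0 z; have := normc_ge0 w; have := normc_ge0 (z - w).
rewrite real_normK ?num_real//.
move: z1 w1 d1 d2 D; move: (normc z) (normc w) (normc (z - w)) => p q d p1 q1 d1 d2 D d0 q0 p0.
have [xy|xy] := leP x y; nra.
Qed.

Lemma block_perturb alpha beta s u (e : R) :
  (forall n, normc (cmv_alpha alpha n - cmv_alpha beta n) <= e) ->
  (forall n, normc (crho (cmv_alpha alpha n) - crho (cmv_alpha beta n)) <= e) ->
  ell2_normr (block alpha s u - block beta s u) <= 3 * e * ell2_normr u.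
Proof.
move=> He Hr; have e0 : 0 <= e by apply: le_trans (He 0); exact: normc_ge0.
pose A := ell2_abs u.
(* Each output coordinate involves [u k] and one neighbour; allowing both neighbours gives a single
   majorant for the two parities, and the factor 3. *)
apply: (@le_trans _ _ (ell2_normr (e%:C%C *: (ell2_shift (-1) A + A + ell2_shift 1 A)))).
  apply: ell2_normr_le_pointwise => k.
  have -> : (e%:C%C *: (ell2_shift (-1) A + A + ell2_shift 1 A)) k =
      (e * (normc (u (k - 1)) + normc (u k) + normc (u (k + 1))))%:C%C.
    by rewrite !ell2E rmorphM 2!rmorphD.
  rewrite normc_real ger0_norm; last by rewrite mulr_ge0 ?addr_ge0 ?normc_ge0.
  change (normc (block_seq (cmv_alpha alpha) s u k - block_seq (cmv_alpha beta) s u k : R[i]) <=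
    e * (normc (u (k - 1)) + normc (u k) + normc (u (k + 1)))).
  rewrite /block_seq; case: ifP => _.
    have -> : (cmv_alpha alpha k)^* * u k + crho (cmv_alpha alpha k) * u (k + 1)
      - ((cmv_alpha beta k)^* * u k + crho (cmv_alpha beta k) * u (k + 1)) =
      (cmv_alpha alpha k - cmv_alpha beta k)^* * u k +
      (crho (cmv_alpha alpha k) - crho (cmv_alpha beta k)) * u (k + 1).
      by rewrite rmorphB; ring.
    apply: le_trans (normcD _ _) _; rewrite !Normc.normcM normc_conj.
    have := ler_wpM2r (normc_ge0 (u k)) (He k).
    have := ler_wpM2r (normc_ge0 (u (k + 1))) (Hr k).
    have := mulr_ge0 e0 (normc_ge0 (u (k - 1))).
    lra.
  have -> : crho (cmv_alpha alpha (k - 1)) * u (k - 1) - cmv_alpha alpha (k - 1) * u k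
    - (crho (cmv_alpha beta (k - 1)) * u (k - 1) - cmv_alpha beta (k - 1) * u k) =
    (crho (cmv_alpha alpha (k - 1)) - crho (cmv_alpha beta (k - 1))) * u (k - 1)
    - (cmv_alpha alpha (k - 1) - cmv_alpha beta (k - 1)) * u k by ring.
  apply: le_trans (normcB _ _) _; rewrite !Normc.normcM.
  have := ler_wpM2r (normc_ge0 (u k)) (He (k - 1)).
  have := ler_wpM2r (normc_ge0 (u (k - 1))) (Hr (k - 1)).
  have := mulr_ge0 e0 (normc_ge0 (u (k + 1))).
  lra.
rewrite ell2_normrZ normc_real (ger0_norm e0) [3 * e]mulrC -mulrA ler_wpM2l//.
apply: le_trans (ell2_normrD _ _) _.
have := ell2_normrD (ell2_shift (-1) A) A.
by rewrite !ell2_normr_shift ell2_normr_abs; lra.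
Qed.

Lemma cmv_perturb (e : R) : 0 < e -> exists2 d, 0 < d & forall alpha beta,
  (forall n, normc (cmv_alpha alpha n - cmv_alpha beta n) <= d) ->
  forall u, ell2_normr (cmv alpha u - cmv beta u) <= e * ell2_normr u.
Proof.
(* Two block factors contribute [3 * f] each; the term [f ^+ 2 / 2] below answers to
   [crho_modulus]. *)
move=> e0; pose f := e / 6; have f0 : 0 < f by rewrite divr_gt0.
exists (Num.min f (f ^+ 2 / 2)); first by rewrite lt_min f0 divr_gt0 ?exprn_gt0.
move=> alpha beta H u.
have Ha n : normc (cmv_alpha alpha n - cmv_alpha beta n) <= f.
  by apply: le_trans (H n) _; rewrite ge_min lexx.
have Hr n : normc (crho (cmv_alpha alpha n) - crho (cmv_alpha beta n)) <= f.
  rewrite -ler_sqr ?nnegrE ?normc_ge0 ?(ltW f0)//.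
  apply: le_trans (crho_modulus (ltW (cmv_alpha_lt1 _ _)) (ltW (cmv_alpha_lt1 _ _))) _.
  have : normc (cmv_alpha alpha n - cmv_alpha beta n) <= f ^+ 2 / 2.
    by apply: le_trans (H n) _; rewrite ge_min lexx orbT.
  lra.
rewrite !cmv_block.
have -> : block alpha true (block alpha false u) - block beta true (block beta false u) =
  block alpha true (block alpha false u - block beta false u) +
  (block alpha true (block beta false u) - block beta true (block beta false u)).
  by rewrite linearB addrA subrK.
apply: le_trans (ell2_normrD _ _) _.
have := block_perturb true (block beta false u) Ha Hr.
have := block_perturb false u Ha Hr.
by rewrite !block_isometry /f; lra.
Qed.

(** An odd translation would exchange the two kinds of rows. *)
Lemma cmv_shift alpha (m : int) u : (2 %| m)%Z ->
  cmv (fun n => alpha (n + m)) (ell2_shift m u) = ell2_shift m (cmv alpha u).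
Proof.
move=> m2; apply: ell2_ext => k; rewrite /= /cmv_seq.
have -> : (2 %| k + m)%Z = (2 %| k)%Z by lia.
have E j : k + m - j = k - j + m by lia.
have E' i j : i + j + m = i + m + j by lia.
by case: ifP => _; rewrite !E /cmv_row1 /cmv_row2 /cmv_rho !E'.
Qed.

End cmv_perturbation.

(** * Transfer matrices *)

Section matrices2.
Context {R : realType}.

(** The entrywise norm is submultiplicative, and on [szego_vector] it is a sum of two moduli, hence
    the value at a site of a sequence in [ell2]. *)
Definition l1norm m n (A : 'M[R[i]]_(m, n)) : R := \sum_i \sum_j normc (A i j).

Lemma l1norm_ge0 m n (A : 'M[R[i]]_(m, n)) : 0 <= l1norm A.
Proof. by apply: sumr_ge0 => i _; apply: sumr_ge0 => j _; exact: normc_ge0. Qed.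

Lemma l1normD m n (A B : 'M[R[i]]_(m, n)) : l1norm (A + B) <= l1norm A + l1norm B.
Proof.
rewrite /l1norm -big_split; apply: ler_sum => i _; rewrite -big_split.
by apply: ler_sum => j _; rewrite mxE normcD.
Qed.

Lemma l1normN m n (A : 'M[R[i]]_(m, n)) : l1norm (- A) = l1norm A.
Proof. by apply: eq_bigr => i _; apply: eq_bigr => j _; rewrite mxE normcN. Qed.

Lemma l1normZ m n (c : R[i]) (A : 'M[R[i]]_(m, n)) :
  l1norm (c *: A) = normc c * l1norm A.
Proof.
rewrite /l1norm mulr_sumr; apply: eq_bigr => i _.
by rewrite mulr_sumr; apply: eq_bigr => j _; rewrite mxE Normc.normcM.
Qed.

Lemma normc_sum (J : Type) (r : seq J) (P : pred J) (F : J -> R[i]) :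
  normc (\sum_(j <- r | P j) F j) <= \sum_(j <- r | P j) normc (F j).
Proof.
elim/big_rec2: _ => [|j y x _ H]; first by rewrite Normc.normc0.
by apply: le_trans (normcD _ _) _; rewrite lerD2l.
Qed.

Lemma l1normM m n p (A : 'M[R[i]]_(m, n)) (B : 'M[R[i]]_(n, p)) :
  l1norm (A *m B) <= l1norm A * l1norm B.
Proof.
rewrite /l1norm mulr_suml; apply: ler_sum => i _.
apply: (@le_trans _ _ (\sum_k \sum_j normc (A i j) * normc (B j k))).
  apply: ler_sum => k _; rewrite mxE; apply: le_trans (normc_sum _ _ _) _.
  by under eq_bigr do rewrite Normc.normcM.
rewrite exchange_big mulr_suml; apply: ler_sum => j _ /=.
rewrite -mulr_sumr ler_wpM2l ?normc_ge0// (bigD1 j)//= lerDl.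
by apply: sumr_ge0 => k _; apply: sumr_ge0 => l _; exact: normc_ge0.
Qed.

Lemma sum_ord2 (V : nmodType) (F : 'I_2 -> V) : \sum_i F i = F 0 + F 1.
Proof. by rewrite !big_ord_recl big_ord0 addr0; congr (_ + F _); apply/val_inj. Qed.

Lemma mx2P m (A B : 'M[R[i]]_(2, m)) : (forall j, A 0 j = B 0 j) ->
  (forall j, A 1 j = B 1 j) -> A = B.
Proof.
move=> H0 H1; apply/matrixP => i j.
by case: i => [[|[|//]] p]; [have -> : Ordinal p = 0 by apply/val_inj|
  have -> : Ordinal p = 1 by apply/val_inj].
Qed.

Lemma ord2P (P : 'I_2 -> Prop) : P 0 -> P 1 -> forall i, P i.
Proof.
move=> P0 P1 [[|[|//]] p].
  by have -> : Ordinal p = 0 by apply/val_inj.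
by have -> : Ordinal p = 1 by apply/val_inj.
Qed.

Definition mx2 (a b c d : R[i]) : 'M[R[i]]_2 :=
  \matrix_(i, j) (if i == 0 then if j == 0 then a else b
                  else if j == 0 then c else d).

Definition cv2 (a b : R[i]) : 'cV[R[i]]_2 := \col_i (if i == 0 then a else b).

Lemma cv2E0 (a b : R[i]) j : cv2 a b 0 j = a. Proof. by rewrite mxE. Qed.
Lemma cv2E1 (a b : R[i]) j : cv2 a b 1 j = b. Proof. by rewrite mxE. Qed.
Lemma mx2E00 (a b c d : R[i]) : mx2 a b c d 0 0 = a. Proof. by rewrite mxE. Qed.
Lemma mx2E01 (a b c d : R[i]) : mx2 a b c d 0 1 = b. Proof. by rewrite mxE. Qed.
Lemma mx2E10 (a b c d : R[i]) : mx2 a b c d 1 0 = c. Proof. by rewrite mxE. Qed.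
Lemma mx2E11 (a b c d : R[i]) : mx2 a b c d 1 1 = d. Proof. by rewrite mxE. Qed.
Definition mx2E := (cv2E0, cv2E1, mx2E00, mx2E01, mx2E10, mx2E11).

Lemma mulmx2E m (A : 'M[R[i]]_2) (B : 'M[R[i]]_(2, m)) i j :
  (A *m B) i j = A i 0 * B 0 j + A i 1 * B 1 j.
Proof. by rewrite mxE sum_ord2. Qed.

Lemma trace2 (A : 'M[R[i]]_2) : \tr A = A 0 0 + A 1 1.
Proof. by rewrite /mxtrace sum_ord2. Qed.

Lemma det2 (A : 'M[R[i]]_2) : \det A = A 0 0 * A 1 1 - A 0 1 * A 1 0.
Proof.
rewrite (expand_det_row _ 0) sum_ord2 /cofactor !det_mx11 !mxE /=.
have -> : lift 0 0 = 1 :> 'I_2 by apply/val_inj.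
have -> : lift 1 0 = 0 :> 'I_2 by apply/val_inj.
by rewrite addn0 add0n expr0 expr1; ring.
Qed.

(** Identifies the inverse as [\tr A - A], so that the trace times a vector is the sum of its images
    under [A] and under the inverse of [A]. *)
Lemma cayley_hamilton2 (A : 'M[R[i]]_2) : \det A = 1 ->
  ((\tr A)%:M - A) *m A = 1%:M.
Proof.
rewrite det2 trace2 => dA.
by apply: mx2P; apply: ord2P; rewrite mulmx2E !mxE /= ?mulr1n ?mulr0n -?dA; ring.
Qed.

End matrices2.

Section szego.
Context {R : realType}.
Implicit Types (alpha : int -> disk R) (u v : ell2 int R) (m n : int) (k : nat) (w z : R[i]).

(** The Szego transfer matrix of the coefficient [z] at the spectral parameter [w ^+ 2], divided by
    [w] and conjugated into SU(1,1). *)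
Definition szego w z : 'M[R[i]]_2 := (crho z)^-1 *: mx2 w^* (- z) (- z^*) w.

Lemma crho_neq0 z : normc z < 1 -> crho z != 0.
Proof.
move=> z1; rewrite /crho; have : 0 < Num.sqrt (1 - normc z ^+ 2).
  by rewrite sqrtr_gt0 subr_gt0 expr_lt1 ?normc_ge0.
by move=> h; apply/eqP => -[] /eqP; rewrite gt_eqF.
Qed.

Lemma circle_mulJ w : normc w = 1 -> w * w^* = 1.
Proof. by move=> w1; rewrite -sqr_normc_conj w1 expr1n. Qed.

Lemma det_szego w z : normc w = 1 -> normc z < 1 -> \det (szego w z) = 1.
Proof.
move=> w1 z1; rewrite det2 !mxE /=.
have wJ := circle_mulJ w1; have r0 := crho_neq0 z1; have r2 := crhoE (ltW z1).
transitivity ((w * w^* - z * z^*) / crho z ^+ 2); first by field.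
by rewrite wJ -r2 divff// expf_neq0.
Qed.

Fixpoint transfer w (a : int -> R[i]) m (k : nat) : 'M[R[i]]_2 :=
  if k is k'.+1 then szego w (a (m + k'%:Z)) *m transfer w a m k' else 1%:M.

Lemma transferSr w a m k :
  transfer w a m k.+1 = transfer w a (m + 1) k *m szego w (a m).
Proof.
elim: k => [|k IH]; first by rewrite /= mulmx1 mul1mx addr0.
rewrite [LHS]/= -/(transfer w a m k.+1) IH mulmxA [transfer _ _ _ k.+1]/=.
by have -> : m + k.+1%:Z = m + 1 + k%:Z by lia.
Qed.

Lemma det_transfer w a m k : normc w = 1 -> (forall n, normc (a n) < 1) ->
  \det (transfer w a m k) = 1.
Proof.
move=> w1 a1; elim: k => [|k IH]; first by rewrite det1.
by rewrite /= det_mulmx IH det_szego// mulr1.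
Qed.

(** Moving the starting point by one site conjugates the period matrix by a Szego matrix. *)
Lemma trace_transfer w a (P : nat) m : normc w = 1 -> (forall n, normc (a n) < 1) ->
  (forall n, a (n + P%:Z) = a n) ->
  \tr (transfer w a m P) = \tr (transfer w a 0 P).
Proof.
move=> w1 a1 aP.
have step n : \tr (transfer w a (n + 1) P) = \tr (transfer w a n P).
  have := transferSr w a n P; rewrite /= aP => e.
  have dS := det_szego w1 (a1 n); have uS : szego w (a n) \in unitmx.
    by rewrite unitmxE dS unitr1.
  have -> : transfer w a (n + 1) P = szego w (a n) *m transfer w a n P *m invmx (szego w (a n)).
    by rewrite e mulmxK.
  by rewrite -mulmxA mxtrace_mulC -mulmxA mulVmx// mulmx1.
elim/int_rec: m => [//|n|n].
  have -> : n.+1%:Z = n%:Z + 1 by lia.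
  by rewrite step.
by have <- := step (- n.+1%:Z); have -> : - n.+1%:Z + 1 = - n%:Z by lia.
Qed.

Lemma transfer_periodic w a (P : nat) m k : (forall n, a (n + P%:Z) = a n) ->
  transfer w a (m - P%:Z) k = transfer w a m k.
Proof.
move=> aP; elim: k => [//|k IH]; rewrite [LHS]/= [RHS]/= IH.
by rewrite -[a (m - _ + _)]aP; have -> : m - P%:Z + k%:Z + P%:Z = m + k%:Z by lia.
Qed.

(* The pair [(w u_m, v_m)], [v] being the image of [u] under the inner block
   operator, in an order depending on the parity of [m]. *)
Definition szego_vector w alpha u m : 'cV[R[i]]_2 :=
  if (2 %| m)%Z then cv2 (block alpha false u m) (w * u m)
  else cv2 (w * u m) (block alpha false u m).

(** An odd step only uses the definition of the inner block operator, so the defect of the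
    eigenvalue equation enters at even sites. *)
Definition szego_error w alpha u m : 'cV[R[i]]_2 :=
  let g := cmv alpha u - w ^+ 2 *: u in
  if (2 %| m)%Z then
    cv2 (- w^* * (cmv_alpha alpha m / crho (cmv_alpha alpha m) * g m + g (m + 1)))
        (g m / crho (cmv_alpha alpha m))
  else 0.

Lemma szego_step w alpha u m : normc w = 1 ->
  szego_vector w alpha u (m + 1) =
  szego w (cmv_alpha alpha m) *m szego_vector w alpha u m + szego_error w alpha u m.
Proof.
move=> w1; have wJ := circle_mulJ w1.
set z := cmv_alpha alpha m; have z1 : normc z < 1 by exact: cmv_alpha_lt1.
have r0 := crho_neq0 z1; have r2 := crhoE (ltW z1).
rewrite /szego_vector /szego_error.
have [me|mo] := boolP (2 %| m)%Z.
  have -> : (2 %| m + 1)%Z = false by lia.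
  rewrite -/z.
  have E1 : cmv alpha u m = z^* * block alpha false u m + crho z * block alpha false u (m + 1).
    by rewrite cmv_block [LHS]block_seq_first.
  have E2 : cmv alpha u (m + 1) = crho z * block alpha false u m - z * block alpha false u (m + 1).
    by rewrite cmv_block [LHS]block_seq_second.
  have G j : (cmv alpha u - w ^+ 2 *: u) j = cmv alpha u j - w ^+ 2 * u j by [].
  rewrite !G E1 E2;
  move: (block alpha false u m) (block alpha false u (m + 1)) (u m) (u (m + 1)) => b b' x x'.
  apply: mx2P => j; rewrite [RHS]mxE mulmx2E !mxE /=.
    apply/eqP; rewrite -subr_eq0; apply/eqP.
    transitivity (w^* * b / crho z * (crho z ^+ 2 - (1 - z * z^*))
      - (w * w^* - 1) * (w * x' + z * w * x / crho z)); first by field.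
    by rewrite r2 wJ; ring.
  by field.
have -> : (2 %| m + 1)%Z = true by lia.
have mF : (2 %| m)%Z = false by exact/negbTE.
have E1 : block alpha false u m = z^* * u m + crho z * u (m + 1).
  by rewrite [LHS]block_seq_first.
have E2 : block alpha false u (m + 1) = crho z * u m - z * u (m + 1).
  by rewrite [LHS]block_seq_second.
rewrite addr0 E1 E2; set x : R[i] := u m; set x' : R[i] := u (m + 1).
apply: mx2P => j; rewrite mulmx2E !mxE /=.
  apply/eqP; rewrite -subr_eq0; apply/eqP.
  transitivity (x / crho z * (crho z ^+ 2 - (1 - z * z^*))
    - x / crho z * (w * w^* - 1)); first by field.
  by rewrite r2 wJ; ring.
by field.
Qed.

Lemma szego_vector_l1norm w alpha u m : normc w = 1 ->
  l1norm (szego_vector w alpha u m) = normc (u m) + normc (block alpha false u m).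
Proof.
move=> w1; rewrite /l1norm sum_ord2 !big_ord1 /szego_vector.
by case: ifP => _; rewrite !mx2E Normc.normcM w1 mul1r // addrC.
Qed.

Lemma szego_error_l1norm w alpha u m (B : R) : normc w = 1 -> 1 <= B ->
  normc (crho (cmv_alpha alpha m))^-1 <= B ->
  l1norm (szego_error w alpha u m) <= 2 * B *
    (normc ((cmv alpha u - w ^+ 2 *: u) m) + normc ((cmv alpha u - w ^+ 2 *: u) (m + 1))).
Proof.
move=> w1 B1 HB; rewrite /szego_error; set g := _ - _ *: _.
have := normc_ge0 (g m); have := normc_ge0 (g (m + 1)).
rewrite /l1norm sum_ord2 !big_ord1; case: ifP => _; last first.
  by rewrite !mxE Normc.normc0 => g0 g1; rewrite addr0 !mulr_ge0 ?addr_ge0 ?(le_trans ler01 B1).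
rewrite !mx2E !Normc.normcM normcN normc_conj w1 mul1r.
have := normcD (cmv_alpha alpha m / crho (cmv_alpha alpha m) * g m) (g (m + 1)).
rewrite !Normc.normcM.
have := ltW (cmv_alpha_lt1 alpha m).
have := normc_ge0 (cmv_alpha alpha m); have := normc_ge0 (crho (cmv_alpha alpha m))^-1.
move: HB; move: (normc _^-1) (normc (cmv_alpha _ _)) (normc (g m)) (normc (g (m + 1))) (normc (_ + _)).
move=> r p x y s rB r0 p0 p1 H y0 x0.
have : p * r * x <= B * x by rewrite ler_wpM2r//; apply: le_trans rB; rewrite ler_piMl.
have : x * r <= B * x by rewrite mulrC ler_wpM2r.
have : y <= B * y by rewrite ler_peMl.
lra.
Qed.

Lemma szego_l1norm w z (B : R) : normc w = 1 -> normc z < 1 ->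
  normc (crho z)^-1 <= B -> l1norm (szego w z) <= 4 * B.
Proof.
move=> w1 z1 HB; rewrite l1normZ /l1norm !sum_ord2 !mx2E.
rewrite !normcN !normc_conj w1; have := normc_ge0 (crho z)^-1.
move: HB (normc_ge0 z) (ltW z1); move: (normc _^-1) (normc z) => r p rB p0 p1 r0.
have : r * (1 + p + (p + 1)) <= r * 4 by rewrite ler_wpM2l//; lra.
lra.
Qed.

(** Variation of constants along [k] steps. The crude constants depend on [k] and [B] alone, which
    makes the conclusion of [hyperbolic_bounded_below] uniform; the factor 2 is the norm of the
    identity. *)
Lemma szego_iterate w alpha u m k (B : R) : normc w = 1 -> 1 <= B ->
  (forall n, normc (crho (cmv_alpha alpha n))^-1 <= B) ->
  l1norm (transfer w (cmv_alpha alpha) m k) <= 2 * (4 * B) ^+ k /\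
  l1norm (szego_vector w alpha u (m + k%:Z)
    - transfer w (cmv_alpha alpha) m k *m szego_vector w alpha u m) <=
  (4 * B) ^+ k * \sum_(j < k) (2 * B *
    (normc ((cmv alpha u - w ^+ 2 *: u) (m + j%:Z)) +
     normc ((cmv alpha u - w ^+ 2 *: u) (m + j%:Z + 1)))).
Proof.
move=> w1 B1 HB; set g := cmv alpha u - _.
have B0 : 0 <= B by exact: le_trans B1.
have K1 : 1 <= 4 * B by lra.
have d0 n : 0 <= 2 * B * (normc (g n) + normc (g (n + 1))).
  by rewrite !mulr_ge0 ?addr_ge0 ?normc_ge0.
elim: k => [|k [IH1 IH2]].
  rewrite expr0 mulr1 big_ord0 mulr0 mul1mx addr0 subrr; split.
    by rewrite /l1norm !sum_ord2 !mxE !eqxx Normc.normc1 Normc.normc0; lra.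
  by rewrite /l1norm sum_ord2 !big_ord1 !mxE Normc.normc0 addr0.
have S4 := szego_l1norm w1 (cmv_alpha_lt1 alpha (m + k%:Z)) (HB _).
split.
  rewrite /=; apply: le_trans (l1normM _ _) _; rewrite exprS.
  by rewrite mulrCA; apply: ler_pM; rewrite ?l1norm_ge0.
have -> : m + k.+1%:Z = m + k%:Z + 1 by lia.
rewrite szego_step// [transfer _ _ _ _.+1]/= -mulmxA addrAC -mulmxBr.
apply: le_trans (l1normD _ _) _.
rewrite big_ord_recr/= mulrDr; apply: lerD.
  apply: le_trans (l1normM _ _) _; rewrite exprS -mulrA.
  by apply: ler_pM; rewrite ?l1norm_ge0.
apply: le_trans (szego_error_l1norm _ w1 B1 (HB _)) _.
by rewrite ler_peMl ?d0// exprn_ege1.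
Qed.

(** With [M] the period matrix at [m] and [T] its trace, [T Y_m = M Y_m + M^-1 Y_m] equals
    [Y_(m + P) + Y_(m - P)] up to the defect. In [ell2] norms this reads [t N <= 2 N + C D], with
    [D] the norm of the defect, and bounds [N] because [t] exceeds 2. *)
Lemma hyperbolic_bounded_below (P : nat) (B t : R) : 1 <= B -> 2 < t ->
  exists2 c, 0 < c & forall alpha w, normc w = 1 ->
    (forall n, normc (crho (cmv_alpha alpha n))^-1 <= B) ->
    (forall n, cmv_alpha alpha (n + P%:Z) = cmv_alpha alpha n) ->
    t <= normc (\tr (transfer w (cmv_alpha alpha) 0 P)) ->
    bounded_below (cmv alpha) (w ^+ 2) c.
Proof.
move=> B1 t2.
have B0 : 0 <= B by exact: le_trans B1.
pose K := (4 * B) ^+ P.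
have K1 : 1 <= K by rewrite exprn_ege1//; lra.
have K0 : 0 <= K by exact: le_trans K1.
(* Each of the [P] summands of [G] below is made of four translates of the defect, whence
   [P%:R * 4]; the added 1 keeps [C] positive. *)
pose C := K * (1 + 2 * K) * (2 * B) * (P%:R * 4) + 1.
have C0 : 0 < C by rewrite ltr_wpDl// !mulr_ge0// addr_ge0 ?mulr_ge0.
exists ((t - 2) / C); first by rewrite divr_gt0// subr_gt0.
move=> alpha w w1 HB aP tr u.
set g := cmv alpha u - w ^+ 2 *: u.
pose d n := 2 * B * (normc (g n) + normc (g (n + 1))).
have d0 n : 0 <= d n by rewrite !mulr_ge0 ?addr_ge0 ?normc_ge0.
pose Y := szego_vector w alpha u; pose M m := transfer w (cmv_alpha alpha) m P.
have al1 n : normc (cmv_alpha alpha n) < 1 by exact: cmv_alpha_lt1.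
have key m : t * l1norm (Y m) <= l1norm (Y (m + P%:Z)) + l1norm (Y (m - P%:Z)) +
    K * (1 + 2 * K) * \sum_(j < P) (d (m + j%:Z) + d (m - P%:Z + j%:Z)).
  have [M1 H1] := szego_iterate u m P w1 B1 HB.
  have [M2 H2] := szego_iterate u (m - P%:Z) P w1 B1 HB.
  rewrite subrK transfer_periodic// in H2.
  move: M1 H1 H2; rewrite -/(M m) -/K -/(Y m) -/(Y (m + P%:Z)) -/(Y (m - P%:Z)).
  rewrite -/g.
  set D1 := \sum_(j < P) _; set D2 := \sum_(j < P) _ => M1 H1 H2.
  have -> : \sum_(j < P) (d (m + j%:Z) + d (m - P%:Z + j%:Z)) = D1 + D2.
    by rewrite big_split.
  have D10 : 0 <= D1 by apply: sumr_ge0 => j _; exact: d0.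
  have D20 : 0 <= D2 by apply: sumr_ge0 => j _; exact: d0.
  have CH := cayley_hamilton2 (det_transfer m P w1 al1); rewrite -/(M m) in CH.
  pose T := \tr (M m); pose A := T%:M - M m.
  have tT : t <= normc T by rewrite /T trace_transfer.
  (* [A] inverts [M m], and by periodicity [M m] is also the matrix leading from site [m - P] to
     site [m]. *)
  have AE : T *: Y m = Y (m + P%:Z) + Y (m - P%:Z)
     + (- (Y (m + P%:Z) - M m *m Y m)) + A *m (Y m - M m *m Y (m - P%:Z)).
    rewrite mulmxBr mulmxA CH mul1mx /A mulmxBl mul_scalar_mx.
    by rewrite opprB; apply/matrixP => i j; rewrite !mxE; ring.
  have A1 : l1norm A <= 2 * K.
    have -> : l1norm A = l1norm (M m).
      rewrite /l1norm !sum_ord2 /A /T trace2 !mxE /= !mulr1n !mulr0n !sub0r !normcN.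
      rewrite addrK [X in normc X + _ + _]addrAC subrr add0r.
      by move: (normc _) (normc _) (normc _) (normc _) => q1 q2 q3 q4; ring.
    exact: M1.
  have := congr1 (@l1norm R 2 1) AE; rewrite l1normZ => AE1.
  apply: (@le_trans _ _ (normc T * l1norm (Y m))).
    by rewrite ler_wpM2r ?l1norm_ge0.
  rewrite AE1; apply: le_trans (l1normD _ _) _.
  apply: le_trans (lerD (l1normD _ _) (l1normM _ _)) _.
  apply: le_trans (lerD (lerD (l1normD _ _) (lexx _)) (lexx _)) _.
  rewrite l1normN -addrA; apply: lerD => //.
  have : l1norm A * l1norm (Y m - M m *m Y (m - P%:Z)) <= 2 * K * (K * D2).
    by apply: ler_pM; rewrite ?l1norm_ge0.
  have : 0 <= K * D2 by rewrite mulr_ge0.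
  have : 0 <= K * (K * D1) by rewrite !mulr_ge0.
  move: H1; clear; lra.
pose y := ell2_abs u + ell2_abs (block alpha false u).
have yE m : y m = (l1norm (Y m))%:C%C.
  by rewrite szego_vector_l1norm// rmorphD.
pose G0 := ell2_abs g + ell2_shift 1 (ell2_abs g).
pose G := \sum_(j < P) (ell2_shift j%:Z G0 + ell2_shift (j%:Z - P%:Z) G0).
have GE m : ((2 * B)%:C%C *: G) m = (\sum_(j < P) (d (m + j%:Z) + d (m - P%:Z + j%:Z)))%:C%C.
  rewrite ell2E /G ell2_sumE mulr_sumr rmorph_sum; apply: eq_bigr => j _.
  rewrite rmorphD /d !rmorphM !rmorphD -mulrDr; congr (_ * (_ + _)).
  have -> : m - P%:Z + j%:Z = m + (j%:Z - P%:Z) by lia.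
  by [].
have NG : ell2_normr G <= P%:R * 4 * ell2_normr g.
  apply: le_trans (ell2_normr_sum _ _ _) _.
  rewrite -mulrA mulr_natl -[P in leRHS]card_ord -sumr_const; apply: ler_sum => j _.
  have := ell2_normrD (ell2_shift j%:Z G0) (ell2_shift (j%:Z - P%:Z) G0).
  have := ell2_normrD (ell2_abs g) (ell2_shift 1 (ell2_abs g)).
  by rewrite !ell2_normr_shift ell2_normr_abs -/G0; lra.
have Ny : t * ell2_normr y <= 2 * ell2_normr y + C * ell2_normr g.
  have t0 : 0 <= t by lra.
  pose L := K * (1 + 2 * K).
  have L0 : 0 <= L by rewrite mulr_ge0// addr_ge0// mulr_ge0.
  apply: (@le_trans _ _ (ell2_normr (ell2_shift P%:Z y + ell2_shift (- P%:Z) y +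
    L%:C%C *: ((2 * B)%:C%C *: G)))).
    rewrite -[t]ger0_norm// -normc_real -ell2_normrZ.
    apply: ell2_normr_le_pointwise => m.
    rewrite 2!ell2_addE (ell2_scaleE t%:C%C) (ell2_scaleE L%:C%C) GE.
    rewrite -[ell2_shift _ y m]/(y (m + P%:Z)) -[ell2_shift _ y m]/(y (m - P%:Z)) !yE.
    have S0 : 0 <= \sum_(j < P) (d (m + j%:Z) + d (m - P%:Z + j%:Z)).
      by apply: sumr_ge0 => j _; rewrite addr_ge0.
    rewrite -!rmorphM -!rmorphD !normc_real [`|t * _|]ger0_norm.
      by rewrite ger0_norm// addr_ge0 ?(mulr_ge0 L0 S0)// addr_ge0 ?l1norm_ge0.
    by rewrite mulr_ge0 ?l1norm_ge0.
  apply: le_trans (ell2_normrD _ _) _; apply: lerD.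
    by apply: le_trans (ell2_normrD _ _) _; rewrite !ell2_normr_shift; lra.
  rewrite !ell2_normrZ !normc_real !ger0_norm//; last by rewrite mulr_ge0.
  have := ler_wpM2l (mulr_ge0 L0 (mulr_ge0 (ler0n R 2) B0)) NG.
  have := ell2_normr_ge0 g.
  by rewrite /C -/L; clear; lra.
have uy : ell2_normr u <= ell2_normr y.
  rewrite -(ell2_normr_abs u); apply: ell2_normr_le_pointwise => m.
  rewrite ell2_addE -rmorphD !normc_real !ger0_norm ?addr_ge0 ?normc_ge0//.
  by rewrite lerDl normc_ge0.
rewrite -/g mulrAC ler_pdivrMr// [leRHS]mulrC.
apply: (@le_trans _ _ ((t - 2) * ell2_normr y)); last by lra.
by rewrite ler_wpM2l// subr_ge0 ltW.
Qed.

(** Without defect the steps of the recursion are invertible, so a zero vector at site 0 propagates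
    in both directions. This bounds the dimension of the kernel by two. *)
Lemma kernel_vanish alpha u w : normc w = 1 -> cmv alpha u = w ^+ 2 *: u ->
  szego_vector w alpha u 0 = 0 -> u = 0.
Proof.
move=> w1 ku Y0; have al1 n : normc (cmv_alpha alpha n) < 1 by exact: cmv_alpha_lt1.
have step m : szego_vector w alpha u (m + 1) = szego w (cmv_alpha alpha m) *m szego_vector w alpha u m.
  rewrite szego_step// /szego_error ku subrr; case: ifP => _; last by rewrite addr0.
  by rewrite mulr0 addr0 mulr0 mul0r; apply: mx2P => j; rewrite mxE !mx2E addr0.
have Y m : szego_vector w alpha u m = 0.
  elim/int_rec: m => [//|n|n].
    have -> : n.+1%:Z = n%:Z + 1 by lia.
    by rewrite step => ->; rewrite mulmx0.
  have := step (- n.+1%:Z); have -> : - n.+1%:Z + 1 = - n%:Z by lia.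
  move=> -> /(congr1 (fun X => invmx (szego w (cmv_alpha alpha (- n.+1%:Z))) *m X)).
  by rewrite mulmx0 mulmxA mulVmx ?mul1mx// unitmxE det_szego// unitr1.
have w0 : w != 0 by apply/eqP => ww; move: w1; rewrite ww Normc.normc0; lra.
apply: ell2_ext => m; have := szego_vector_l1norm alpha u m w1.
rewrite Y; have -> : l1norm (0 : 'cV[R[i]]_2) = 0.
  by rewrite /l1norm sum_ord2 !big_ord1 !mxE Normc.normc0 addr0.
have := normc_ge0 (u m); have := normc_ge0 (block alpha false u m) => h1 h2 h3.
by apply: Normc.eq0_normc; lra.
Qed.

End szego.

(** * Almost periodic coefficients and isolated points of the spectrum *)

Section no_isolated_points.
Context {R : realType}.

Lemma even_multiple_gt (L p : nat) : (0 < p)%N ->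
  exists q : int, (L < absz (q * p%:Z * 2)%R)%N.
Proof. by move=> p0; exists L.+1%:Z; rewrite !abszM /=; nia. Qed.

Lemma far_translate (L : nat) (n q y : int) : (L + `|n| < `|q|)%N -> y != 0 ->
  (L < absz (n + y * q)%R)%N.
Proof.
move=> Lq y0; have : (`|q| <= absz (y * q)%R)%N by rewrite abszM leq_pmull// absz_gt0.
by move: (y * q) => x; lia.
Qed.

Lemma ell2_normr_gt0 (I : choiceType) (u : ell2 I R) : u != 0 -> 0 < ell2_normr u.
Proof.
by move=> u0; rewrite lt_def ell2_normr_ge0 andbT; apply: contra_neq u0; exact: ell2_normr_eq0.
Qed.

(* Three translates of a vector of the kernel of [E - z0], along three far apart
   almost periods, are close to linearly independent vectors of the kernel,
   which has dimension at most two. *)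
Lemma cmv_not_isolated (alpha : int -> disk R) (z0 : R[i]) (r : R) :
  (forall e, 0 < e -> exists2 p : nat, (0 < p)%N & forall j n : int,
     normc (cmv_alpha alpha (n + j * p%:Z) - cmv_alpha alpha n) <= e) ->
  normc z0 = 1 -> 0 < r ->
  (forall z, normc z = 1 -> z != z0 -> normc (z - z0) <= 2 * r ->
     exists2 c, 0 < c & bounded_below (cmv alpha) z c) ->
  exists2 c, 0 < c & bounded_below (cmv alpha) z0 c.
Proof.
move=> AP z01 r0 iso; apply: contrapT => nbb.
have gap := isolated_gap (@cmv_isometry R alpha) z01 r0 iso.
have [C C0 near] := near_kernel (@cmv_isometry R alpha) z01 r0 gap.
have [v kv v0] : exists2 v, cmv alpha v = z0 *: v & v != 0.
  (* Since [C * (C + 1)^-1 < 1], a vector violating the bound with this constant is closer to the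
     kernel than its own norm, so the kernel is nonzero. *)
  have c0 : 0 < (C + 1)^-1 by rewrite invr_gt0 ltr_wpDl.
  have /existsNP[x /negP] : ~ bounded_below (cmv alpha) z0 (C + 1)^-1.
    by move=> bb; apply: nbb; exists (C + 1)^-1.
  rewrite -ltNge => xlt; have [k kk kx] := near x; exists k => //.
  apply/eqP => k0; move: kx; rewrite k0 sub0r ell2_normrN.
  have x0 : 0 < ell2_normr x.
    rewrite -(pmulr_rgt0 _ c0); apply: le_lt_trans xlt; exact: ell2_normr_ge0.
  have : C * ell2_normr (cmv alpha x - z0 *: x) <= C * ((C + 1)^-1 * ell2_normr x).
    by rewrite ler_wpM2l// ltW.
  have : C * ((C + 1)^-1 * ell2_normr x) < ell2_normr x.
    rewrite mulrA gtr_pMl// ltr_pdivrMr ?ltr_wpDl// mul1r ltrDl//.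
  by clear; lra.
have [n0 vn0] : exists n0, v n0 != 0.
  apply: contrapT => /forallNP H; move/eqP: v0; apply; apply: ell2_ext => n.
  by have /negP := H n; rewrite negbK => /eqP.
pose eta := normc (v n0).
have eta0 : 0 < eta.
  by rewrite lt_def normc_ge0 andbT; apply: contra_neq vn0; exact: Normc.eq0_normc.
have Nv : 0 < ell2_normr v by exact: ell2_normr_gt0.
(* Chosen so that a translate of [v] with defect at most [e * ell2_normr v] lies within [eta / 16]
   of the kernel. *)
pose e := eta / (16 * (C + 1) * ell2_normr v).
have C1 : 0 < C + 1 by rewrite ltr_wpDl.
have e0 : 0 < e by rewrite divr_gt0// !mulr_gt0.
have Ce : C * (e * ell2_normr v) <= eta / 16.
  have -> : C * (e * ell2_normr v) = eta / 16 * (C / (C + 1)).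
    by rewrite /e; field; rewrite !gt_eqF.
  rewrite ger_pMr ?divr_gt0// ler_pdivrMr// mul1r lerDl//.
have [d d0 Hd] := cmv_perturb e0.
have [p p0 Hp] := AP _ d0.
have eta16 : 0 < eta / 16 by rewrite divr_gt0.
have [s Hs] := ell2_tail v eta16.
have [L HL] : exists L : nat, forall k : int, (L < `|k|)%N -> normc (v k) < eta / 16.
  exists (\max_(k <- s) `|k|)%N => k Lk; apply: Hs; apply/negP => ks.
  by move: Lk; rewrite ltnNge (@leq_bigmax_seq _ s xpredT (fun k : int => `|k|%N) k ks isT).
have [q' q'L] := even_multiple_gt (L + `|n0|) p0.
(* Even, as [cmv_shift] requires, a multiple of the almost period, and long enough to move [n0] to
   where [v] is small. *)
pose q := q' * p%:Z * 2.
pose wj (j : 'I_3) := ell2_shift (- ((j : nat)%:Z * q)) v.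
have Hw j : ell2_normr (cmv alpha (wj j) - z0 *: wj j) <= e * ell2_normr v.
  pose m : int := (j : nat)%:Z * q.
  have m2 : (2 %| - m)%Z by rewrite -mulNr mulrA; apply: dvdz_mull.
  pose alpha' n := alpha (n + m).
  have aE : (fun n => alpha' (n - m)) = alpha.
    by apply/funext => n; rewrite /alpha' subrK.
  have := cmv_shift alpha' v m2; rewrite aE => ->.
  have -> : ell2_shift (- m) (cmv alpha' v) - z0 *: wj j =
      ell2_shift (- m) (cmv alpha' v - cmv alpha v).
    by rewrite kv; apply: ell2_ext => k; rewrite !ell2E.
  rewrite ell2_normr_shift; apply: Hd => n; rewrite /cmv_alpha /alpha'.
  have -> : n + m = n + (j : nat)%:Z * q' * 2 * p%:Z by rewrite /m /q; ring.
  exact: Hp.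
have /boolp.choice[k Hk] : forall j : 'I_3, exists k, cmv alpha k = z0 *: k /\
    ell2_normr (k - wj j) <= eta / 16.
  move=> j; have [k kk kw] := near (wj j); exists k; split=> //.
  apply: le_trans kw _; apply: le_trans Ce.
  by apply: ler_wpM2l => //; exact: Hw.
(* At these points the values of the [k j] form a diagonally dominant matrix: at least
   [15 / 16 * eta] on the diagonal, at most [eta / 8] elsewhere. *)
pose x (i : 'I_3) : int := n0 + (i : nat)%:Z * q.
have kdiag i : 15 / 16 * eta <= normc (k i (x i)).
  have := normc_le_ell2_normr (k i - wj i) (x i); rewrite ell2_subE.
  have -> : wj i (x i) = v n0 by rewrite /wj /= /x addrK.
  have := normcD (v n0 - k i (x i)) (k i (x i)); rewrite subrK normcBC -/eta.
  by have [_] := Hk i; lra.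
have koff i j : i != j -> normc (k j (x i)) <= eta / 8.
  move=> ij; have := normc_le_ell2_normr (k j - wj j) (x i); rewrite ell2_subE.
  have := normcD (k j (x i) - wj j (x i)) (wj j (x i)); rewrite subrK.
  have : normc (wj j (x i)) < eta / 16.
    apply: HL; rewrite /x -addrA -mulrBl; apply: far_translate => //.
    by apply: contra_neq ij => /eqP; rewrite subr_eq0 => /eqP[] /val_inj.
  by have [_] := Hk j; lra.
pose w := sqrtc z0.
have w2 : w ^+ 2 = z0 by exact: sqr_sqrtc.
have w1 : normc w = 1.
  have := congr1 (@Normc.normc R) w2; rewrite normcX z01.
  by move/eqP; rewrite pexpr_eq1 ?normc_ge0// => /eqP.
(* Three rows of length two are dependent, so a nontrivial combination of the [k i] has a zero
   vector at site 0 and vanishes by [kernel_vanish]. *)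
pose X : 'M[R[i]]_(3, 2) := \matrix_(i, j) szego_vector w alpha (k i) 0 j 0.
have [c c0 cX] : exists2 c : 'rV[R[i]]_3, c != 0 & c *m X = 0.
  have /rowV0Pn[c cK c0] : kermx X != 0.
    by rewrite -mxrank_eq0 mxrank_ker subn_eq0 -ltnNge; apply: leq_ltn_trans (rank_leq_col X) _.
  by exists c => //; apply/sub_kermxP.
pose S := \sum_i c 0 i *: k i.
have SE n : S n = \sum_i c 0 i * k i n by rewrite ell2_sumE.
have S0 : S = 0.
  apply: (@kernel_vanish _ alpha _ w) => //.
    rewrite w2 linear_sum scaler_sumr; apply: eq_bigr => i _.
    transitivity (c 0 i *: cmv alpha (k i)); first exact: linearZ_LR.
    by rewrite (Hk i).1 !scalerA mulrC.
  have cXE j : \sum_i c 0 i * szego_vector w alpha (k i) 0 j 0 = 0.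
    transitivity ((c *m X) 0 j); last by rewrite cX mxE.
    rewrite [RHS]mxE; apply: eq_bigr => i _; congr (_ * _).
    by rewrite [RHS]mxE.
  have bE : block alpha false S 0 = \sum_i c 0 i * block alpha false (k i) 0.
    rewrite linear_sum ell2_sumE; apply: eq_bigr => i _.
    transitivity ((c 0 i *: block alpha false (k i)) 0) => //.
    by congr (ell2_seq _ 0); exact: linearZ_LR.
  have vE u : szego_vector w alpha u 0 = cv2 (block alpha false u 0) (w * u 0) by [].
  rewrite vE; apply: mx2P => j; rewrite ord1 mx2E [RHS]mxE.
    rewrite bE -[RHS](cXE 0); apply: eq_bigr => i _.
    by rewrite vE mx2E.
  rewrite SE -[RHS](cXE 1) mulr_sumr; apply: eq_bigr => i _.
  by rewrite vE mx2E; ring.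
(* At [x m], with [m] the index of the largest coefficient, the two other terms amount to at most
   [normc (c 0 m) * (eta / 4)], less than the diagonal one. *)
pose m := [arg max_(i > (0 : 'I_3)) normc (c 0 i)]%O.
have cm i : normc (c 0 i) <= normc (c 0 m).
  by rewrite /m; case: arg_maxP => // j _ /(_ i isT).
have cm0 : 0 < normc (c 0 m).
  rewrite lt_def normc_ge0 andbT; apply: contra_neq c0 => cm0.
  apply/rowP => i; rewrite mxE; apply: Normc.eq0_normc; apply/eqP.
  by rewrite eq_le normc_ge0 andbT -cm0.
have := congr1 (fun u : ell2 int R => u (x m)) S0; rewrite SE (bigD1 m)//=.
move/eqP; rewrite addr_eq0 => /eqP/(congr1 (@Normc.normc R)).
rewrite normcN Normc.normcM => E1.
have : normc (\sum_(i | i != m) c 0 i * k i (x m)) <= normc (c 0 m) * (eta / 4).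
  apply: le_trans (normc_sum _ _ _) _.
  apply: (@le_trans _ _ (\sum_(i : 'I_3 | i != m) normc (c 0 m) * (eta / 8))).
    apply: ler_sum => i im; rewrite Normc.normcM; apply: ler_pM; rewrite ?normc_ge0//.
    by apply: koff; rewrite eq_sym.
  rewrite sumr_const; have -> : #|[pred i | i != m]| = 2%N.
    have := cardC1 m; rewrite card_ord => h; rewrite -[RHS]/(3.-1) -h.
    exact: eq_card.
  by rewrite -mulrnAr ler_pM2l// mulr2n; lra.
rewrite -E1; apply/negP; rewrite -ltNge ltr_pM2l//.
by apply: lt_le_trans (kdiag m); lra.
Qed.

End no_isolated_points.

(** * Open subgroups of Cantor groups *)

Section zero_dimensional.
Context {T : topologicalType}.

(** In a compact Hausdorff space the intersection of the clopen sets containing [x] is connected; a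
    point [y] in all of them would belong to the component of [x]. *)
Lemma compact_totally_disconnected_zero_dimensional :
  compact [set: T] -> hausdorff_space T -> totally_disconnected [set: T] ->
  zero_dimensional T.
Proof.
move=> cT hT tdT x y xy; apply: contrapT => noU.
have sep D : clopen D -> D x -> D y.
  by move=> cD Dx; apply: contrapT => nDy; apply: noU; exists D.
pose Q := \bigcap_(D in [set D : set T | clopen D /\ D x]) D.
have Qx : Q x by move=> D [].
have Qy : Q y by move=> D [] /sep; apply.
have clQ : closed Q by apply: closed_bigI => D [[]].
pose F := filter_from [set D : set T | clopen D /\ D x] id.
have FF : ProperFilter F.
  apply: filter_from_proper; last by move=> ? [_ ?]; exists x.
  apply: filter_from_filter; first by exists setT; split => //; exact: clopenT.
  move=> A B [? ?] [? ?]; exists (A `&` B) => //; split=> //; exact: clopenI.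
(* By compactness of the complement, some clopen set around [x] already lies in [W]. *)
have inW W : open W -> Q `<=` W -> exists2 D, clopen D /\ D x & D `<=` W.
  move=> oW QW.
  have cW : compact (~` W) by apply: (subclosed_compact _ cT) => //; exact: open_closedC.
  have Hn : forall z, (~` W) z -> \forall z' \near z & D \near powerset_filter_from F, (~` D) z'.
    move=> z nWz; have /existsNP[C /not_implyP[[cC Cx] nCz]] : ~ Q z by move=> /QW.
    exists (~` C, [set D | D `<=` C]) => /=; first split.
    - by apply: open_nbhs_nbhs; split => //; exact: closed_openC cC.2.
    - apply/near_powerset_filter_fromP; first by move=> ? ?; exact: subset_trans.
      by exists C => //; exists C.
    - by case=> i j /= [nCi /subsetC]; apply.
  have := (compact_near_coveringP (~` W)).1 cW _ _ (fun D z => (~` D) z) (powerset_filter_from_filter FF) Hn.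
  case=> D [DF _ [C DC]] /(_ _ DC) WC.
  have [B [cB Bx] BC] := DF _ DC.
  by exists B => // z /BC Cz; apply: contrapT => /WC.
suff cQ : connected Q.
  have : connected_component [set: T] x y by exists Q.
  by rewrite tdT// => /esym/eqP; apply/negP.
move=> B [b0] Bb0 [W1 oW1 BO]; case=> K1 cK1 BK.
rewrite eqEsubset; split.
  by rewrite BO => ? [].
have cB : closed B by rewrite BK; exact: closedI.
have nb : set_nbhs B (~` (Q `\` W1)).
  move=> z Bz; apply: open_nbhs_nbhs; split.
    by apply: closed_openC; rewrite setDE; apply: closedI => //; exact: open_closedC.
  by move: Bz; rewrite BO => -[_ Oz] [].
have [U BU clU] := compact_normal hT cT cB nb.
pose V := ~` closure U.
have oV : open V by apply: closed_openC; exact: closed_closure.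
have UV : U° `&` V = set0.
  by apply/seteqP; split=> // z [/interior_subset/subset_closure].
(* The two disjoint open sets cut [D] into clopen pieces, and the piece containing [x] contains all
   of [Q]. *)
have [|D [cD Dx] DW] := inW (U° `|` V) (openU (open_interior U) oV).
  move=> z Qz; have [Oz|nOz] := pselect (W1 z).
    by left; apply: BU; rewrite BO.
  by right => /clU; apply.
have DU : D `&` U° = D `&` ~` V.
  apply/seteqP; split=> z [Dz h]; split=> //.
    by move=> Vz; have : (U° `&` V) z by []; rewrite UV.
  by have [] := DW z Dz.
have DV : D `&` V = D `&` ~` U°.
  apply/seteqP; split=> z [Dz h]; split=> //.
    by move=> Uz; have : (U° `&` V) z by []; rewrite UV.
  by have [] := DW z Dz.
have [oD clD] := cD.
have c1 : clopen (D `&` U°).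
  split; first by apply: openI => //; exact: open_interior.
  by rewrite DU; apply: closedI => //; exact: open_closedC.
have c2 : clopen (D `&` V).
  split; first exact: openI.
  by rewrite DV; apply: closedI => //; apply: open_closedC; exact: open_interior.
have [Ux|Vx] := DW x Dx.
  move=> z Qz; have [_ Uz] := Qz _ (conj c1 (conj Dx Ux)).
  apply: contrapT => nBz; have : V z.
    by move=> /clU; apply; split => // Oz; apply: nBz; rewrite BO.
  by move=> Vz; have : (U° `&` V) z by []; rewrite UV.
have Qb0 : Q b0 by move: Bb0; rewrite BO => -[].
have [_ Vb0] := Qb0 _ (conj c2 (conj Dx Vx)).
have : (U° `&` V) b0 by split => //; exact: BU.
by rewrite UV.
Qed.

End zero_dimensional.

Section cantor_groups.
Context {G : topologicalZmodType}.

Definition open_subgroup (H : set G) :=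
  [/\ open H, H 0 & forall x y, H x -> H y -> H (x - y)].

Lemma open_subgroupN (H : set G) x : open_subgroup H -> H x -> H (- x).
Proof. by case=> _ H0 HB Hx; rewrite -sub0r; exact: HB. Qed.

Lemma open_subgroupD (H : set G) x y : open_subgroup H -> H x -> H y -> H (x + y).
Proof.
by move=> sH Hx Hy; rewrite -[y]opprK; have [_ _] := sH; apply => //; exact: open_subgroupN.
Qed.

Lemma open_subgroupMz (H : set G) x (n : int) : open_subgroup H -> H x -> H (x *~ n).
Proof.
move=> sH Hx; have [_ H0 _] := sH.
have Hn (m : nat) : H (x *+ m).
  elim: m => [|m IH]; first by rewrite mulr0n.
  by rewrite mulrS; exact: open_subgroupD.
by case: n => m; [exact: Hn|rewrite NegzE mulrNz; apply: open_subgroupN => //; exact: Hn].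
Qed.

Lemma open_coset (H : set G) w : open_subgroup H -> open [set x | H (x - w)].
Proof.
move=> [oH H0 HB]; have : open ((fun x => x - w) @^-1` H); last exact.
apply: open_comp => // x _.
have : (fun x : G * G => x.1 + x.2) \o (fun x => (x, - w)) @ x --> x - w.
  apply: (@continuous_comp _ _ _ (fun x => (x, - w)) (fun x : G * G => x.1 + x.2)).
    by apply: cvg_pair => /=; [exact: cvg_id|exact: cvg_cst].
  exact: add_continuous.
exact.
Qed.

Hypothesis cantorG : cantor_group G.

(** The subgroup is the stabilizer under translation of a clopen neighborhood [V] of 0 inside [U].
    It is a neighborhood of 0 because [V] is compact and open, and it lies in [V] because 0 does. *)
Lemma exists_open_subgroup (U : set G) : nbhs 0 U ->
  exists2 H, open_subgroup H & H `<=` U.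
Proof.
have [cG hG tdG _] := cantorG.
have zG := compact_totally_disconnected_zero_dimensional cG hG tdG.
move=> U0; have [V [V0 [oV clV]] VU] := zero_dimensional_cvg hG zG cG U0.
have cV : compact V by exact: (subclosed_compact clV cG).
pose N (s : bool) h := V `<=` [set x | V (if s then x + h else x - h)].
have nN s : nbhs 0 (N s).
  have := (compact_near_coveringP V).1 cV _ (nbhs (0 : G)) (fun h x => V (if s then x + h else x - h)) _.
  apply => x Vx.
  have : (fun p : G * G => if s then p.1 + p.2 else p.1 - p.2) @ (x, 0 : G) --> x.
    case: s.
      by have := @add_continuous G (x, 0); rewrite /continuous_at /= addr0.
    by have := @sub_continuous G (x, 0); rewrite /continuous_at /= subr0.
  by move=> /(_ V (open_nbhs_nbhs (conj oV Vx))).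
pose H := N true `&` N false.
have H0 : nbhs 0 H by exact: filterI.
have HB x y : H x -> H y -> H (x - y).
  move=> [x1 x2] [y1 y2]; split=> v Vv /=.
    by rewrite addrA; apply: y2; exact: x1.
  by rewrite opprB addrA; exact: (x2 _ (y1 _ Vv)).
have HN x : H x -> H (- x) by move=> Hx; rewrite -sub0r; apply: HB => //; exact: nbhs_singleton.
exists H; last first.
  move=> h [h1 _]; apply: VU; rewrite -[h]add0r; exact: h1.
split; [|exact: nbhs_singleton|exact: HB].
rewrite openE => h Hh; rewrite /interior.
have : (fun x : G => x - h) @ h --> h - h.
  apply: (@continuous_comp _ _ _ (fun x => (x, - h)) (fun x : G * G => x.1 + x.2)).
    by apply: cvg_pair => /=; [exact: cvg_id|exact: cvg_cst].
  exact: add_continuous.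
rewrite subrr => /(_ H H0) Hn.
have {}Hn : nbhs h ((fun x => x - h) @^-1` H) by [].
apply: filterS Hn => x /= Hxh.
by rewrite -(subrK h x) -[h in _ + h]opprK; apply: HB => //; exact: HN.
Qed.

Lemma cantor_group_nontrivial (U : set G) : nbhs 0 U -> exists2 x, U x & x != 0.
Proof.
move=> U0; apply: contrapT => /forall2NP H; have [_ _ _ iso] := cantorG.
have : isolated [set: G] 0.
  split; first by rewrite inE.
  exists U => //; rewrite setIT; apply/seteqP; split=> [x Ux|x ->].
    by have [//|/negP] := H x; rewrite negbK => /eqP.
  exact: nbhs_singleton.
by rewrite iso.
Qed.

Variable a : G.
Hypothesis mina : minimal_translation a.

Lemma minimal_dense (O : set G) : open O -> O !=set0 -> exists n : int, O (a *~ n).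
Proof.
move=> oO O0; have [x [Ox [n _ nx]]] := mina 0 O0 oO.
by exists n; rewrite -[_ *~ _]add0r -translation_iterE nx.
Qed.

(** [p] is the first return time to [H]. Returns exist because 0 is not isolated: the nonzero points
    of [H] form a nonempty open set, which the orbit of 0 meets. *)
Lemma open_subgroup_period (H : set G) : open_subgroup H ->
  exists2 p : nat, (0 < p)%N & forall n : int, H (a *~ n) <-> (p %| n)%Z.
Proof.
move=> sH; have [oH H0 HB] := sH; have [_ hG _ _] := cantorG.
have [x Hx x0] := cantor_group_nontrivial (open_nbhs_nbhs (conj oH H0)).
have [n [Hn n0]] : exists n : int, H (a *~ n) /\ a *~ n != 0.
  have [||n [Hn n0]] := @minimal_dense (H `&` ~` [set 0]).
  - apply: openI => //; apply: closed_openC.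
    exact/accessible_closed_set1/hausdorff_accessible.
  - by exists x; split => //; apply/eqP.
  - by exists n; split => //; apply/eqP.
have ex : exists m : nat, `[< (0 < m)%N /\ H (a *+ m) >].
  exists `|n|%N; apply/asboolP; split.
    by rewrite absz_gt0; apply: contra_neq n0 => ->; rewrite mulr0z.
  case: n Hn n0 => m //; rewrite NegzE mulrNz => /(open_subgroupN sH).
  by rewrite opprK abszN.
case: (ex_minnP ex) => p /asboolP[p0 Hp] pmin; exists p => // m; split; last first.
  by move=> /dvdzP[q ->]; rewrite mulrC mulrzA; exact: open_subgroupMz.
move=> Hm; have pn0 : (p%:Z != 0) by lia.
have Hr : H (a *~ (m %% p)%Z).
  have -> : (m %% p)%Z = m - p%:Z * (m %/ p)%Z by rewrite {2}(divz_eq m p); ring.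
  by rewrite mulrzBr; apply: HB => //; rewrite mulrzA; exact: open_subgroupMz.
apply/dvdz_mod0P; have := modz_ge0 m pn0; have := ltz_mod m pn0.
move: Hr; case: (m %% p)%Z => // r Hr rp _; congr Posz; apply/eqP; rewrite eqn0Ngt.
apply/negP => r0; have /pmin : `[< (0 < r)%N /\ H (a *+ r) >] by apply/asboolP.
by rewrite leqNgt; move: rp; rewrite ger0_norm// ltz_nat => ->.
Qed.

(** A finite orbit would be closed and dense, hence the whole group, which would then be
    discrete. *)
Lemma minimal_order (n : nat) : (0 < n)%N -> a *+ n != 0.
Proof.
move=> n0; apply/eqP => an; have [_ hG _ _] := cantorG.
have aG : accessible_space G by exact: hausdorff_accessible.
pose S : set G := [set a *+ k | k in `I_n].
have fS : finite_set S by apply: finite_image; exact: finite_II.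
have orb (m : int) : S (a *~ m).
  exists (absz (m %% n)%Z).
    by rewrite /= -ltz_nat abszE ger0_norm ?modz_ge0 ?ltz_pmod; lia.
  rewrite -[_ *+ _]/(a *~ (absz _)%:Z) abszE ger0_norm; last by rewrite modz_ge0; lia.
  have e : m = n%:Z * (m %/ n)%Z + (m %% n)%Z by rewrite mulrC -divz_eq.
  have -> : a *~ m = a *~ n%:Z *~ (m %/ n)%Z + a *~ (m %% n)%Z.
    by rewrite -mulrzA -mulrzDr -e.
  by rewrite -[a *~ n%:Z]/(a *+ n) an mul0rz add0r.
have ST : S = setT.
  apply/seteqP; split=> // x _; apply: contrapT => nSx.
  have [||k] := @minimal_dense (~` S); last by move=> nS; exact: nS (orb k).
    by apply: closed_openC; exact: (accessible_finite_set_closed.1 aG).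
  by exists x.
have o0 : nbhs (0 : G) [set 0].
  apply: open_nbhs_nbhs; split => //.
  rewrite -[X in open X]setCK; apply: closed_openC; apply: (accessible_finite_set_closed.1 aG).
  by apply: sub_finite_set fS; rewrite ST.
by have [x -> /eqP] := cantor_group_nontrivial o0.
Qed.

(** The excluded multiples of [a] are finitely many and nonzero, so a neighborhood of 0 avoids them.
    The effect is to push the return time beyond [K]. *)
Lemma exists_open_subgroup_period (H : set G) (K : nat) : open_subgroup H ->
  exists H', [/\ open_subgroup H', H' `<=` H &
    forall n : nat, (0 < n <= K)%N -> ~ H' (a *+ n)].
Proof.
move=> sH; have [oH H0 _] := sH; have [_ hG _ _] := cantorG.
have aG : accessible_space G by exact: hausdorff_accessible.
pose S : set G := [set a *+ k | k in [set k | (0 < k <= K)%N]].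
have fS : finite_set S.
  apply: finite_image; apply: (@sub_finite_set _ _ `I_K.+1); last exact: finite_II.
  by move=> k /= /andP[_]; rewrite ltnS.
have : nbhs 0 (H `&` ~` S).
  apply: open_nbhs_nbhs; split; last first.
    by split=> // -[k /andP[k0 _] ak]; have := minimal_order k0; rewrite ak eqxx.
  by apply: openI => //; apply: closed_openC; exact: (accessible_finite_set_closed.1 aG).
move=> /exists_open_subgroup[H' sH' H'U]; exists H'; split=> // [x /H'U[]//|n nK /H'U[_]].
by apply; exists n.
Qed.

Lemma minimal_coset (H : set G) w : open_subgroup H -> exists n : int, H (w - a *~ n).
Proof.
move=> sH; have [||n Hn] := @minimal_dense [set x | H (x - w)].
- exact: open_coset.
- by exists w; rewrite /= subrr; have [] := sH.
- by exists n; rewrite -opprB; apply: open_subgroupN.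
Qed.

(** Uniform continuity in terms of open subgroups. It yields both the almost periods of the
    coefficients and the approximation by functions constant on cosets. *)
Lemma uniformly_continuous_translation (R : realType) (f : G -> R[i]) (e : R) : 0 < e ->
  continuous f -> exists2 H, open_subgroup H &
    forall w h, H h -> normc (f (w + h) - f w) < e.
Proof.
move=> e0 cf; have [cG _ _ _] := cantorG.
suff : \forall h \near (0 : G), [set: G] `<=` (fun x => normc (f (x + h) - f x) < e).
  by move=> /exists_open_subgroup[H sH HV]; exists H => // w h /HV; apply.
apply: ((compact_near_coveringP _).1 cG) => x _.
have e20 : 0 < e / 2 by rewrite divr_gt0.
have nb : nbhs (f x) [set z | normc (f x - z) < e / 2].
  by apply/nbhs_complexP; exists (e / 2).
have n1 : nbhs x [set y | normc (f x - f y) < e / 2] by exact: (cf x _ nb).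
have n2 : nbhs (x, 0 : G) [set p | normc (f x - f (p.1 + p.2)) < e / 2].
  by have := @add_continuous G (x, 0); rewrite /continuous_at /= addr0 => /(_ _ n1).
have [[A B] /= [Ax B0] AB] := n2.
exists (A `&` [set y | normc (f x - f y) < e / 2], B) => /=; first by split => //; exact: filterI.
move=> [y h] /= [[Ay fy] Bh]; have /= fyh := AB (y, h) (conj Ay Bh).
have := normcD (f (y + h) - f x) (f x - f y); rewrite addrA subrK.
by rewrite [normc (f (y + h) - f x)]normcBC; lra.
Qed.

End cantor_groups.

(** * Opening gaps of periodic operators *)

Section circle_parametrization.
Context {R : realType}.

(* [(1 + i x) / (1 - i x)], whose squares cover the whole circle. *)
Definition cayley (x : R) : R[i] :=
  Complex ((1 - x ^+ 2) / (1 + x ^+ 2)) (2 * x / (1 + x ^+ 2)).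

Let den0 (x : R) : 1 + x ^+ 2 != 0.
Proof. by rewrite gt_eqF// ltr_pwDl// sqr_ge0. Qed.

Lemma cayley_circle x : normc (cayley x) = 1.
Proof.
rewrite /cayley /=; have -> : ((1 - x ^+ 2) / (1 + x ^+ 2)) ^+ 2 + (2 * x / (1 + x ^+ 2)) ^+ 2 = 1.
  by field; exact: den0.
exact: sqrtr1.
Qed.

Lemma cayley_inj : injective cayley.
Proof.
move=> x y [H1 H2].
have g z : 2 / (1 + z ^+ 2) = 1 + (1 - z ^+ 2) / (1 + z ^+ 2) :> R.
  by field; exact: den0.
have e : 2 / (1 + x ^+ 2) = 2 / (1 + y ^+ 2) by rewrite !g H1.
have f z : z * (2 / (1 + z ^+ 2)) = 2 * z / (1 + z ^+ 2) :> R by ring.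
have := H2; rewrite -!f e => /mulIf; apply.
by rewrite mulf_neq0// invr_neq0.
Qed.

Lemma cayley_sqr_surj (z : R[i]) : normc z = 1 -> exists x, cayley x ^+ 2 = z.
Proof.
(* [cayley] misses only [-1], and every [z] on the circle has a square root other than [-1]. *)
move=> z1; have [w w2 wN] : exists2 w : R[i], w ^+ 2 = z & 1 + complex.Re w != 0.
  have w2 := sqr_sqrtc z; have [h|h] := eqVneq (1 + complex.Re (sqrtc z)) 0.
    exists (- sqrtc z); first by rewrite sqrrN.
    by move: h; case: (sqrtc z) => u v /= h; apply/eqP; lra.
  by exists (sqrtc z).
have w1 : normc w = 1.
  have := congr1 (@Normc.normc R) w2; rewrite normcX z1.
  by move/eqP; rewrite pexpr_eq1 ?normc_ge0// => /eqP.
have := sqr_normcE w; rewrite w1 expr1n; case: w w2 wN {w1} => c s <- /= c0 cs.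
have sE : s ^+ 2 = (1 - c) * (1 + c) by rewrite -[1 - c]addr0; lra.
exists (s / (1 + c)); congr (_ ^+ 2); rewrite /cayley.
have d : 1 + (s / (1 + c)) ^+ 2 = 2 / (1 + c).
  by rewrite expr_div_n sE; field.
rewrite d; congr Complex.
  by rewrite expr_div_n sE; field.
by field.
Qed.

(** Stated on real and imaginary parts because the intermediate value theorem will be applied to a
    real part. *)
Definition ccontinuous (F : R -> R[i]) :=
  continuous (fun x => complex.Re (F x)) /\ continuous (fun x => complex.Im (F x)).

Lemma ccontinuous_cst c : ccontinuous (fun=> c).
Proof. by split => x; exact: cvg_cst. Qed.

Lemma ccontinuousD F G : ccontinuous F -> ccontinuous G ->
  ccontinuous (fun x => F x + G x).
Proof.
move=> [F1 F2] [G1 G2]; split=> x.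
  rewrite (_ : (fun x => _) = (fun x => complex.Re (F x)) + (fun x => complex.Re (G x))).
    by apply: cvgD; [exact: F1|exact: G1].
  by apply/funext => y; rewrite fctE; case: (F y) (G y) => ? ? [].
rewrite (_ : (fun x => _) = (fun x => complex.Im (F x)) + (fun x => complex.Im (G x))).
  by apply: cvgD; [exact: F2|exact: G2].
by apply/funext => y; rewrite fctE; case: (F y) (G y) => ? ? [].
Qed.

Lemma ccontinuousM F G : ccontinuous F -> ccontinuous G ->
  ccontinuous (fun x => F x * G x).
Proof.
move=> [F1 F2] [G1 G2]; split=> x.
  rewrite (_ : (fun x => _) = (fun x => complex.Re (F x)) * (fun x => complex.Re (G x)) -
      (fun x => complex.Im (F x)) * (fun x => complex.Im (G x))).
    by apply: cvgB; apply: cvgM; [exact: F1|exact: G1|exact: F2|exact: G2].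
  by apply/funext => y; rewrite !fctE; case: (F y) (G y) => ? ? [].
rewrite (_ : (fun x => _) = (fun x => complex.Re (F x)) * (fun x => complex.Im (G x)) +
    (fun x => complex.Im (F x)) * (fun x => complex.Re (G x))).
  by apply: cvgD; apply: cvgM; [exact: F1|exact: G2|exact: F2|exact: G1].
by apply/funext => y; rewrite !fctE; case: (F y) (G y) => ? ? [] ? ? /=; ring.
Qed.

Lemma ccontinuous_conj F : ccontinuous F -> ccontinuous (fun x => (F x)^*).
Proof.
move=> [F1 F2]; split=> x.
  rewrite (_ : (fun x => _) = (fun x => complex.Re (F x))); first exact: F1.
  by apply/funext => y; case: (F y).
rewrite (_ : (fun x => _) = - (fun x => complex.Im (F x))); first by apply: cvgN; exact: F2.
by apply/funext => y; rewrite fctE; case: (F y).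
Qed.

Lemma ccontinuous_near F x (e : R) : ccontinuous F -> 0 < e ->
  \forall y \near x, normc (F x - F y) < e.
Proof.
move=> [F1 F2] e0; have e2 : 0 < e / 2 by rewrite divr_gt0.
have /cvgrPdist_lt /(_ _ e2) := F1 x; have /cvgrPdist_lt /(_ _ e2) := F2 x.
apply: filterS2 => y; case: (F x) (F y) => p q [p' q'] /= h2 h1.
by apply: le_lt_trans (normc_le_ReIm (Complex (p - p') (q - q'))) _ => /=; lra.
Qed.

Lemma cayley_ccontinuous : ccontinuous cayley.
Proof.
have sqc : continuous (fun x : R => x ^+ 2) by move=> y; exact: exprn_continuous.
have dc : continuous (fun x : R => (1 + x ^+ 2)^-1).
  move=> y; apply: cvgV; first exact: den0.
  by apply: cvgD; [exact: cvg_cst|exact: sqc].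
split=> x.
  apply: cvgM; last exact: dc.
  by apply: cvgB; [exact: cvg_cst|exact: sqc].
apply: cvgM; last exact: dc.
by apply: cvgM; [exact: cvg_cst|exact: cvg_id].
Qed.

End circle_parametrization.

Section su11.
Context {R : realType}.
Implicit Types (M N : 'M[R[i]]_2) (w z : R[i]) (a : int -> R[i]).

(** The shape of a matrix of SU(1,1), the determinant being treated apart; this shape makes the
    trace real. *)
Definition su11 M := M 1 1 = (M 0 0)^* /\ M 1 0 = (M 0 1)^*.

Lemma su11_mul M N : su11 M -> su11 N -> su11 (M *m N).
Proof.
move=> [M1 M2] [N1 N2]; split; rewrite !mulmx2E M1 M2 N1 N2 !(rmorphD, rmorphM) /= !conjCK.
  by rewrite addrC.
by rewrite addrC.
Qed.

Lemma su11_1 : su11 1%:M.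
Proof. by split; rewrite !mxE /= ?rmorph1 ?rmorph0. Qed.

Lemma szego_su11 w z : su11 (szego w z).
Proof.
have rJ : ((crho z)^-1)^* = (crho z)^-1 by rewrite fmorphV /= conj_crho.
split; rewrite !mxE rmorphM /= rJ; first by rewrite /= conjCK.
by rewrite /= rmorphN.
Qed.

Lemma transfer_su11 w a m k : su11 (transfer w a m k).
Proof.
elim: k => [|k IH]; first exact: su11_1.
by apply: su11_mul => //; exact: szego_su11.
Qed.

Lemma su11_trace M : su11 M -> \tr M = (2 * complex.Re (M 0 0))%:C%C.
Proof.
move=> [M1 _]; rewrite trace2 M1; case: (M 0 0) => x y /=.
by rewrite /GRing.add /= /real_complex_def subrr; congr Complex; lra.
Qed.

Lemma transferD w a m k l :
  transfer w a m (k + l) = transfer w a (m + k%:Z) l *m transfer w a m k.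
Proof.
elim: l => [|l IH]; first by rewrite addn0 mul1mx.
rewrite addnS [LHS]/= IH mulmxA [transfer _ _ _ l.+1]/=.
by have -> : m + (k + l)%N%:Z = m + k%:Z + l%:Z by lia.
Qed.

Lemma transfer_shift_periodic w a (p : nat) m k (j : nat) : (forall n, a (n + p%:Z) = a n) ->
  transfer w a (m + (j * p)%N%:Z) k = transfer w a m k.
Proof.
move=> aP; elim: j => [|j IH]; first by rewrite mul0n addr0.
rewrite -IH -[LHS](transfer_periodic w (m + (j.+1 * p)%N%:Z) k aP).
by have -> : m + (j.+1 * p)%N%:Z - p%:Z = m + (j * p)%N%:Z by rewrite mulSn; lia.
Qed.

Lemma transfer_pow w a (p k : nat) m : (forall n, a (n + p%:Z) = a n) ->
  transfer w a m (k * p) = transfer w a m p ^+ k.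
Proof.
move=> aP; elim: k => [|k IH]; first by rewrite mul0n expr0.
by rewrite mulSnr transferD transfer_shift_periodic// IH exprS.
Qed.

Lemma transfer_entry_continuous a m k i j :
  ccontinuous (fun x : R => transfer (cayley x) a m k i j).
Proof.
elim: k i j => [|k IH] i j; first exact: ccontinuous_cst.
have szc i' j' : ccontinuous (fun x : R => szego (cayley x) (a (m + k%:Z)) i' j').
  pose r := (crho (a (m + k%:Z)))^-1.
  have cc := @cayley_ccontinuous R.
  move: i' j'; apply: ord2P; apply: ord2P.
  - rewrite (_ : (fun x => _) = fun x => r * (cayley x)^*); last by apply/funext => x; rewrite mxE mx2E.
    by apply: ccontinuousM; [exact: ccontinuous_cst|exact: ccontinuous_conj].
  - rewrite (_ : (fun x => _) = fun x => r * - a (m + k%:Z)); last by apply/funext => x; rewrite mxE mx2E.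
    exact: ccontinuous_cst.
  - rewrite (_ : (fun x => _) = fun x => r * - (a (m + k%:Z))^*); last by apply/funext => x; rewrite mxE mx2E.
    exact: ccontinuous_cst.
  - rewrite (_ : (fun x => _) = fun x => r * cayley x); last by apply/funext => x; rewrite mxE mx2E.
    by apply: ccontinuousM; [exact: ccontinuous_cst|].
rewrite (_ : (fun x => _) = fun x => szego (cayley x) (a (m + k%:Z)) i 0 * transfer (cayley x) a m k 0 j +
   szego (cayley x) (a (m + k%:Z)) i 1 * transfer (cayley x) a m k 1 j); last first.
  by apply/funext => x; rewrite [LHS]mulmx2E.
by apply: ccontinuousD; apply: ccontinuousM.
Qed.

End su11.

Section trace_polynomial.
Context {R : realType}.
Implicit Types (w z : R[i]) (a : int -> R[i]).

(** On the circle [w^*] is the inverse of [w], so [w] times a Szego matrix is polynomial in [w], and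
    only its lower right entry has degree 2. Hence for positive [n] only [D] reaches degree
    [2 * n]. *)
Lemma transfer_polynomials a n : (forall k, normc (a k) < 1) ->
  exists A B C D : {poly R[i]},
  [/\ (size A <= maxn 1 (2 * n).-1)%N, (size B <= 2 * n)%N, (size C <= 2 * n)%N,
      size D = (2 * n).+1 &
   forall w, normc w = 1 ->
     [/\ w ^+ n * transfer w a 0 n 0 0 = A.[w], w ^+ n * transfer w a 0 n 1 0 = B.[w],
         w ^+ n * transfer w a 0 n 0 1 = C.[w] & w ^+ n * transfer w a 0 n 1 1 = D.[w]]].
Proof.
move=> a1; elim: n => [|n [A [B [C [D [sA sB sC sD H]]]]]].
  exists 1, 0, 0, 1; split; [by rewrite size_poly1|by rewrite size_poly0|
    by rewrite size_poly0|by rewrite size_poly1|move=> w w1].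
  by rewrite expr0 !mul1r !mxE hornerC horner0.
set z := a (0 + n%:Z); set r := (crho z)^-1.
have r0 : r != 0 by rewrite invr_neq0// crho_neq0// a1.
have sX (p : {poly R[i]}) m : (size p <= m)%N -> (size ('X * p)%R <= m.+1)%N.
  by move=> pm; apply: leq_trans (size_polyMleq _ _) _; rewrite size_polyX.
exists (r *: (A - z *: ('X * B))), (r *: ('X * ('X * B) - z^* *: ('X * A))),
  (r *: (C - z *: ('X * D))), (r *: ('X * ('X * D) - z^* *: ('X * C))).
have sXC : (size ('X * C)%R <= (2 * n).+1)%N by exact: sX.
have sXB : (size ('X * B)%R <= (2 * n).+1)%N by exact: sX.
have sXD : (size ('X * D)%R <= (2 * n).+2)%N by apply: sX; rewrite sD.
have sXA : (size ('X * A)%R <= (2 * n).+2)%N.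
  by apply: sX; apply: leq_trans sA _; rewrite geq_max; lia.
have sXXB : (size ('X * ('X * B))%R <= (2 * n).+2)%N by exact: sX.
have sXXD : size ('X * ('X * D))%R = (2 * n).+3.
  have D0 : D != 0 by rewrite -size_poly_eq0 sD.
  by rewrite !size_mul ?mulf_neq0 ?polyX_eq0// size_polyX sD; lia.
split.
- apply: leq_trans (size_scale_leq _ _) _; apply: leq_trans (size_polyD _ _) _.
  rewrite size_polyN geq_max; apply/andP; split.
    by apply: leq_trans sA _; rewrite geq_max leq_max /=; lia.
  by apply: leq_trans (size_scale_leq _ _) _; apply: leq_trans sXB _; rewrite leq_max; lia.
- apply: leq_trans (size_scale_leq _ _) _; apply: leq_trans (size_polyD _ _) _.
  rewrite size_polyN geq_max; apply/andP; split; first by apply: leq_trans sXXB _; lia.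
  by apply: leq_trans (size_scale_leq _ _) _; apply: leq_trans sXA _; lia.
- apply: leq_trans (size_scale_leq _ _) _; apply: leq_trans (size_polyD _ _) _.
  rewrite size_polyN geq_max; apply/andP; split; first by apply: leq_trans sC _; lia.
  by apply: leq_trans (size_scale_leq _ _) _; apply: leq_trans sXD _; lia.
- rewrite size_scale// size_polyDl ?sXXD; first by lia.
  rewrite size_polyN; apply: leq_ltn_trans (size_scale_leq _ _) _.
  by apply: leq_ltn_trans sXC _; lia.
- move=> w w1; have [h1 h2 h3 h4] := H w w1; have wJ := circle_mulJ w1.
  rewrite [transfer w a 0 n.+1]/= !mulmx2E ![szego _ _ _ _]mxE !mx2E -/z -/r.
  rewrite !(hornerZ, hornerD, hornerN, hornerM, hornerX) -h1 -h2 -h3 -h4 exprS.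
  move: (w ^+ n) (transfer w a 0 n 0 0) (transfer w a 0 n 1 0) (transfer w a 0 n 0 1)
    (transfer w a 0 n 1 1) => y t00 t10 t01 t11.
  split.
  + transitivity (r * (w * w^* * (y * t00) - z * w * (y * t10))); first by ring.
    by rewrite wJ; ring.
  + by ring.
  + transitivity (r * (w * w^* * (y * t01) - z * w * (y * t11))); first by ring.
    by rewrite wJ; ring.
  + by ring.
Qed.

(** If the trace were [c] on the interval, [A + D - c *: 'X^p], of degree exactly [2 * p], would
    vanish at [2 * p + 1] points. *)
Lemma trace_not_constant a (p : nat) (q1 q2 : R) (c : R[i]) : (0 < p)%N ->
  (forall k, normc (a k) < 1) -> q1 < q2 ->
  exists2 x, q1 < x < q2 & \tr (transfer (cayley x) a 0 p) != c.
Proof.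
move=> p0 a1 q12; apply: contrapT => /forall2NP H.
have [A [B [C [D [sA _ _ sD HP]]]]] := transfer_polynomials p a1.
pose P := A + D - c *: 'X^p.
have sP : size P = (2 * p).+1.
  rewrite /P -addrA addrC -addrA size_polyDl ?sD//.
  apply: leq_ltn_trans (size_polyD _ _) _; rewrite gtn_max size_polyN.
  apply/andP; split.
    by apply: leq_ltn_trans (size_scale_leq _ _) _; rewrite size_polyXn; lia.
  by apply: leq_ltn_trans sA _; rewrite gtn_max; lia.
pose N := (2 * p).+1.
pose x (k : nat) : R := q1 + (q2 - q1) * (k.+1%:R / N.+1%:R).
have N0 : 0 < N.+1%:R :> R by rewrite ltr0n.
have xin k : (k < N)%N -> q1 < x k < q2.
  move=> kN; have d0 : 0 < q2 - q1 by rewrite subr_gt0.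
  rewrite /x ltrDl mulr_gt0 ?divr_gt0//= -ltrBrDl gtr_pMr//.
  by rewrite ltr_pdivrMr// mul1r ltr_nat ltnS.
have xinj : injective x.
  move=> k l /addrI /mulfI; rewrite subr_eq0 gt_eqF// => /(_ isT).
  by move=> /(mulIf (invr_neq0 (lt0r_neq0 N0)))/eqP; rewrite eqr_nat => /eqP[].
have := @max_poly_roots _ P [seq cayley (x k) | k <- iota 0 N].
rewrite -size_poly_eq0 sP => /(_ isT); rewrite size_map size_iota ltnn.
have -> : all (root P) [seq cayley (x k) | k <- iota 0 N].
  apply/allP => y /mapP[k]; rewrite mem_iota => /andP[_ kN] ->.
  have [//|/negP] := H (x k); first by rewrite xin.
  rewrite negbK => /eqP tc; have [h00 _ _ h11] := HP _ (cayley_circle (x k)).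
  rewrite /root /P !(hornerZ, hornerD, hornerN, hornerXn) -h00 -h11 -mulrDr -trace2 tc mulrC subrr//.
have u : uniq [seq cayley (x k) | k <- iota 0 N].
  by rewrite map_inj_uniq ?iota_uniq// => k l /cayley_inj/xinj.
by move=> /(_ isT u).
Qed.

End trace_polynomial.

Section gap_opening.
Context {R : realType}.
Implicit Types (w z : R[i]) (a : int -> R[i]).

(** By Cayley-Hamilton the powers of [M] obey the Chebyshev recurrence, that is [sin th * M ^ n =
    sin (n th) * M - sin ((n - 1) th)]. At a zero of [sin (k th)] only the scalar term is left. *)
Lemma elliptic_pow (M : 'M[R[i]]_2) (th : R) (k : nat) : \det M = 1 ->
  \tr M = (2 * cos th)%:C%C -> sin th != 0 -> sin (k%:R * th) = 0 -> (0 < k)%N ->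
  M ^+ k = (cos (k%:R * th))%:C%C%:M.
Proof.
move=> dM tM s0 sk k0.
have CH : M *m M = (2 * cos th)%:C%C *: M - 1%:M.
  by rewrite -tM -(cayley_hamilton2 dM) mulmxBl mul_scalar_mx opprB addrC subrK.
have rec n : (sin th)%:C%C *: M ^+ n.+1 =
    (sin (n.+1%:R * th))%:C%C *: M - (sin (n%:R * th))%:C%C *: 1%:M.
  elim: n => [|n IH]; first by rewrite expr1 mul1r mul0r sin0 scale0r subr0.
  rewrite exprS scalerAr IH mulrBr -!scalerAr -[M * M]/(M *m M) CH.
  have -> : (sin (n.+2%:R * th))%:C%C =
      (2 * cos th)%:C%C * (sin (n.+1%:R * th))%:C%C - (sin (n%:R * th))%:C%C :> R[i].
    rewrite -rmorphM -rmorphB; congr (_%:C%C).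
    have -> : n.+2%:R * th = n.+1%:R * th + th by rewrite -[n.+2]addn1 natrD mulrDl mul1r.
    have -> : n%:R * th = n.+1%:R * th - th by rewrite -[n.+1]addn1 natrD mulrDl mul1r addrK.
    by rewrite sinD sinB; ring.
  rewrite -[M * 1%:M]/(M *m 1%:M) mulmx1.
  by apply/matrixP => i j; rewrite !mxE; ring.
have kE : k = k.-1.+1 by rewrite prednK.
have := rec k.-1; rewrite -kE sk scale0r sub0r.
have -> : sin (k.-1%:R * th) = - (cos (k%:R * th) * sin th).
  have -> : k.-1%:R * th = k%:R * th - th by rewrite [in RHS]kE -addn1 natrD mulrDl mul1r addrK.
  by rewrite sinB sk; ring.
move=> H; have sC : (sin th)%:C%C != 0 :> R[i] by apply/eqP => -[] /eqP; exact/negP.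
apply: (scalerI sC); rewrite H -[in RHS]scalemx1 scalerA -scaleNr; congr (_ *: _).
by rewrite rmorphN opprK rmorphM mulrC.
Qed.

Lemma sin_pi_nat (j : nat) : sin (j%:R * pi) = 0 :> R.
Proof.
elim: j => [|j IH]; first by rewrite mul0r sin0.
by rewrite -addn1 natrD mulrDl mul1r sinD IH sinpi mul0r mulr0 addr0.
Qed.

(** The angles [j pi / k] have spacing [pi / k], so one of them falls strictly between the two
    arccosines once [k] is large. It is then strictly between 0 and [pi], where the sine is
    nonzero. *)
Lemma cos_multiple_between (t1 t2 : R) : -2 <= t1 -> t1 < t2 -> t2 <= 2 ->
  exists K : nat, forall k : nat, (K <= k)%N -> (0 < k)%N -> exists th : R,
    [/\ t1 < 2 * cos th < t2, sin th != 0 & sin (k%:R * th) = 0].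
Proof.
move=> t1g t12 t2l.
have b1 : -1 <= t1 / 2 <= 1 by apply/andP; split; lra.
have b2 : -1 <= t2 / 2 <= 1 by apply/andP; split; lra.
pose th1 := acos (t1 / 2); pose th2 := acos (t2 / 2).
have c1 : cos th1 = t1 / 2 by exact: acosK.
have c2 : cos th2 = t2 / 2 by exact: acosK.
have in1 : 0 <= th1 <= pi by rewrite acos_ge0 ?acos_lepi.
have in2 : 0 <= th2 <= pi by rewrite acos_ge0 ?acos_lepi.
have th21 : th2 < th1.
  rewrite ltNge; apply/negP => h.
  have : cos th2 <= cos th1 by rewrite leNgt ltr_cos ?in_itv //= -leNgt.
  by rewrite c1 c2; lra.
have d0 : 0 < (th1 - th2) / pi by rewrite divr_gt0 ?subr_gt0 ?pi_gt0.
exists (Num.truncn ((th1 - th2) / pi)^-1).+1 => k Kk k0.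
have kd : pi < k%:R * (th1 - th2).
  have : ((th1 - th2) / pi)^-1 < k%:R.
    apply: lt_le_trans (_ : (Num.truncn ((th1 - th2) / pi)^-1).+1%:R <= _); last by rewrite ler_nat.
    by rewrite truncnS_gt.
  by rewrite invf_div ltr_pdivrMr ?subr_gt0.
have k0R : 0 < k%:R :> R by rewrite ltr0n.
have pi0 : 0 < pi :> R by exact: pi_gt0.
pose j := (Num.truncn (k%:R * th2 / pi)).+1.
have [th2_0 _] := andP in2; have [_ th1_pi] := andP in1.
have jl : k%:R * th2 < j%:R * pi by rewrite -ltr_pdivrMr// truncnS_gt.
have jr : j%:R * pi < k%:R * th1.
  have : (Num.truncn (k%:R * th2 / pi))%:R <= k%:R * th2 / pi.
    have h0 : 0 <= k%:R * th2 / pi by rewrite divr_ge0 ?(ltW pi0)// mulr_ge0 ?(ltW k0R).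
    by have /andP[] := truncn_itv h0.
  rewrite ler_pdivlMr// /j -addn1 natrD mulrDl mul1r; lra.
pose y : R := j%:R * pi / k%:R; exists y.
have a1 : th2 < y by rewrite ltr_pdivlMr// mulrC.
have a2 : y < th1 by rewrite ltr_pdivrMr// [th1 * _]mulrC.
have th0 : 0 < y by exact: le_lt_trans th2_0 a1.
have thpi : y < pi by exact: lt_le_trans a2 th1_pi.
have inth : 0 <= y <= pi by rewrite (ltW th0) (ltW thpi).
split.
- have -> : t1 = 2 * cos th1 by rewrite c1; lra.
  have -> : t2 = 2 * cos th2 by rewrite c2; lra.
  by rewrite !ltr_pM2l// !ltr_cos ?in_itv //= a1 a2.
- by rewrite gt_eqF// sin_gt0_pi// th0 thpi.
- by rewrite /y mulrCA divff ?mulr1 ?sin_pi_nat// gt_eqF.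
Qed.

Lemma transfer_ext w a b m k : (forall j : nat, (j < k)%N -> a (m + j%:Z) = b (m + j%:Z)) ->
  transfer w a m k = transfer w b m k.
Proof.
elim: k => [//|k IH] H; rewrite [LHS]/= [RHS]/= IH ?H// => j jk.
by apply: H; exact: ltnW.
Qed.

(* By the arithmetic-geometric inequality [rho rho' < 1 - Re (z conj(z'))]. *)
Lemma szego_ratio_trace w z z' : normc w = 1 -> normc z < 1 -> normc z' < 1 -> z != z' ->
  2 < normc (\tr (((\tr (szego w z))%:M - szego w z) *m szego w z')).
Proof.
move=> w1 z1 z1' zz'; have wJ := circle_mulJ w1.
have rE (y : R[i]) : (crho y)^-1 = ((Num.sqrt (1 - normc y ^+ 2))^-1)%:C%C by rewrite fmorphV.
have -> : \tr (((\tr (szego w z))%:M - szego w z) *m szego w z') =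
    (crho z)^-1 * (crho z')^-1 * (2 - (z * z'^* + z^* * z')).
  rewrite !trace2 !mulmx2E !mxE /= !mulr1n !mulr0n.
  transitivity ((crho z)^-1 * (crho z')^-1 * (2 * (w * w^*) - (z * z'^* + z^* * z'))); first by ring.
  by rewrite wJ; ring.
have pos (y : R[i]) : normc y < 1 -> 0 < Num.sqrt (1 - normc y ^+ 2).
  by move=> y1; rewrite sqrtr_gt0 subr_gt0 expr_lt1 ?normc_ge0.
have sq (y : R[i]) : normc y < 1 -> Num.sqrt (1 - normc y ^+ 2) ^+ 2 = 1 - normc y ^+ 2.
  by move=> y1; rewrite sqr_sqrtr// subr_ge0 expr_le1 ?normc_ge0// ltW.
have := pos _ z1; have := pos _ z1'; have := sq _ z1; have := sq _ z1'.
rewrite !rE !sqr_normcE; move: (Num.sqrt _) (Num.sqrt _) => r' r r2' r2 r0' r0.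
have -> : 2 - (z * z'^* + z^* * z') =
    (2 * (1 - (complex.Re z * complex.Re z' + complex.Im z * complex.Im z')))%:C%C.
  by case: z z' {z1 z1' zz' r2 r2'} => x y [u v]; apply/eqP; rewrite eq_complex /=;
    apply/andP; split; apply/eqP; ring.
rewrite -!rmorphM normc_real.
have d : 0 < (complex.Re z - complex.Re z') ^+ 2 + (complex.Im z - complex.Im z') ^+ 2.
  rewrite lt_def addr_ge0 ?sqr_ge0// andbT; apply: contra_neq zz' => h.
  have := sqr_ge0 (complex.Re z - complex.Re z'); have := sqr_ge0 (complex.Im z - complex.Im z') => h1 h2.
  have e1 : (complex.Re z - complex.Re z') ^+ 2 = 0 by lra.
  have e2 : (complex.Im z - complex.Im z') ^+ 2 = 0 by lra.
  move/eqP: e1; move/eqP: e2; rewrite !sqrf_eq0 !subr_eq0.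
  by case: (z) (z') => x y [u v] /= /eqP -> /eqP ->.
move: r2 r2' d; move: (complex.Re z) (complex.Im z) (complex.Re z') (complex.Im z') => x y u v r2 r2' d.
have key : r * r' < 1 - (x * u + y * v) by have := sqr_ge0 (r - r'); lra.
have k0 : 0 < 1 - (x * u + y * v) by apply: lt_trans key; rewrite mulr_gt0.
rewrite ger0_norm; last by rewrite !mulr_ge0 ?invr_ge0 ?ltW.
by rewrite -invfM mulrC ltr_pdivlMr ?mulr_gt0// ltr_pM2l// mulrC.
Qed.

Lemma not_dvdz_between (P j : nat) : (j < P)%N -> ~~ (P.+1%:Z %| 1 + j%:Z)%Z.
Proof. by move=> jP; rewrite -[1 + _]/(j.+1%:Z) dvdzE /= gtnNdvd. Qed.

(** [K] comes before [k] and [b] because in [dense_gap_set] the multiplier is dictated by a subgroup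
    chosen after [K], and the coefficients are changed only then; any change of the coefficient at 0
    opens the gap. *)
Lemma gap_dichotomy a (p : nat) (q1 q2 : R) : (0 < p)%N ->
  (forall n, normc (a n) < 1) -> (forall n, a (n + p%:Z) = a n) -> q1 < q2 ->
  (exists2 x, q1 < x < q2 & 2 < normc (\tr (transfer (cayley x) a 0 p))) \/
  exists K : nat, forall k : nat, (K <= k)%N -> (0 < k)%N -> forall b : int -> R[i],
    (forall n, normc (b n) < 1) ->
    (forall n, ~~ ((k * p)%N%:Z %| n)%Z -> b n = a n) -> b 0 != a 0 ->
    exists2 x, q1 < x < q2 & 2 < normc (\tr (transfer (cayley x) b 0 (k * p))).
Proof.
move=> p0 a1 aP q12.
pose T x := 2 * complex.Re (transfer (cayley x) a 0 p 0 0).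
have trE x : \tr (transfer (cayley x) a 0 p) = (T x)%:C%C.
  by rewrite su11_trace//; exact: transfer_su11.
have cT : continuous T.
  have [c1 _] := @transfer_entry_continuous R a 0 p 0 0.
  by move=> x; apply: cvgM; [exact: cvg_cst|exact: (c1 x)].
have [[x xq Tx]|noT] := pselect (exists2 x, q1 < x < q2 & 2 < `|T x|).
  by left; exists x => //; rewrite trE normc_real.
right; pose x1 := (q1 + q2) / 2.
have x1q : q1 < x1 < q2 by rewrite /x1; apply/andP; split; lra.
have [x2 x2q] := trace_not_constant (\tr (transfer (cayley x1) a 0 p)) p0 a1 q12.
rewrite !trE => T12; have {}T12 : T x1 != T x2 by apply: contra_neq T12 => ->.
have bT x : q1 < x < q2 -> -2 <= T x <= 2.
  by move=> xq; rewrite -ler_norml leNgt; apply/negP => h; apply: noT; exists x.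
pose lo := Num.min (T x1) (T x2); pose hi := Num.max (T x1) (T x2).
have lohi : lo < hi by rewrite gt_min !lt_max !ltxx orbF /= -neq_lt.
have lo2 : -2 <= lo by rewrite le_min; have /andP[-> _] := bT _ x1q; have /andP[-> _] := bT _ x2q.
have hi2 : hi <= 2 by rewrite ge_max; have /andP[_ ->] := bT _ x1q; have /andP[_ ->] := bT _ x2q.
have [K HK] := cos_multiple_between lo2 lohi hi2.
exists K => k Kk k0 b b1 ba b0; have [th [/andP[th1 th2] s0 sk]] := HK k Kk k0.
have [x xq Tx] : exists2 x, q1 < x < q2 & T x = 2 * cos th.
  have ivt y1 y2 : y1 <= y2 -> q1 < y1 -> y2 < q2 ->
      Num.min (T y1) (T y2) <= 2 * cos th <= Num.max (T y1) (T y2) ->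
      exists2 x, q1 < x < q2 & T x = 2 * cos th.
    move=> y12 h1 h2 h; have [|x] := @IVT _ T y1 y2 (2 * cos th) y12 _ h.
      exact: continuous_subspaceT.
    rewrite in_itv /= => /andP[l r] e; exists x => //.
    by rewrite (lt_le_trans h1 l) (le_lt_trans r h2).
  have /andP[l1 r1] := x1q; have /andP[l2 r2] := x2q.
  have [x12|x21] := leP x1 x2; first by apply: (ivt x1 x2) => //; rewrite !ltW.
  by apply: (ivt x2 x1) => //; rewrite ?(ltW x21)// minC maxC !ltW.
exists x => //; set w := cayley x; have w1 : normc w = 1 by exact: cayley_circle.
have Mk := elliptic_pow (det_transfer 0 p w1 a1) (_ : _ = (2 * cos th)%:C%C) s0 sk k0.
rewrite trE Tx in Mk; have {}Mk := Mk erefl.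
have P0 : (0 < k * p)%N by rewrite muln_gt0 k0.
pose P' := (k * p).-1; have PE : (k * p)%N = P'.+1 by rewrite prednK.
rewrite -transfer_pow// PE transferSr add0r in Mk.
rewrite PE transferSr add0r.
have -> : transfer w b 1 P' = transfer w a 1 P'.
  by apply: transfer_ext => j jP; apply: ba; rewrite PE not_dvdz_between.
set S := szego w (a 0) in Mk *; set S' := szego w (b 0).
have CH : ((\tr S)%:M - S) *m S = 1%:M by apply: cayley_hamilton2; exact: det_szego.
(* A full period of [a] is plus or minus the identity, so all of it but the first step is plus or
   minus the inverse of [S], written as [\tr S - S]. *)
have -> : transfer w a 1 P' = (cos (k%:R * th))%:C%C *: ((\tr S)%:M - S).
  by rewrite -[LHS]mulmx1 -(mulmx1C CH) mulmxA Mk mul_scalar_mx.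
rewrite -scalemxAl mxtraceZ Normc.normcM.
have -> : normc (cos (k%:R * th))%:C%C = 1.
  rewrite normc_real; have := cos2Dsin2 (k%:R * th); rewrite sk expr0n addr0.
  by move=> /eqP; rewrite -real_normK ?num_real// pexpr_eq1// => /eqP.
by rewrite mul1r; apply: szego_ratio_trace => //; rewrite eq_sym.
Qed.

End gap_opening.

(** * Generic sampling functions *)

Section sampling_functions.
Context {R : realType} {G : topologicalZmodType}.
Implicit Types (f g : continuousType G (disk R)).

Definition sampling_value f (w : G) : R[i] := set_val (f w).

Lemma sampling_value_lt1 f w : normc (sampling_value f w) < 1.
Proof. by apply/diskP; exact: set_valP. Qed.

Lemma sampling_value_continuous f : continuous (sampling_value f).
Proof.
move=> w; apply: (@continuous_comp _ _ _ f (set_val : disk R -> R[i])).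
  exact: cts_fun.
exact: initial_continuous.
Qed.

Lemma sampling_exists (h : G -> R[i]) : continuous h -> (forall w, normc (h w) < 1) ->
  exists g, forall w, sampling_value g w = h w.
Proof.
move=> ch h1; pose g w : disk R := SigSub (mem_set ((diskP (h w)).2 (h1 w))).
have cg : continuous g by apply: continuous_comp_initial; exact: ch.
by exists (mkcts cg).
Qed.

Lemma open_samplingP (O1 : set (continuousType G (disk R))) :
  (forall f, O1 f -> exists2 e : R, 0 < e & forall g,
     (forall w, normc (sampling_value f w - sampling_value g w) < e) -> O1 g) -> open O1.
Proof. by move=> H; rewrite openE => f /H Hf; apply/nbhs_samplingE. Qed.

Lemma open_sampling (O1 : set (continuousType G (disk R))) f : open O1 -> O1 f ->
  exists2 e : R, 0 < e & forall g,
     (forall w, normc (sampling_value f w - sampling_value g w) < e) -> O1 g.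
Proof. by move=> oO Of; apply/nbhs_samplingE; apply: open_nbhs_nbhs. Qed.

Lemma sampling_value_bound f : compact [set: G] ->
  exists2 d : R, 0 < d & forall w, normc (sampling_value f w) < 1 - d.
Proof.
move=> cG.
suff H : \forall d \near at_right (0 : R), [set: G] `<=` (fun w => normc (sampling_value f w) < 1 - d).
  have [d [d0 Hd]] := @filter_ex _ (at_right (0 : R)) _ _ (filterI (nbhs_right_gt 0) H).
  by exists d => // w; exact: Hd.
apply: ((compact_near_coveringP _).1 cG) => w _.
pose e := (1 - normc (sampling_value f w)) / 2.
have e0 : 0 < e by rewrite divr_gt0// subr_gt0 sampling_value_lt1.
exists ([set v | normc (sampling_value f w - sampling_value f v) < e], [set d | d < e]) => /=.
  split; last exact: nbhs_right_lt.
  have nb : nbhs (sampling_value f w) [set z | normc (sampling_value f w - z) < e].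
    by apply/nbhs_complexP; exists e.
  exact: (sampling_value_continuous nb).
move=> [v d] /= [h1 h2].
have := normcD (sampling_value f v - sampling_value f w) (sampling_value f w).
by rewrite subrK [normc (sampling_value f v - _)]normcBC; rewrite /e in h1 h2; lra.
Qed.

(** A uniform limit of functions into the open disk may touch the unit circle; the third hypothesis
    rules this out. *)
Lemma sampling_limit (fs : nat -> continuousType G (disk R)) (e : nat -> R) :
  (forall n m w, (n <= m)%N ->
     normc (sampling_value (fs m) w - sampling_value (fs n) w) <= e n) ->
  (forall d, 0 < d -> exists n, e n < d) ->
  (forall w, normc (sampling_value (fs 0%N) w) + 2 * e 0%N < 1) ->
  exists g, forall n w, normc (sampling_value g w - sampling_value (fs n) w) <= 2 * e n.
Proof.
move=> H e0 H1.
have /boolp.choice[l Hl] : forall w, exists l : R[i], forall n,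
    normc (l - sampling_value (fs n) w) <= 2 * e n.
  by move=> w; apply: complex_cauchy_approx => n m nm; exact: H.
have cl : continuous l.
  move=> w P /nbhs_complexP[d d0 dP].
  have d8 : 0 < d / 8 by rewrite divr_gt0.
  have [n en] := e0 _ d8.
  have nb : nbhs (sampling_value (fs n) w) [set z | normc (sampling_value (fs n) w - z) < d / 4].
    by apply/nbhs_complexP; exists (d / 4) => //; rewrite divr_gt0.
  have nw : nbhs w ((sampling_value (fs n)) @^-1` [set z | normc (sampling_value (fs n) w - z) < d / 4]).
    exact: (sampling_value_continuous nb).
  have : nbhs w (l @^-1` P); last by [].
  apply: filterS nw => v /= Hv; apply: dP.
  have -> : l w - l v = (l w - sampling_value (fs n) w) +
      (sampling_value (fs n) w - sampling_value (fs n) v) + (sampling_value (fs n) v - l v) by ring.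
  apply: le_lt_trans (normcD _ _) _; have := normcD (l w - sampling_value (fs n) w)
    (sampling_value (fs n) w - sampling_value (fs n) v).
  have := Hl v n; rewrite normcBC; have := Hl w n; lra.
have l1 w : normc (l w) < 1.
  have := normcD (l w - sampling_value (fs 0%N) w) (sampling_value (fs 0%N) w).
  by rewrite subrK; have := Hl w 0%N; have := H1 w; lra.
have [g Hg] := sampling_exists cl l1.
by exists g => n w; rewrite Hg.
Qed.

(** Nested balls, with an initial radius that also confines the limit to the disk. *)
Lemma sampling_baire (F : nat -> set (continuousType G (disk R))) : compact [set: G] ->
  (forall n, open (F n)) -> (forall n, dense (F n)) -> dense (\bigcap_n F n).
Proof.
move=> cG oF dF U [f0 Uf0] oU.
have [eU eU0 HU] := open_sampling oU Uf0.
have [d1 d10 Hd1] := sampling_value_bound f0 cG.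
pose St := (continuousType G (disk R) * {e : R | is_true (0 < e)})%type.
have step n (s : St) : exists s' : St,
   [/\ (forall w, normc (sampling_value s.1 w - sampling_value s'.1 w) <= sval s.2 / 2),
       sval s'.2 <= sval s.2 / 2 &
       forall g, (forall w, normc (sampling_value s'.1 w - sampling_value g w) <= 2 * sval s'.2) -> F n g].
  case: s => f [e e0] /=.
  have e20 : 0 < e / 2 by rewrite divr_gt0.
  pose B := [set g | forall w, normc (sampling_value f w - sampling_value g w) < e / 2].
  have nB : nbhs f B by apply/nbhs_samplingE; exists (e / 2).
  have [||f' [Bf' Ff']] := dF n (interior B).
  - by exists f; exact: nB.
  - exact: open_interior.
  have {}Bf' := interior_subset Bf'.
  have [d d0 Hd] := open_sampling (oF n) Ff'.
  (* [e / 2] nests the balls; [d / 4] puts the ball of twice the new radius inside [F n], twice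
     because of the bound in [sampling_limit]. *)
  have m0 : 0 < Num.min (e / 2) (d / 4) by rewrite lt_min e20 divr_gt0.
  exists (f', exist (fun e : R => is_true (0 < e)) _ m0); split=> /= [w||g Hg]; first exact/ltW/Bf'.
    by rewrite ge_min lexx.
  apply: Hd => w; apply: le_lt_trans (Hg w) _.
  have : Num.min (e / 2) (d / 4) <= d / 4 by rewrite ge_min lexx orbT.
  by lra.
have /boolp.choice[nx Hnx] : forall p : nat * St, exists s' : St,
   [/\ (forall w, normc (sampling_value p.2.1 w - sampling_value s'.1 w) <= sval p.2.2 / 2),
       sval s'.2 <= sval p.2.2 / 2 &
       forall g, (forall w, normc (sampling_value s'.1 w - sampling_value g w) <= 2 * sval s'.2) -> F p.1 g].
  by move=> [n s]; exact: step.
(* The limit is within twice this radius of [f0], hence in [U] and of modulus less than 1. *)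
have e00 : 0 < Num.min (eU / 4) (d1 / 4) by rewrite lt_min !divr_gt0.
pose S := fix S n : St :=
  if n is n'.+1 then nx (n', S n') else (f0, exist (fun e : R => is_true (0 < e)) _ e00).
pose fs n := (S n).1; pose e n := sval (S n).2.
have en0 n : 0 < e n by rewrite /e; case: (S n).2.
have SP n : [/\ (forall w, normc (sampling_value (fs n) w - sampling_value (fs n.+1) w) <= e n / 2),
     e n.+1 <= e n / 2 &
     forall g, (forall w, normc (sampling_value (fs n.+1) w - sampling_value g w) <= 2 * e n.+1) -> F n g].
  exact: (Hnx (n, S n)).
have nest n k w : normc (sampling_value (fs (k + n)%N) w - sampling_value (fs n) w) + e (k + n)%N <= e n.
  elim: k => [|k IH]; first by rewrite add0n subrr Normc.normc0 add0r.
  have [h1 h2 _] := SP (k + n)%N; rewrite addSn.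
  have := normcD (sampling_value (fs (k + n).+1) w - sampling_value (fs (k + n)%N) w)
    (sampling_value (fs (k + n)%N) w - sampling_value (fs n) w).
  by rewrite addrA subrK [normc (_ - sampling_value (fs (k + n)%N) w)]normcBC; have := h1 w; lra.
have esmall n : e n <= e 0%N * 2^-1 ^+ n.
  elim: n => [|n IH]; first by rewrite expr0 mulr1.
  by have [_ h2 _] := SP n; rewrite exprS mulrCA; lra.
have [g Hg] : exists g, forall n w, normc (sampling_value g w - sampling_value (fs n) w) <= 2 * e n.
  apply: sampling_limit.
  - by move=> n m w /subnK <-; have := nest n (m - n)%N w; have := en0 (m - n + n)%N; lra.
  - move=> d d0; have h0 : (0 : R) <= 2^-1 by rewrite invr_ge0.
    have h1 : (2^-1 : R) < 1 by rewrite invf_lt1// ltr1n.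
    have [N HN] := expr_lt_eventually (e 0%N) h0 h1 d0.
    by exists N; apply: le_lt_trans (esmall N) (HN N (leqnn _)).
  - move=> w; have := Hd1 w; have : e 0%N <= d1 / 4 by rewrite /e /= ge_min lexx orbT.
    by rewrite /fs /=; lra.
exists g; split.
  apply: HU => w; have := Hg 0%N w; rewrite normcBC /fs /=.
  have : e 0%N <= eU / 4 by rewrite /e /= ge_min lexx.
  by lra.
move=> n _; have [_ _] := SP n; apply => w.
by rewrite normcBC; exact: Hg.
Qed.

End sampling_functions.

(** * Gaps along the orbits of a minimal translation *)

Section generic_gaps.
Context {R : realType} {G : topologicalZmodType} (a : G).
Implicit Types (f g : continuousType G (disk R)).
Hypothesis cantorG : cantor_group G.
Hypothesis mina : minimal_translation a.

Lemma cmv_alpha_verblunsky f w n :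
  cmv_alpha (verblunsky f a w) n = sampling_value f (w + a *~ n).
Proof. by rewrite /cmv_alpha /verblunsky translation_iterE. Qed.

(** The constant is common to all [w], which makes the condition open in [f]. *)
Definition gap_at f z := exists2 c : R, 0 < c & forall w, bounded_below (cmv (verblunsky f a w)) z c.

Lemma gap_at_open f z : gap_at f z -> exists2 d : R, 0 < d & forall g,
  (forall w, normc (sampling_value f w - sampling_value g w) < d) -> gap_at g z.
Proof.
move=> [c c0 bb]; have c20 : 0 < c / 2 by rewrite divr_gt0.
have [d d0 Hd] := cmv_perturb c20.
exists d; first exact: d0.
move=> g fg; exists (c / 2); first exact: c20.
move=> w u.
have pert : ell2_normr (cmv (verblunsky f a w) u - cmv (verblunsky g a w) u) <= c / 2 * ell2_normr u.
  by apply: Hd => n; rewrite !cmv_alpha_verblunsky; apply/ltW/fg.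
have := bb w u.
have -> : cmv (verblunsky f a w) u - z *: u = (cmv (verblunsky g a w) u - z *: u) +
    (cmv (verblunsky f a w) u - cmv (verblunsky g a w) u).
  by apply: ell2_ext => i; rewrite !ell2E; ring.
move=> h; have := le_trans h (ell2_normrD _ _); lra.
Qed.

Lemma locally_constant_continuous (H : set G) (h : G -> R[i]) : open_subgroup H ->
  (forall w x, H x -> h (w + x) = h w) -> continuous h.
Proof.
move=> sH hH w P hP; have := open_coset w sH => oc.
have nw : nbhs w [set x | H (x - w)].
  by apply: open_nbhs_nbhs; split=> //; rewrite /= subrr; have [] := sH.
apply: filterS nw => x /= Hx; rewrite /= -(subrK w x) addrC hH//.
exact: nbhs_singleton.
Qed.

(** Every [w] lies in the coset of some [a *~ n0], so its coefficients are those along the orbit of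
    0 translated by [n0], with the same trace over a period. The constants come from a single
    period, hence are uniform in [w]. *)
Lemma periodic_gap (H : set G) (P : nat) g (z : R[i]) : open_subgroup H -> (0 < P)%N ->
  (forall n : int, H (a *~ n) <-> (P %| n)%Z) ->
  (forall w x, H x -> sampling_value g (w + x) = sampling_value g w) -> normc z = 1 ->
  2 < normc (\tr (transfer z (fun n => sampling_value g (a *~ n)) 0 P)) ->
  gap_at g (z ^+ 2).
Proof.
move=> sH P0 HP gH z1 tr2; pose A n := sampling_value g (a *~ n).
have A1 n : normc (A n) < 1 by exact: sampling_value_lt1.
have AP n : A (n + P%:Z) = A n.
  by rewrite /A mulrzDr; apply: gH; apply/HP; exact: dvdzz.
have Amod n : A n = A (n %% P)%Z.
  rewrite /A {1}(divz_eq n P) addrC mulrzDr; apply: gH; apply/HP.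
  by apply: dvdz_mull; exact: dvdzz.
pose B : R := 1 + \sum_(j < P) normc (crho (A j%:Z))^-1.
have S0 : 0 <= \sum_(j < P) normc (crho (A j%:Z))^-1.
  by apply: sumr_ge0 => j _; exact: normc_ge0.
have B1 : 1 <= B by rewrite lerDl.
have HB n : normc (crho (A n))^-1 <= B.
  rewrite Amod; have Pn0 : P%:Z != 0 by lia.
  have := modz_ge0 n Pn0; have := ltz_pmod n (_ : 0 < P%:Z).
  case: (n %% P)%Z => [j|//]; rewrite ltz_nat => /(_ _) jP _.
  have {}jP : (j < P)%N by apply: jP.
  rewrite /B (bigD1 (Ordinal jP) isT) addrCA lerDl addr_ge0//.
  by apply: sumr_ge0 => i _; exact: normc_ge0.
have [c c0 Hc] := hyperbolic_bounded_below P B1 tr2.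
exists c => // w; have [n0 Hn0] := minimal_coset mina w sH.
have aE n : cmv_alpha (verblunsky g a w) n = A (n + n0).
  rewrite cmv_alpha_verblunsky /A mulrzDr.
  have -> : w + a *~ n = a *~ n + a *~ n0 + (w - a *~ n0).
    by rewrite -addrA [a *~ n0 + _]addrC subrK addrC.
  exact: gH.
apply: Hc => //.
- by move=> n; rewrite aE HB.
- by move=> n; rewrite !aE addrAC AP.
have -> : transfer z (cmv_alpha (verblunsky g a w)) 0 P = transfer z A n0 P.
  elim: (P) => [//|k IH]; rewrite [LHS]/= [RHS]/= IH aE.
  by rewrite add0r [k%:Z + _]addrC.
by rewrite (trace_transfer n0 z1 A1 AP).
Qed.

Definition gap_set (q1 q2 : R) : set (continuousType G (disk R)) :=
  [set f | exists2 x, q1 < x < q2 & gap_at f (cayley x ^+ 2)].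

Lemma open_gap_set q1 q2 : open (gap_set q1 q2).
Proof.
apply: open_samplingP => f [x xq /gap_at_open[d d0 Hd]].
by exists d => // g fg; exists x => //; exact: Hd.
Qed.

Lemma dense_gap_set q1 q2 : q1 < q2 -> dense (gap_set q1 q2).
Proof.
move=> q12 U [f Uf] oU; have [e e0 HU] := open_sampling oU Uf.
have e20 : 0 < e / 2 by rewrite divr_gt0.
have [H sH fH] := uniformly_continuous_translation cantorG e20 (@sampling_value_continuous _ _ f).
have [oH H0 HB] := sH.
have [p p0 Hp] := open_subgroup_period cantorG mina sH.
(* A representative depending only on the coset of [w]; composing [f] with it gives an approximation
   constant on cosets. *)
pose rep w : G := xget 0 [set x | H (x - w)].
have repP w : H (rep w - w).
  by rewrite /rep; case: xgetP => [x _ //|/(_ w)]; rewrite /= subrr.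
have repH w x : H x -> rep (w + x) = rep w.
  move=> Hx; rewrite /rep; congr (xget 0 _); apply/seteqP; split=> y /= h.
    have -> : y - w = y - (w + x) + x by rewrite opprD addrA subrK.
    exact: open_subgroupD.
  by rewrite opprD addrA; exact: HB.
pose f0 w := sampling_value f (rep w).
have f0H w x : H x -> f0 (w + x) = f0 w by move=> Hx; rewrite /f0 repH.
have f0f w : normc (f0 w - sampling_value f w) < e / 2.
  by have := fH w _ (repP w); rewrite [w + (rep w - w)]addrC subrK.
have f01 w : normc (f0 w) < 1 by exact: sampling_value_lt1.
pose A n := f0 (a *~ n).
have AP n : A (n + p%:Z) = A n.
  by rewrite /A mulrzDr; apply: f0H; apply/Hp; exact: dvdzz.
have [[x xq tr2]|[K HK]] := gap_dichotomy p0 (fun n => f01 (a *~ n)) AP q12.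
  have [g Hg] := sampling_exists (locally_constant_continuous sH f0H) f01.
  exists g; split.
    by apply: HU => w; rewrite Hg normcBC; apply: lt_trans (f0f w) _; lra.
  exists x => //; apply: (periodic_gap sH p0 Hp) => //.
  - by move=> w y Hy; rewrite !Hg f0H.
  - exact: cayley_circle.
  by under eq_fun do rewrite Hg.
(* Excluding return times up to [K * p] forces the new period [P = k * p] to satisfy [K <= k]. *)
have [H' [sH' H'H H'K]] := exists_open_subgroup_period cantorG mina (K * p)%N sH.
have [P P0 HP] := open_subgroup_period cantorG mina sH'.
have aPH' : H' (a *~ P%:Z) by apply/HP; exact: dvdzz.
have pP : (p %| P)%N by have /Hp := H'H _ aPH'.
pose k := (P %/ p)%N; have PE : P = (k * p)%N by rewrite divnK.
have k0 : (0 < k)%N by rewrite divn_gt0// dvdn_leq.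
have Kk : (K <= k)%N.
  rewrite leqNgt; apply/negP => kK; apply: (H'K P) => //.
  by rewrite P0 PE leq_mul2r ltnW ?orbT.
(* Halving makes both bounds strict: the bump is below [e / 2] and leaves [A 0 + m] in the disk. *)
pose m := Num.min (e / 2) (1 - normc (A 0)) / 2.
have m0 : 0 < m by rewrite divr_gt0// lt_min e20 subr_gt0 f01.
have me : m < e / 2.
  have : Num.min (e / 2) (1 - normc (A 0)) <= e / 2 by rewrite ge_min lexx.
  by rewrite /m; lra.
have m1 : m < 1 - normc (A 0).
  have : Num.min (e / 2) (1 - normc (A 0)) <= 1 - normc (A 0) by rewrite ge_min lexx orbT.
  have : 0 < 1 - normc (A 0) by rewrite subr_gt0 f01.
  by rewrite /m; lra.
have Nm : normc (m%:C%C : R[i]) = m by rewrite normc_real ger0_norm// ltW.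
(* Along the orbit of 0 only the coefficients at multiples of [P] change, as these are the return
   times to [H']. *)
pose h w := if `[< H' w >] then A 0 + m%:C%C else f0 w.
have H'D w x : H' x -> `[< H' (w + x) >] = `[< H' w >].
  move=> Hx; apply: asbool_equiv_eq; split=> hh; last exact: open_subgroupD.
  by rewrite -(addrK x w); have [_ _] := sH'; apply.
have hH w x : H' x -> h (w + x) = h w.
  by move=> Hx; rewrite /h H'D//; case: ifP => // _; apply: f0H; exact: H'H.
have h1 w : normc (h w) < 1.
  rewrite /h; case: ifP => _ //; apply: le_lt_trans (normcD _ _) _.
  by rewrite Nm; lra.
have [g Hg] := sampling_exists (locally_constant_continuous sH' hH) h1.
have bE n : ~~ (P %| n)%Z -> h (a *~ n) = A n.
  by move=> Pn; rewrite /h; case: asboolP => // /HP; rewrite (negbTE Pn).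
have b0 : h (a *~ 0) = A 0 + m%:C%C.
  by rewrite mulr0z /h; case: asboolP => // nH; exfalso; apply: nH; have [] := sH'.
have [||x xq tr2] := HK k Kk k0 (fun n => h (a *~ n)) (fun n => h1 (a *~ n)).
- by move=> n; rewrite -PE; exact: bE.
- rewrite b0 -subr_eq0 addrAC subrr add0r; apply/eqP => /(congr1 (@Normc.normc R)).
  by rewrite Nm Normc.normc0 => h0; rewrite h0 ltxx in m0.
exists g; split.
  apply: HU => w; rewrite Hg normcBC /h; case: asboolP => [H'w|_]; last first.
    by apply: lt_trans (f0f w) _; lra.
  have -> : A 0 = f0 w.
    by rewrite /A mulr0z -[w in RHS]add0r f0H//; exact: H'H.
  have := normcD (f0 w - sampling_value f w) m%:C%C; rewrite addrAC Nm.
  by have := f0f w; lra.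
exists x => //; apply: (periodic_gap sH' P0 HP) => //.
- by move=> w y Hy; rewrite !Hg hH.
- exact: cayley_circle.
by under eq_fun do rewrite Hg; rewrite PE.
Qed.

Lemma almost_periodic f w (e : R) : 0 < e -> exists2 p : nat, (0 < p)%N & forall j n : int,
  normc (cmv_alpha (verblunsky f a w) (n + j * p%:Z) - cmv_alpha (verblunsky f a w) n) <= e.
Proof.
move=> e0; have [H sH fH] := uniformly_continuous_translation cantorG e0 (@sampling_value_continuous _ _ f).
have [p p0 Hp] := open_subgroup_period cantorG mina sH; exists p => // j n.
rewrite !cmv_alpha_verblunsky mulrzDr addrA; apply/ltW/fH; apply/Hp.
by apply: dvdz_mull; exact: dvdzz.
Qed.

Lemma nbhs_circle (z : R[i]) (U : set R[i]) : circle R z ->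
  nbhs (z : subspace (circle R)) U ->
  exists2 d : R, 0 < d & forall z', circle R z' -> normc (z - z') < d -> U z'.
Proof.
move=> Cz /(@nbhs_subspace_ex _ (circle R) U z Cz)[V /nbhs_complexP[d d0 dV] VU].
exists d; first exact: d0.
move=> z' Cz' zz'; have : (V `&` circle R) z' by split; [exact: dV|].
by rewrite -VU => -[].
Qed.

Lemma gaps_cantor_spectrum f w :
  (forall q1 q2 : rat, (ratr q1 : R) < ratr q2 -> gap_set (ratr q1) (ratr q2) f) ->
  circle_cantor_set (spectrum (cmv (verblunsky f a w))).
Proof.
move=> gaps; set E := cmv _.
have isoE : forall u, ell2_normr (E u) = ell2_normr u by exact: cmv_isometry.
have invE : forall u, E (cmv_inv (verblunsky f a w) u) = u by exact: cmv_invK.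
have resP z := resolvent_set_bounded_below isoE invE z.
have specC := spectrum_circle isoE invE.
have clS : closed (spectrum E).
  rewrite -[spectrum E]setCK; apply: open_closedC; rewrite setCK openE => z /resP[c c0 bb].
  apply/nbhs_complexP; exists (c / 2); first by rewrite divr_gt0.
  move=> z' zz; apply/resP; exists (c / 2); first by rewrite divr_gt0.
  move=> u; apply: le_trans (bounded_below_near z' bb u).
  by apply: ler_wpM2r; [exact: ell2_normr_ge0|lra].
split=> //.
- have [z z1 nbb] := approx_eigenvalue isoE 0; exists z => /= /resP; exact.
(* A relative neighborhood inside the spectrum would contain the image of an interval around [x0],
   hence the gap attached to a rational subinterval. *)
- apply/seteqP; split=> // z0 z0S.
  have Sz0 : spectrum E z0 by exact: (nbhs_singleton z0S).
  have Cz0 := specC _ Sz0.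
  have [d d0 dV] := nbhs_circle Cz0 z0S.
  have [x0 x0z] : exists x, cayley x ^+ 2 = z0 by apply: cayley_sqr_surj; exact/circleP.
  have cc2 : ccontinuous (fun x : R => cayley x ^+ 2).
    by apply: ccontinuousM; exact: cayley_ccontinuous.
  have /nbhs_ballP[r /= r0 rx] := ccontinuous_near x0 cc2 d0.
  have [q1] := rat_in_itvoo (ltac:(lra) : x0 - r < x0); rewrite in_itv /= => /andP[q11 q12].
  have [q2] := rat_in_itvoo (ltac:(lra) : x0 < x0 + r); rewrite in_itv /= => /andP[q21 q22].
  have [x /andP[xq1 xq2] [c c0 bb]] := gaps q1 q2 (lt_trans q12 q21).
  have : spectrum E (cayley x ^+ 2).
    apply: dV; first by apply/circleP; rewrite normcX cayley_circle expr1n.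
    rewrite -x0z; apply: rx; rewrite /ball /= ltr_norml.
    by apply/andP; split; lra.
  by apply; apply/resP; exists c; [exact: c0|exact: bb].
- apply/seteqP; split=> // z0 [/set_mem Sz0 [V /nbhs_complexP[d d0 dV] VS]].
  have z01 : normc z0 = 1 by apply/circleP/specC.
  apply: Sz0; apply/resP.
  (* With [d / 4] the points at distance at most [2 * (d / 4)] stay inside the isolating
     neighborhood. *)
  apply: (@cmv_not_isolated _ _ z0 (d / 4)) => //.
  + by move=> e; exact: almost_periodic.
  + by rewrite divr_gt0.
  move=> z z1 zz0 zd; apply/resP; apply: contrapT => zS.
  have : (V `&` spectrum E) z by split => //; apply: dV; rewrite normcBC; lra.
  by rewrite VS => /eqP; apply/negP.
Qed.

End generic_gaps.

Theorem theorem2 (R : realType) (Omega : topologicalZmodType) (a : Omega)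
    (Omega_cantor : cantor_group Omega) (a_minimal : minimal_translation a) :
  exists calR : set (continuousType Omega (disk R)),
    [/\ dense calR, Gdelta calR &
      forall f : continuousType Omega (disk R), calR f -> forall w : Omega,
        circle_cantor_set (spectrum (cmv (verblunsky f a w)))].
Proof.
(* Pairs of rationals are enumerated through their codes; indices coding no pair and empty intervals
   get the whole space. *)
pose F n : set (continuousType Omega (disk R)) :=
  if unpickle n is Some (q1, q2) then
    if (ratr q1 : R) < ratr q2 then gap_set a (ratr q1 : R) (ratr q2) else setT
  else setT.
have oF n : open (F n).
  rewrite /F; case: (unpickle n) => [[q1 q2]|]; last exact: openT.
  by case: ifP => _; [exact: open_gap_set|exact: openT].
have dT : dense [set: continuousType Omega (disk R)] by move=> U U0 _; rewrite setIT.
have dF n : dense (F n).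
  rewrite /F; case: (unpickle n) => [[q1 q2]|]; last exact: dT.
  by case: ifP => q12; [exact: dense_gap_set|exact: dT].
have [cG _ _ _] := Omega_cantor.
exists (\bigcap_n F n); split; first exact: sampling_baire.
  by exists F.
move=> f Ff w; apply: gaps_cantor_spectrum => // q1 q2 q12.
by have := Ff (pickle (q1, q2)) I; rewrite /F pickleK q12.
Qed.
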